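(* Let $\delta>0$ and let $\{x_j:j\in\mathbb{N}\}$ be a complete interpolating sequence for $S_\delta=[-\delta,\delta]^2$. If $0<\beta<(3-\sqrt8)\delta$ and $f\in PW_{B_\beta}$, then \[ \lim_{\alpha\to\infty}\|f-I_\alpha[f]\|_{L^2(\mathbb{R}^2)}=0. \]
   Context: Fourier transform on $\mathbb{R}^2$: $\hat g(\xi)=(2\pi)^{-1}\int g(x)e^{-i\langle\xi,x\rangle}dx$, extended to $L^2$. $PW_S=\{f\in L^2(\mathbb{R}^2):\hat f=0\text{ a.e. outside }S\}$, and $B_\beta=\{\xi\in\mathbb{R}^2:|\xi|\le\beta\}$ (so $PW_{B_\beta}\subset PW_{S_\delta}$ here). $\{x_j\}$ is a complete interpolating sequence for $S_\delta$ if $\{e^{i\langle\cdot,x_j\rangle}\}$ is a Riesz basis of $L^2(S_\delta)$. Poisson kernel $g_\alpha(x)=(2\pi)^{-1}\alpha(\alpha^2+|x|^2)^{-3/2}$. For $f\in PW_{S_\delta}$ and $\alpha>0$, the Poisson interpolant is $I_\alpha[f](x)=\sum_ja_jg_\alpha(x-x_j)$, where $\{a_j\}\in\ell^2$ is the (unique) sequence with $I_\alpha[f](x_k)=f(x_k)$ for all $k\in\mathbb{N}$. *)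

(* Defs.v *)
From HB Require Import structures.
From mathcomp Require Import all_boot all_order all_algebra.
From mathcomp Require Import all_classical all_reals all_analysis.
From mathcomp Require Import complex.
Set Implicit Arguments. Unset Strict Implicit. Unset Printing Implicit Defensive.
Import Order.TTheory GRing.Theory Num.Theory.
Import numFieldNormedType.Exports.
Local Open Scope classical_set_scope.
Local Open Scope ring_scope.

Section Defs.
Variable R : realType.

Definition leb2 := ((@lebesgue_measure R) \x (@lebesgue_measure R))%E.

Definition dot2 (u v : R * R) : R := u.1 * v.1 + u.2 * v.2.
Definition nrm2sq (u : R * R) : R := u.1 ^+ 2 + u.2 ^+ 2.
Definition sub2 (u v : R * R) : R * R := (u.1 - v.1, u.2 - v.2).

Definition expi (t : R) : R[i] := Complex (cos t) (sin t).
Definition cabs2 (z : R[i]) : R := (complex.Re z) ^+ 2 + (complex.Im z) ^+ 2.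

Definition cint (D : set (R * R)) (g : R * R -> R[i]) : R[i] :=
  Complex (Rintegral leb2 D (fun x => complex.Re (g x))) (Rintegral leb2 D (fun x => complex.Im (g x))).

Definition L2on (D : set (R * R)) (f : R * R -> R[i]) : Prop :=
  measurable_fun D (fun x => complex.Re (f x)) /\ measurable_fun D (fun x => complex.Im (f x)) /\
  leb2.-integrable D (fun x => (cabs2 (f x))%:E).

Definition L2sq (D : set (R * R)) (f : R * R -> R[i]) : \bar R :=
  (\int[leb2]_(x in D) (cabs2 (f x))%:E)%E.

Definition ball2 (r : R) : set (R * R) := [set x | nrm2sq x <= r ^+ 2].
Definition S_ (d : R) : set (R * R) := [set x | `|x.1| <= d /\ `|x.2| <= d].
Definition B_ (b : R) : set (R * R) := ball2 b.

Definition fourier_trunc (f : R * R -> R[i]) (r : R) (xi : R * R) : R[i] :=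
  Complex ((2 * pi)^-1) 0 * cint (ball2 r) (fun x => f x * expi (- dot2 xi x)).

Definition is_fourier_L2 (f F : R * R -> R[i]) : Prop :=
  L2on setT F /\
  ((fun r => L2sq setT (fun xi => F xi - fourier_trunc f r xi)) @ +oo --> 0%E).

Definition PW (S : set (R * R)) (f : R * R -> R[i]) : Prop :=
  L2on setT f /\ exists F, is_fourier_L2 f F /\
    {ae leb2, forall xi, ~ S xi -> F xi = 0}.

(* Riesz basis {e^{i<.,x_j>}} of L^2(S) : complete, with Riesz bounds *)
Definition csum (N : nat) (c : nat -> R[i]) (x : nat -> R * R) : R * R -> R[i] :=
  fun xi => \sum_(j < N) c j * expi (dot2 xi (x j)).

Definition complete_interpolating (S : set (R * R)) (x : nat -> R * R) : Prop :=
  (exists A B : R, 0 < A /\ 0 < B /\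
     forall (N : nat) (c : nat -> R[i]),
       ((A * \sum_(j < N) cabs2 (c j))%R%:E <= L2sq S (csum N c x))%E /\
       (L2sq S (csum N c x) <= (B * \sum_(j < N) cabs2 (c j))%R%:E)%E) /\
  (forall g, L2on S g -> forall eps : R, 0 < eps ->
     exists N c, (L2sq S (fun xi => (g xi - csum N c x xi)%R) < eps%:E)%E).

Definition poisson (a : R) (x : R * R) : R :=
  (2 * pi)^-1 * a * powR (a ^+ 2 + nrm2sq x) (- (3 / 2)).

Definition ell2 (a : nat -> R[i]) : Prop := cvgn (series (fun j => cabs2 (a j))).

Definition poisson_sum (al : R) (a : nat -> R[i]) (x : nat -> R * R) (y : R * R) : R[i] :=
  Complex (limn (series (fun j => complex.Re (a j) * poisson al (sub2 y (x j)))))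
  (limn (series (fun j => complex.Im (a j) * poisson al (sub2 y (x j))))).

End Defs.

(* Main.v *)
Require Import Defs.
From HB Require Import structures.
From mathcomp Require Import all_boot all_order all_algebra.
From mathcomp Require Import all_classical all_reals all_analysis.
From mathcomp Require Import measurable_realfun complex ring lra.
Set Implicit Arguments.
Unset Strict Implicit.
Unset Printing Implicit Defensive.
Import Order.TTheory GRing.Theory Num.Theory.
Import numFieldNormedType.Exports.
Local Open Scope classical_set_scope.
Local Open Scope ring_scope.

(* Write f as the Fourier integral of F, let G be the Fourier symbol of the Poisson
   kernel and let Psi be the exponential sum with the coefficients of the
   interpolant. Then f - I_alpha[f] is the Fourier integral of h = F - G Psi, and
   the interpolation conditions say that h is orthogonal to every exponential
   e^{i<.,x_k>}.
   - Pairing h with Psi gives int G|Psi|^2 <= |F|^2 / m, where m is the minimum of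
     G on the ball of radius beta.
   - Outside the square F vanishes, so int |h|^2 there is at most K int G|Psi|^2
     with K a bound for G off the square.
   - Inside the square h is approximated by exponential sums, to which it is
     orthogonal up to its part outside the square; the Riesz lower bound and the
     Bessel inequality then control the inner part of h by the outer one.
   Hence |h|^2 <= C (K / m) |F|^2. Subordination of the Poisson kernel to Gaussians
   gives K <= C e^{-alpha delta / 2} and m >= c e^{-2 alpha beta}, up to constant
   factors; this decays since 3 - sqrt 8 < 1/4. The infinite sum Psi is handled by
   truncation, which makes h only almost orthogonal, followed by Fatou's lemma. *)

(** * Integrals of real-valued functions *)

Section RealIntegral.
Context {d} {T : measurableType d} {R : realType} (m : {measure set T -> \bar R}).
Implicit Types f g h : T -> R.

(** Two obstacles shape the development. The nodes see point values of f, while its Fourier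
    transform is only an L2 limit of truncated integrals. Pointwise statements are therefore
    obtained by testing with Gaussians, whose transform comes from a differential equation: a
    Gaussian average of f is a Gaussian-weighted integral of F, and continuity of f removes the
    average. The same weights give a Plancherel inequality with constant 8 pi^2, twice the sharp
    one; the loss is harmless because only a limit is claimed. Secondly, the Riesz bounds speak of
    the square alone, while G Psi lives on the whole plane. Averaging the upper bound over
    translates of the square turns it into a Bessel inequality on the plane with the weight
    e^(-|xi_1| - |xi_2|). The decay of G is split so that a part independent of alpha supplies this
    weight; this costs no more than a factor e^(2 delta) in K / m, and the rate in alpha stays delta
    / 2 - 2 beta. *)

Definition intg f := m.-integrable setT (EFin \o f).

Lemma intg_meas f : intg f -> measurable_fun setT f.
Proof. by move=> /integrableP[/measurable_EFinP]. Qed.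

Lemma intg_le f g : measurable_fun setT f -> (forall x, `|f x| <= g x) ->
  intg g -> intg f.
Proof.
move=> mf fg; apply: le_integrable => //; first exact/measurable_EFinP.
by move=> x _ /=; rewrite lee_fin (le_trans (fg x))// ler_norm.
Qed.

Lemma eq_intg f g : f =1 g -> intg f -> intg g.
Proof. by move=> /funext ->. Qed.

Lemma intg0 : intg (fun=> 0).
Proof. exact: integrable0. Qed.

Lemma intgZ r f : intg f -> intg (fun x => r * f x).
Proof. exact: integrableZl. Qed.

Lemma intgN f : intg f -> intg (fun x => - f x).
Proof. exact: integrableN. Qed.

Lemma intgD f g : intg f -> intg g -> intg (fun x => f x + g x).
Proof. by move=> fi gi; exact: integrableD fi gi. Qed.

Lemma intgB f g : intg f -> intg g -> intg (fun x => f x - g x).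
Proof. by move=> fi gi; exact/intgD/intgN. Qed.

Lemma intg_norm f : intg f -> intg (fun x => `|f x|).
Proof. exact: integrable_norm. Qed.

Lemma intg_bM f h (M : R) : measurable_fun setT h -> (forall x, `|h x| <= M) ->
  intg f -> intg (fun x => h x * f x).
Proof.
move=> mh hM fi; apply: (@intg_le _ (fun x => M * `|f x|)).
- by apply: measurable_funM => //; exact: intg_meas.
- by move=> x; rewrite normrM ler_wpM2r.
- exact/intgZ/intg_norm.
Qed.

Lemma RI_fin f : intg f -> (\int[m]_x (f x)%:E = (\int[m]_x f x)%:E)%E.
Proof. by move=> fi; rewrite /Rintegral fineK//; exact: integrable_fin_num. Qed.

Lemma RIZ r f : intg f -> \int[m]_x (r * f x) = r * \int[m]_x f x.
Proof. by move=> fi; rewrite RintegralZl. Qed.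

Lemma RIN f : intg f -> \int[m]_x (- f x) = - \int[m]_x f x.
Proof.
move=> fi; rewrite -mulN1r -RIZ//; apply: eq_Rintegral => x _.
by rewrite mulN1r.
Qed.

Lemma RID f g : intg f -> intg g ->
  \int[m]_x (f x + g x) = \int[m]_x f x + \int[m]_x g x.
Proof. by move=> fi gi; rewrite RintegralD. Qed.

Lemma RIB f g : intg f -> intg g ->
  \int[m]_x (f x - g x) = \int[m]_x f x - \int[m]_x g x.
Proof. by move=> fi gi; rewrite RintegralB. Qed.

Lemma le_RI f g : intg f -> intg g -> (forall x, f x <= g x) ->
  \int[m]_x f x <= \int[m]_x g x.
Proof. by move=> fi gi fg; apply: le_Rintegral. Qed.

Lemma RI_ge0 f : (forall x, 0 <= f x) -> 0 <= \int[m]_x f x.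
Proof. by move=> f0; apply: Rintegral_ge0. Qed.

Lemma RI_ext f g : f =1 g -> \int[m]_x f x = \int[m]_x g x.
Proof. by move=> /funext ->. Qed.

Lemma intg_ge0P f : measurable_fun setT f -> (forall x, 0 <= f x) ->
  (\int[m]_x (f x)%:E < +oo)%E -> intg f.
Proof.
move=> mf f0 fi; apply/integrableP; split; first exact/measurable_EFinP.
by under eq_integral do rewrite /= ger0_norm//.
Qed.

Lemma intg_limn (F : nat -> T -> R) f g :
  (forall n, measurable_fun setT (F n)) -> measurable_fun setT f ->
  (forall x, F n x @[n --> \oo] --> f x) -> intg g ->
  (forall n x, `|F n x| <= g x) ->
  \int[m]_x F n x @[n --> \oo] --> \int[m]_x f x.
Proof.
move=> mF mf Ff gi Fg.
have [fi _ cv] : [/\ m.-integrable setT (EFin \o f),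
   [sequence (\int[m]_(x in setT) (`|(F n x)%:E - (f x)%:E|))%E]_n @ \oo --> 0%E &
   [sequence (\int[m]_(x in setT) (F n x)%:E)%E]_n @ \oo
     --> (\int[m]_(x in setT) (f x)%:E)%E].
  apply: (@dominated_convergence _ _ _ m setT measurableT
    (fun n x => (F n x)%:E) (EFin \o f) (EFin \o g)).
  - by move=> n; exact/measurable_EFinP.
  - exact/measurable_EFinP.
  - by apply: aeW => x _; apply: cvg_EFin; [exact: nearW|exact: Ff].
  - exact: gi.
  - by apply: aeW => x n _; rewrite lee_fin.
have Fi n : intg (F n) by apply: intg_le gi.
move: cv; rewrite RI_fin// => cv; apply: fine_cvg.
by apply: cvg_trans cv; apply: near_eq_cvg; apply: nearW => n /=.
Qed.

End RealIntegral.

(** * Fubini and Tonelli for real-valued functions *)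

Section Product.
Context {d1 d2} {T1 : measurableType d1} {T2 : measurableType d2} {R : realType}.
Variables (m1 : {sigma_finite_measure set T1 -> \bar R})
          (m2 : {sigma_finite_measure set T2 -> \bar R}).

Lemma intg_prod (u : T1 -> R) (v : T2 -> R) : intg m1 u -> intg m2 v ->
  intg (m1 \x m2)%E (fun z => u z.1 * v z.2).
Proof.
move=> ui vi.
have mu' := intg_meas ui; have mv := intg_meas vi.
apply/integrable12ltyP.
  apply/measurable_EFinP; apply: measurable_funM.
    exact: (measurableT_comp mu').
  exact: (measurableT_comp mv).
have -> : (\int[m1]_x \int[m2]_y `|(EFin \o (fun z : T1 * T2 => u z.1 * v z.2)%R) (x, y)| =
  \int[m1]_x (`|u x| * \int[m2]_y `|v y|)%:E)%E.
  apply: eq_integral => x _ /=.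
  under eq_integral do rewrite normrM.
  have vi' := intg_norm vi.
  by rewrite RI_fin ?RIZ//; exact: intgZ.
rewrite -/(is_true _).
have /integrable_lty : intg m1 (fun x => (\int[m2]_y `|v y|) * `|u x|).
  exact/intgZ/intg_norm.
move=> /(_ measurableT) /=.
by under eq_integral do rewrite mulrC.
Qed.

(** Every section, and not just almost every one, is assumed integrable: the inner integrals are
    then finite everywhere, so the extended-real theorem transfers to real integrals pointwise. *)
Lemma Rfubini (f : T1 * T2 -> R) : intg (m1 \x m2)%E f ->
  (forall x, intg m2 (fun y => f (x, y))) ->
  (forall y, intg m1 (fun x => f (x, y))) ->
  [/\ intg m1 (fun x => \int[m2]_y f (x, y)),
      \int[(m1 \x m2)%E]_z f z = \int[m1]_x \int[m2]_y f (x, y) &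
      \int[m1]_x \int[m2]_y f (x, y) = \int[m2]_y \int[m1]_x f (x, y)].
Proof.
move=> fi fi1 fi2.
have F1 := @integrable_fubini_F _ _ _ _ _ m1 m2 _ fi.
have F1E : fubini_F m2 (EFin \o f) = EFin \o (fun x => \int[m2]_y f (x, y)).
  by apply/funext => x; rewrite /fubini_F /= RI_fin.
have G1E : fubini_G m1 (EFin \o f) = EFin \o (fun y => \int[m1]_x f (x, y)).
  by apply/funext => y; rewrite /fubini_G /= RI_fin.
have E1 := @integral12_prod_meas1 _ _ _ _ _ m1 m2 _ fi.
have E2 := @integral21_prod_meas1 _ _ _ _ _ m1 m2 _ fi.
rewrite F1E in F1 E1; rewrite G1E in E2.
split => //; rewrite /Rintegral; congr fine.
  by rewrite -E1.
by rewrite /= in E1 E2; rewrite E1 E2.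
Qed.

Lemma tonelli_intg (f : T1 * T2 -> R) : measurable_fun setT f ->
  (forall z, 0 <= f z) ->
  (forall x, intg m2 (fun y => f (x, y))) ->
  intg m1 (fun x => \int[m2]_y f (x, y)) -> intg (m1 \x m2)%E f.
Proof.
move=> mf f0 fi Fi; apply/integrable12ltyP; first exact/measurable_EFinP.
have := integrable_lty measurableT Fi; congr (_ < _)%E.
apply: eq_integral => x _ /=; rewrite -RI_fin//.
by apply: eq_integral => y _; rewrite ger0_norm.
Qed.

End Product.

(** * Measure-preserving maps and translations *)

Definition pushm {d1 d2} {T1 : measurableType d1} {T2 : measurableType d2}
    {R : realType} (m : {measure set T1 -> \bar R}) (phi : T1 -> T2)
    (mphi : measurable_fun setT phi) : {measure set T2 -> \bar R} :=
  measure_function_pushforward__canonical__measure_function_Measure m mphi.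

Section Invariance.
Context {d} {T : measurableType d} {R : realType} (m : {measure set T -> \bar R}).
Variable phi : T -> T.
Hypothesis mphi : measurable_fun setT phi.
Hypothesis inv : forall A, measurable A -> m (phi @^-1` A) = m A.

Lemma integral_invariant (f : T -> R) : measurable_fun setT f ->
  (forall x, 0 <= f x) ->
  (\int[m]_x (f (phi x))%:E = \int[m]_x (f x)%:E)%E.
Proof.
move=> mf f0.
transitivity (\int[pushforward m phi]_x (f x)%:E)%E.
  rewrite ge0_integral_pushforward//=; last by move=> x _; rewrite lee_fin.
  exact/measurable_EFinP.
by apply: (@eq_measure_integral _ _ _ setT m (pushm m mphi)) => A mA _; exact: inv.
Qed.

Lemma intg_invariant (f : T -> R) : (forall x, 0 <= f x) -> intg m f ->
  intg m (f \o phi).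
Proof.
move=> f0 fi; have mf := intg_meas fi; apply: intg_ge0P.
- exact: measurableT_comp.
- by move=> x /=.
- by rewrite /= integral_invariant//; exact: integrable_lty fi.
Qed.

Lemma RI_invariant (f : T -> R) : measurable_fun setT f -> (forall x, 0 <= f x) ->
  \int[m]_x f (phi x) = \int[m]_x f x.
Proof. by move=> mf f0; rewrite /Rintegral integral_invariant. Qed.

End Invariance.

Section Translation.
Context {R : realType}.
Local Notation mu := (@lebesgue_measure R).

(** The translated measure gives every half-open interval its length, and Lebesgue measure is the
    only one that does. The plane case is the same argument with rectangles. *)
Lemma leb_shift (a : R) A : measurable A -> mu ((fun x => x + a) @^-1` A) = mu A.
Proof.
have ma : measurable_fun setT (fun x : measurableTypeR R => x + a : measurableTypeR R).
  exact: measurable_funD.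
move=> mA; apply/esym.
apply: (@lebesgue_measure_unique R (pushm mu ma)) => // X.
case=> -[b c] _ <- /=; rewrite /= /pushforward.
have -> : (fun x => x + a) @^-1` [set` `]b, c]%R] = [set` `]b - a, c - a]%R].
  by apply/seteqP; split => x /=; rewrite !in_itv/= ltrBlDr lerBrDr.
by rewrite !lebesgue_measure_itv /= !lte_fin ltrD2r; case: ifP => // _;
  rewrite -!EFinB; congr EFin; ring.
Qed.

Lemma leb2_shift (a : R * R) A : measurable A ->
  @leb2 R ((fun x => (x.1 + a.1, x.2 + a.2)) @^-1` A) = @leb2 R A.
Proof.
have ma : measurable_fun setT (fun x : measurableTypeR R * measurableTypeR R =>
    (x.1 + a.1, x.2 + a.2) : measurableTypeR R * measurableTypeR R).
  by apply/measurable_fun_pairP; split => /=; exact: measurable_funD.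
move=> mA; apply/esym.
apply: (@product_measure_unique _ _ _ _ _ mu mu
  (pushm (@leb2 R) ma)) => // X Y mX mY.
rewrite /= /pushforward.
have -> : (fun x : R * R => (x.1 + a.1, x.2 + a.2)) @^-1` (X `*` Y) =
  ((fun x => x + a.1) @^-1` X) `*` ((fun x => x + a.2) @^-1` Y).
  by apply/seteqP; split => -[x y].
rewrite /leb2 product_measure1E.
- by congr (_ * _)%E; exact: leb_shift.
- by rewrite -[X in measurable X]setTI; apply: measurable_funD.
- by rewrite -[X in measurable X]setTI; apply: measurable_funD.
Qed.

End Translation.

(** * The integral of a derivative over the line *)

Section Derivative.
Context {R : realType}.
Local Notation mu := (@lebesgue_measure R).

Lemma eventually_eq_cvg (u : nat -> R) l N : (forall n, (N <= n)%N -> u n = l) ->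
  u n @[n --> \oo] --> l.
Proof. by move=> uE; apply: cvg_near_cst; exists N => // n /= /uE ->. Qed.

(** The fundamental theorem on [-(n+1), n+1] yields a difference of boundary values that tends to 0,
    and dominated convergence with bound |f| recovers the full integral. The shift to n+1 keeps the
    interval nondegenerate. All integrations by parts below are instances. *)
Lemma RI_derivative_eq0 (F f : R -> R) :
  (forall x : R, is_derive x 1 F (f x)) -> continuous f -> intg mu f ->
  F x @[x --> +oo] --> 0 -> F x @[x --> -oo] --> 0 ->
  \int[mu]_x f x = 0.
Proof.
move=> dF cf fi Fy FNy.
have mf := intg_meas fi.
pose I n : set R := [set` `[- n.+1%:R, n.+1%:R]%R].
pose h n x := \1_(I n) x * f x.
have cv1 : \int[mu]_x h n x @[n --> \oo] --> \int[mu]_x f x.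
  apply: (@intg_limn _ _ _ mu h f (fun x => `|f x|)) => //.
  - move=> n; rewrite /h; apply: measurable_funM; last exact: mf.
    by apply: measurable_indic; exact: measurable_itv.
  - move=> x.
    have [N hN] : exists N : nat, `|x| <= N%:R.
      by exists (Num.truncn `|x|).+1; rewrite ltW// truncnS_gt.
    apply: (@eventually_eq_cvg (h ^~ x) _ N) => n Nn; rewrite /h indicE mem_set ?mul1r//.
    rewrite /I /= in_itv /= -ler_norml (le_trans hN)// ler_nat.
    exact: leq_trans Nn _.
  - exact: intg_norm.
  - move=> n x; rewrite /h normrM indicE.
    by case: (x \in _); rewrite /= ?normr1 ?normr0 ?mul1r ?mul0r.
have hE n : \int[mu]_x h n x = F n.+1%:R - F (- n.+1%:R).
  have lt : (- n.+1%:R < n.+1%:R :> R) by rewrite gtrN.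
  have cF x : {for x, continuous F}.
    have /@ex_derive := dF x.
    by move=> /derivable1_diffP /differentiable_continuous.
  have := @continuous_FTC2 R f F _ _ lt.
  move=> /(_ _ _ _) => H.
  rewrite /Rintegral.
  have -> : (\int[mu]_x (h n x)%:E = \int[mu]_(x in I n) (f x)%:E)%E.
    rewrite [RHS]integral_mkcond; apply: eq_integral => x _.
    by rewrite /h patchE indicE; case: (x \in _); rewrite ?mul1r ?mul0r.
  rewrite /I H//.
  - exact: continuous_subspaceT.
  - split => [x _||].
    + by have /@ex_derive := dF x.
    + exact/cvg_at_right_filter/cF.
    + exact/cvg_at_left_filter/cF.
  - by move=> x _; rewrite derive1E; have [_ ->] := dF x.
have cv2 : \int[mu]_x h n x @[n --> \oo] --> 0 - (0 : R).
  under eq_fun do rewrite hE.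
  apply: cvgB.
    apply: (cvg_comp (fun n => n.+1%:R) F _ Fy).
    by apply/cvgryPge => A; exists (Num.truncn `|A|).+1 => // n /= An;
      rewrite (le_trans (ler_norm A))// (le_trans (ltW (Num.Theory.truncnS_gt _)))// ler_nat ltnW.
  apply: (cvg_comp (fun n => - n.+1%:R) F _ FNy).
  apply/cvgrNyPle => A; exists (Num.truncn `|A|).+1 => // n /= An.
  rewrite lerNl (le_trans (ler_norm _))// normrN (le_trans (ltW (Num.Theory.truncnS_gt _)))// ler_nat ltnW//.
by rewrite (cvg_unique _ cv1 cv2)// subr0.
Qed.

End Derivative.

(** * Gaussians on the line and their moments *)

Section Gaussian.
Context {R : realType}.
Local Notation mu := (@lebesgue_measure R).
Implicit Types s x y c t : R.

Definition gs s x := expR (- (s * x ^+ 2)).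

Lemma gs_ge0 s x : 0 <= gs s x. Proof. exact: expR_ge0. Qed.

Lemma gs_le1 s x : 0 <= s -> gs s x <= 1.
Proof. by move=> s0; rewrite -expR0 ler_expR oppr_le0 mulr_ge0// sqr_ge0. Qed.

Lemma is_derive_gs s x : is_derive x 1 (gs s) (- (2 * s * x) * gs s x).
Proof.
rewrite /gs.
have := @is_derive1_comp R expR (fun x => - (s * x ^+ 2)) x
   (expR (- (s * x ^+ 2))) (- (2 * s * x)) (is_derive_expR _).
move=> H; apply: is_derive_eq.
rewrite /GRing.scale /=; ring.
Qed.

Lemma continuous_gs s : continuous (gs s).
Proof.
by move=> x; have /@ex_derive := is_derive_gs s x;
  move=> /derivable1_diffP /differentiable_continuous.
Qed.

Lemma measurable_gs s : measurable_fun setT (gs s).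
Proof. apply: continuous_measurable_fun; exact: continuous_gs. Qed.

Lemma gs_int s : 0 < s -> intg mu (gs s) /\ \int[mu]_x gs s x = Num.sqrt (pi / s).
Proof.
move=> s0.
(* The standard deviation for which the normal density is proportional to [gs s]; its total mass 1
   then gives the integral. *)
pose sg := Num.sqrt (2 * s)^-1.
have sg2 : sg ^+ 2 = (2 * s)^-1 by rewrite sqr_sqrtr// invr_ge0 mulr_ge0// ltW.
have sg0 : sg != 0 by rewrite gt_eqF// sqrtr_gt0 invr_gt0 mulr_gt0.
have pE x : normal_pdf 0 sg x = (Num.sqrt (pi / s))^-1 * gs s x.
  rewrite normal_pdfE//= /normal_peak /normal_fun sg2 /gs.
  congr ((Num.sqrt _)^-1 * expR _); first by field; rewrite gt_eqF.
  by rewrite subr0; field; rewrite gt_eqF.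
have q0 : 0 < Num.sqrt (pi / s) by rewrite sqrtr_gt0 divr_gt0// pi_gt0.
have fi : intg mu (gs s).
  have := @integrable_normal_pdf R 0 sg => /(intgZ (Num.sqrt (pi / s))).
  by apply: eq_intg => x; rewrite pE mulrA divff ?mul1r// gt_eqF.
split=> //.
have : \int[mu]_x normal_pdf 0 sg x = 1.
  by rewrite /Rintegral integral_normal_pdf.
under eq_Rintegral do rewrite pE.
rewrite RIZ// => /(congr1 (fun u => Num.sqrt (pi / s) * u)).
by rewrite mulr1 mulrA divff ?mul1r// gt_eqF.
Qed.

(** Half of the exponent absorbs the square, by u e^(-u) <= 1 with u = s x^2 / 2; the other half
    remains as an integrable Gaussian. *)
Lemma sqr_gs_le s x : 0 < s -> x ^+ 2 * gs s x <= 2 / s * gs (s / 2) x.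
Proof.
move=> s0; have h := expR_ge1Dx (s / 2 * x ^+ 2).
have -> : gs s x = gs (s / 2) x * gs (s / 2) x.
  by rewrite /gs -expRD; congr expR; field.
have g0 := gs_ge0 (s / 2) x.
have gK : gs (s / 2) x * expR (s / 2 * x ^+ 2) = 1.
  by rewrite /gs -expRD addrC subrr expR0.
rewrite mulrA ler_wpM2r// mulrC ler_pdivlMr//.
have : gs (s / 2) x * (s / 2 * x ^+ 2) <= 1.
  by rewrite -[leRHS]gK ler_wpM2l//; lra.
nra.
Qed.

Lemma sqr_gs_int s : 0 < s -> intg mu (fun x => x ^+ 2 * gs s x).
Proof.
move=> s0; apply: (@intg_le _ _ _ mu _ (fun x => 2 / s * gs (s / 2) x)).
- by apply: measurable_funM; [exact: measurable_funX|exact: measurable_gs].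
- move=> x; rewrite normrM (ger0_norm (gs_ge0 _ _)) (ger0_norm (sqr_ge0 _)).
  exact: sqr_gs_le.
- by apply: intgZ; apply: (gs_int _).1; rewrite divr_gt0.
Qed.

Lemma measurable_norm_id : measurable_fun setT (fun x : R => `|x|).
Proof. exact: normr_measurable. Qed.

Lemma abs_gs_int s : 0 < s -> intg mu (fun x => `|x| * gs s x).
Proof.
move=> s0; apply: (@intg_le _ _ _ mu _ (fun x => gs s x + x ^+ 2 * gs s x)).
- by apply: measurable_funM; [exact: measurable_norm_id|exact: measurable_gs].
- move=> x; rewrite normrM normr_id (ger0_norm (gs_ge0 _ _)).
  rewrite -[X in _ <= X + _]mul1r -mulrDl ler_wpM2r ?gs_ge0//.
  rewrite -real_normK ?num_real//; have := sqr_ge0 (`|x| - 1); have := normr_ge0 x; nra.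
- by apply: intgD; [exact: (gs_int _).1|exact: sqr_gs_int].
Qed.

Lemma cvg0_of_decay (F : R -> R) C : (forall x, `|x| * `|F x| <= C) ->
  (F x @[x --> +oo] --> 0) /\ (F x @[x --> -oo] --> 0).
Proof.
move=> FC.
have C0 : 0 <= C by have := FC 0; rewrite normr0 mul0r.
have H e x : 0 < e -> (C + 1) / e <= `|x| -> `|F x| <= e.
  move=> e0; rewrite ler_pdivrMr// => h; have := FC x.
  have [//|lt] := leP (`|F x|) e.
  have x0 : 0 < `|x| by have := normr_ge0 x; nra.
  by nra.
split; apply/cvgrPdist_le => e e0; near=> x; rewrite sub0r normrN; apply: H => //.
  rewrite (le_trans _ (ler_norm x))//; near: x; apply: nbhs_pinfty_ge; exact: num_real.
rewrite -normrN (le_trans _ (ler_norm _))// lerNr; near: x; apply: nbhs_ninfty_le; exact: num_real.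
Unshelve. all: by end_near. Qed.

Lemma gs_decay s x : 0 < s -> `|x| * gs s x <= 1 + 2 / s /\
   `|x| * (`|x| * gs s x) <= 2 / s.
Proof.
move=> s0.
have h : x ^+ 2 * gs s x <= 2 / s.
  rewrite (le_trans (sqr_gs_le x s0))// -[leRHS]mulr1 ler_wpM2l//.
    by rewrite divr_ge0// ltW.
  by apply: gs_le1; rewrite divr_ge0// ltW.
have g0 := gs_ge0 s x; have g1 := gs_le1 x (ltW s0).
have n0 := normr_ge0 x.
split; last by rewrite mulrA -expr2 real_normK ?num_real.
apply: (@le_trans _ _ (gs s x + x ^+ 2 * gs s x)); last by lra.
rewrite -[X in _ <= X + _]mul1r -mulrDl ler_wpM2r//.
rewrite -real_normK ?num_real//; have := sqr_ge0 (`|x| - 1); nra.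
Qed.

(** The derivative of [x * gs s x] is gs s x - 2 s x^2 gs s x, and its integral vanishes. *)
Lemma sqr_gs_RI s : 0 < s ->
  \int[mu]_x (x ^+ 2 * gs s x) = Num.sqrt (pi / s) / (2 * s).
Proof.
move=> s0; have [gi gE] := gs_int s0; have g2i := sqr_gs_int s0.
have : \int[mu]_x (gs s x - (2 * s) * (x ^+ 2 * gs s x)) = 0.
  have [d1 d2] : (x * gs s x @[x --> +oo] --> 0) /\ (x * gs s x @[x --> -oo] --> 0).
    apply: (@cvg0_of_decay _ (2 / s)) => x; rewrite normrM (ger0_norm (gs_ge0 _ _)).
    exact: (gs_decay x s0).2.
  apply: (@RI_derivative_eq0 _ (fun x => x * gs s x)) => //.
  - move=> x; have H := is_derive_gs s x.
    apply: is_derive_eq; rewrite /GRing.scale /=; ring.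
  - move=> x; apply: cvgB; first exact: continuous_gs.
    apply: cvgM; first exact: cvg_cst.
    by apply: cvgM; [exact: exprn_continuous|exact: continuous_gs].
  - by apply: intgB => //; exact: intgZ.
rewrite RIB//; last exact: intgZ.
rewrite RIZ// gE => /eqP; rewrite subr_eq0 => /eqP ->.
by field; rewrite gt_eqF.
Qed.

Lemma is_derive_cos_lin (y c t : R) :
  is_derive t 1 (fun t : R => cos (t * y + c)) (- (y * sin (t * y + c))).
Proof.
have H1 : is_derive t 1 (fun t : R => t * y + c) y.
  by apply: is_derive_eq; rewrite /GRing.scale /=; ring.
have := @is_derive1_comp R cos _ t _ _ (is_derive_cos (t * y + c)) H1.
by move=> H; apply: is_derive_eq; ring.
Qed.

Lemma is_derive_sin_lin (y c t : R) :
  is_derive t 1 (fun t : R => sin (t * y + c)) (y * cos (t * y + c)).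
Proof.
have H1 : is_derive t 1 (fun t : R => t * y + c) y.
  by apply: is_derive_eq; rewrite /GRing.scale /=; ring.
have := @is_derive1_comp R sin _ t _ _ (is_derive_sin (t * y + c)) H1.
by move=> H; apply: is_derive_eq; ring.
Qed.
End Gaussian.

(** * The Fourier transform of a Gaussian on the line *)

Section GaussianFourier.
Context {R : realType}.
Local Notation mu := (@lebesgue_measure R).
Implicit Types s x y c t : R.

Lemma cos_norm_le1 x : `|cos x| <= 1.
Proof. by rewrite ler_norml cos_geN1 cos_le1. Qed.

Lemma sin_norm_le1 x : `|sin x| <= 1.
Proof. by rewrite ler_norml sin_geN1 sin_le1. Qed.

Lemma continuous_cos_lin y c : continuous (fun t : R => cos (t * y + c)).
Proof.
move=> t; have /@ex_derive := is_derive_cos_lin y c t.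
by move=> /derivable1_diffP /differentiable_continuous.
Qed.

Lemma continuous_sin_lin y c : continuous (fun t : R => sin (t * y + c)).
Proof.
move=> t; have /@ex_derive := is_derive_sin_lin y c t.
by move=> /derivable1_diffP /differentiable_continuous.
Qed.

Lemma measurable_cos_lin y c : measurable_fun setT (fun t : R => cos (t * y + c)).
Proof. apply: continuous_measurable_fun; exact: continuous_cos_lin. Qed.

Lemma measurable_sin_lin y c : measurable_fun setT (fun t : R => sin (t * y + c)).
Proof. apply: continuous_measurable_fun; exact: continuous_sin_lin. Qed.

Lemma gs_cos_int s y c : 0 < s -> intg mu (fun t => gs s t * cos (t * y + c)).
Proof.
move=> s0; apply: (@intg_le _ _ _ mu _ (gs s)).
- by apply: measurable_funM; [exact: measurable_gs|exact: measurable_cos_lin].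
- move=> t; rewrite normrM (ger0_norm (gs_ge0 _ _)) ler_piMr ?gs_ge0//.
  exact: cos_norm_le1.
- exact: (gs_int s0).1.
Qed.

Lemma t_gs_sin_int s y c : 0 < s -> intg mu (fun t => t * gs s t * sin (t * y + c)).
Proof.
move=> s0; apply: (@intg_le _ _ _ mu _ (fun t => `|t| * gs s t)).
- apply: measurable_funM; last exact: measurable_sin_lin.
  by apply: measurable_funM; last exact: measurable_gs.
- move=> t; rewrite 2!normrM (ger0_norm (gs_ge0 _ _)) ler_piMr ?sin_norm_le1//.
  by rewrite mulr_ge0// gs_ge0.
- exact: abs_gs_int.
Qed.

(** The phase [c] lets one real computation serve both parts of the complex Fourier integral: phase
    0 gives the cosine part and phase -pi/2 the sine part. *)
Definition gsPhi s c y := \int[mu]_t (gs s t * cos (t * y + c)).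

(** Integration by parts: the derivative of [gs s t * sin (t * y + c)] in t has integral 0. *)
Lemma gsPhi_parts s c y : 0 < s ->
  \int[mu]_t (t * gs s t * sin (t * y + c)) = y / (2 * s) * gsPhi s c y.
Proof.
move=> s0; have i1 := t_gs_sin_int y c s0; have i2 := gs_cos_int y c s0.
have : \int[mu]_t (y * (gs s t * cos (t * y + c)) -
    2 * s * (t * gs s t * sin (t * y + c))) = 0.
  have [d1 d2] : (gs s t * sin (t * y + c) @[t --> +oo] --> 0) /\
     (gs s t * sin (t * y + c) @[t --> -oo] --> 0).
    apply: (@cvg0_of_decay _ _ (1 + 2 / s)) => x.
    rewrite normrM (ger0_norm (gs_ge0 _ _)) (le_trans _ (gs_decay x s0).1)//.
    by rewrite ler_wpM2l// ler_piMr ?gs_ge0 ?sin_norm_le1.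
  apply: (@RI_derivative_eq0 _ (fun t => gs s t * sin (t * y + c))) => //.
  - move=> t; have H1 := is_derive_gs s t; have H2 := is_derive_sin_lin y c t.
    by apply: is_derive_eq; rewrite /GRing.scale /=; ring.
  - move=> t; apply: cvgB; apply: cvgM; try exact: cvg_cst.
      by apply: cvgM; [exact: continuous_gs|exact: continuous_cos_lin].
    apply: cvgM; last exact: continuous_sin_lin.
    by apply: cvgM; [exact: cvg_id|exact: continuous_gs].
  - by apply: intgB => //; exact: intgZ.
rewrite RIB; [|exact: intgZ|exact: intgZ].
rewrite !RIZ// -/(gsPhi s c y) => /eqP; rewrite subr_eq0 => /eqP E.
apply: (@mulfI _ (2 * s)); first by rewrite mulf_neq0// gt_eqF.
by rewrite -E; field; rewrite gt_eqF.
Qed.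

(** Differentiation under the integral, dominated by |t| gs s t; the integration by parts above then
    turns the result into a linear differential equation for [gsPhi s c]. *)
Lemma is_derive_gsPhi s c y : 0 < s ->
  is_derive y 1 (gsPhi s c) (- (y / (2 * s) * gsPhi s c y)).
Proof.
move=> s0.
pose f (y t : R) : R := gs s t * cos (t * y + c).
have df (z t : R) : is_derive z 1 (f ^~ t) (- (t * gs s t * sin (t * z + c))).
  have H : is_derive z 1 (fun z : R => cos (z * t + c)) (- (t * sin (z * t + c))).
    exact: is_derive_cos_lin.
  rewrite /f; under eq_fun do rewrite [t * _]mulrC.
  by apply: is_derive_eq; rewrite /GRing.scale /= [z * t]mulrC; ring.
have d1 (z t : R) : partial1of2 f z t = - (t * gs s t * sin (t * z + c)).
  by rewrite partial1of2E; have [_ ->] := df z t.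
have Iy : (`]y - 1, y + 1[%classic : set R) y.
  by rewrite /= in_itv /= ltrBlDr ltrDl ltr01.
have fi z : intg mu (f z) by exact: gs_cos_int.
have G0 (t : R) : 0 <= `|t| * gs s t by rewrite mulr_ge0// gs_ge0.
have ub (z t : R) : `|partial1of2 f z t| <= `|t| * gs s t.
  rewrite d1 normrN 2!normrM (ger0_norm (gs_ge0 _ _)) ler_piMr ?sin_norm_le1//.
have D1 := @derivable_under_integral R _ _ mu f setT measurableT y (y - 1) (y + 1) Iy
  (fun z _ => fi z) (fun z t _ _ => @ex_derive _ _ _ _ _ _ _ (df z t))
  (fun t => `|t| * gs s t) G0 (abs_gs_int s0) (fun z t _ _ => ub z t).
have D2 := @differentiation_under_integral R _ _ mu f setT measurableT y (y - 1) (y + 1) Iy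
  (fun z _ => fi z) (fun z t _ _ => @ex_derive _ _ _ _ _ _ _ (df z t))
  (fun t => `|t| * gs s t) G0 (abs_gs_int s0) (fun z t _ _ => ub z t).
apply: DeriveDef => //.
rewrite -derive1E D2 -gsPhi_parts// -RIN; last exact: t_gs_sin_int.
by apply: eq_Rintegral => t _; rewrite d1.
Qed.

(** The growing Gaussian with parameter -1/(4s) is an integrating factor of the differential
    equation, so its product with [gsPhi s c] is constant and can be evaluated at 0. *)
Lemma gsPhiE s c y : 0 < s ->
  gsPhi s c y = Num.sqrt (pi / s) * gs (4 * s)^-1 y * cos c.
Proof.
move=> s0.
have H (z : R) : is_derive z 1 (fun z => gsPhi s c z * gs (- (4 * s)^-1) z) 0.
  have H1 := is_derive_gsPhi c z s0; have H2 := is_derive_gs (- (4 * s)^-1) z.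
  apply: is_derive_eq; rewrite /GRing.scale /=; field.
  by rewrite gt_eqF.
have E : gsPhi s c y * gs (- (4 * s)^-1) y = gsPhi s c 0 * gs (- (4 * s)^-1) 0.
  exact: (is_derive_0_is_cst y 0 H).
have e1 : gs (- (4 * s)^-1) 0 = 1 by rewrite /gs expr0n/= mulr0 oppr0 expR0.
have e2 : gsPhi s c 0 = Num.sqrt (pi / s) * cos c.
  rewrite /gsPhi -(gs_int s0).2 mulrC -RIZ; last exact: (gs_int s0).1.
  by apply: eq_Rintegral => t _; rewrite mulr0 add0r mulrC.
have g1 : gs (- (4 * s)^-1) y * gs (4 * s)^-1 y = 1.
  by rewrite /gs -expRD mulNr opprK subrr expR0.
transitivity (gsPhi s c y * (gs (- (4 * s)^-1) y * gs (4 * s)^-1 y)).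
  by rewrite g1 mulr1.
by rewrite mulrA E e1 e2; ring.
Qed.

End GaussianFourier.

(** * Complex numbers through real and imaginary parts *)

Section ComplexArithmetic.
Context {R : realType}.
Implicit Types z w : R[i].

Lemma ReD z w : complex.Re (z + w) = complex.Re z + complex.Re w.
Proof. by case: z => a b; case: w. Qed.
Lemma ImD z w : complex.Im (z + w) = complex.Im z + complex.Im w.
Proof. by case: z => a b; case: w. Qed.
Lemma ReN z : complex.Re (- z) = - complex.Re z. Proof. by case: z. Qed.
Lemma ImN z : complex.Im (- z) = - complex.Im z. Proof. by case: z. Qed.
Lemma ReM z w : complex.Re (z * w) =
  complex.Re z * complex.Re w - complex.Im z * complex.Im w.
Proof. by case: z => a b; case: w. Qed.
Lemma ImM z w : complex.Im (z * w) =
  complex.Re z * complex.Im w + complex.Im z * complex.Re w.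
Proof. by case: z => a b; case: w. Qed.
Lemma ReJ z : complex.Re (conjc z) = complex.Re z. Proof. by case: z. Qed.
Lemma ImJ z : complex.Im (conjc z) = - complex.Im z. Proof. by case: z. Qed.

Definition reim := (ReD, ImD, ReN, ImN, ReM, ImM, ReJ, ImJ).

Lemma complexP z w :
  complex.Re z = complex.Re w -> complex.Im z = complex.Im w -> z = w.
Proof. by case: z => a b; case: w => c d /= -> ->. Qed.

(** The sum norm, equivalent to the modulus. It avoids square roots and passes directly to the two
    real integrals that make up a complex one. *)
Definition nabs z := `|complex.Re z| + `|complex.Im z|.

Lemma nabs_ge0 z : 0 <= nabs z. Proof. by rewrite addr_ge0. Qed.
Lemma Re_le_nabs z : `|complex.Re z| <= nabs z. Proof. by rewrite lerDl. Qed.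
Lemma Im_le_nabs z : `|complex.Im z| <= nabs z. Proof. by rewrite lerDr. Qed.

Lemma nabsM z w : nabs (z * w) <= nabs z * nabs w.
Proof.
rewrite /nabs !reim.
have := ler_normB (complex.Re z * complex.Re w) (complex.Im z * complex.Im w).
have := ler_normD (complex.Re z * complex.Im w) (complex.Im z * complex.Re w).
rewrite !normrM; lra.
Qed.

Lemma nabsD z w : nabs (z + w) <= nabs z + nabs w.
Proof.
rewrite /nabs !reim.
have := ler_normD (complex.Re z) (complex.Re w).
have := ler_normD (complex.Im z) (complex.Im w); lra.
Qed.

Lemma nabsN z : nabs (- z) = nabs z.
Proof. by rewrite /nabs !reim !normrN. Qed.

Lemma nabsJ z : nabs (conjc z) = nabs z.
Proof. by rewrite /nabs !reim normrN. Qed.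

Lemma cabs2_ge0 z : 0 <= cabs2 z.
Proof. by rewrite addr_ge0// sqr_ge0. Qed.

Lemma cabs2E z : cabs2 z = complex.Re (z * conjc z).
Proof. by rewrite /cabs2 !reim; ring. Qed.

Lemma cabs2M z w : cabs2 (z * w) = cabs2 z * cabs2 w.
Proof. by rewrite /cabs2 !reim; ring. Qed.

Lemma cabs2J z : cabs2 (conjc z) = cabs2 z.
Proof. by rewrite /cabs2 !reim sqrrN. Qed.

Lemma cabs2N z : cabs2 (- z) = cabs2 z.
Proof. by rewrite /cabs2 !reim !sqrrN. Qed.

Lemma cabs2D z w : cabs2 (z + w) <= 2 * cabs2 z + 2 * cabs2 w.
Proof.
rewrite /cabs2 !reim.
have := sqr_ge0 (complex.Re z - complex.Re w).
have := sqr_ge0 (complex.Im z - complex.Im w); nra.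
Qed.

Lemma nabs_le_cabs2 z : nabs z <= 1 + cabs2 z.
Proof.
rewrite /nabs /cabs2 -(real_normK (num_real (complex.Re z))).
rewrite -(real_normK (num_real (complex.Im z))).
have := sqr_ge0 (2 * `|complex.Re z| - 1).
have := sqr_ge0 (2 * `|complex.Im z| - 1); nra.
Qed.

Lemma cabs2_le_nabs z : cabs2 z <= nabs z ^+ 2.
Proof.
rewrite /nabs /cabs2 -(real_normK (num_real (complex.Re z))).
rewrite -(real_normK (num_real (complex.Im z))).
have := normr_ge0 (complex.Re z); have := normr_ge0 (complex.Im z); nra.
Qed.

(* AM-GM with a free weight stands in for the Cauchy-Schwarz inequality. *)
Lemma young_complex (l : R) z w : 0 < l ->
  2 * complex.Re (z * conjc w) <= l * cabs2 z + l^-1 * cabs2 w.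
Proof.
move=> l0; rewrite /cabs2 !reim.
set a := complex.Re z; set b := complex.Im z.
set c := complex.Re w; set e := complex.Im w.
rewrite -subr_ge0.
have -> : l * (a ^+ 2 + b ^+ 2) + l^-1 * (c ^+ 2 + e ^+ 2) -
   2 * (a * c - b * - e) = l^-1 * ((l * a - c) ^+ 2 + (l * b - e) ^+ 2).
  by field; rewrite gt_eqF.
by rewrite mulr_ge0 ?invr_ge0 ?(ltW l0)// addr_ge0 ?sqr_ge0.
Qed.

Lemma nabs_expi (t : R) : nabs (expi t) <= 2.
Proof.
by have := cos_norm_le1 t; have := sin_norm_le1 t; rewrite /nabs /=; lra.
Qed.

Lemma expiD (s t : R) : expi (s + t) = expi s * expi t.
Proof. by apply: complexP; rewrite !reim /= ?cosD ?sinD//; ring. Qed.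

Lemma expiN (t : R) : expi (- t) = conjc (expi t).
Proof. by apply: complexP; rewrite !reim /= ?cosN ?sinN. Qed.

Lemma cabs2_expi (t : R) : cabs2 (expi t) = 1.
Proof. by rewrite /cabs2 /= cos2Dsin2. Qed.

Lemma nabs_sqr_le z : nabs z ^+ 2 <= 2 * cabs2 z.
Proof.
rewrite /nabs /cabs2 -[X in _ <= 2 * (X + _)](real_normK (num_real _)).
rewrite -[X in _ <= 2 * (_ + X)](real_normK (num_real _)).
have := sqr_ge0 (`|complex.Re z| - `|complex.Im z|); nra.
Qed.

End ComplexArithmetic.

(** * Integrals of complex-valued functions *)

Section ComplexIntegral.
Context {d} {T : measurableType d} {R : realType} (m : {measure set T -> \bar R}).
Implicit Types f g k : T -> R[i].

Definition cmeas f := measurable_fun setT (fun x => complex.Re (f x)) /\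
  measurable_fun setT (fun x => complex.Im (f x)).

Definition cintg f := intg m (fun x => complex.Re (f x)) /\
  intg m (fun x => complex.Im (f x)).

Definition CI f : R[i] :=
  Complex (\int[m]_x complex.Re (f x)) (\int[m]_x complex.Im (f x)).

Lemma eq_cmeas f g : f =1 g -> cmeas f -> cmeas g.
Proof. by move=> /funext ->. Qed.

Lemma eq_cintg f g : f =1 g -> cintg f -> cintg g.
Proof. by move=> /funext ->. Qed.

Lemma eq_CI f g : f =1 g -> CI f = CI g.
Proof. by move=> /funext ->. Qed.

Lemma cintg_cmeas f : cintg f -> cmeas f.
Proof. by move=> [/intg_meas ? /intg_meas]. Qed.

Lemma cmeas_cst (c : R[i]) : cmeas (fun=> c).
Proof. by split; exact: measurable_cst. Qed.

Lemma cmeasD f g : cmeas f -> cmeas g -> cmeas (fun x => f x + g x).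
Proof.
move=> [f1 f2] [g1 g2]; split; under eq_fun do rewrite reim;
  exact: measurable_funD.
Qed.

Lemma cmeasN f : cmeas f -> cmeas (fun x => - f x).
Proof.
by move=> [f1 f2]; split; under eq_fun do rewrite reim; exact: measurableT_comp.
Qed.

Lemma cmeasB f g : cmeas f -> cmeas g -> cmeas (fun x => f x - g x).
Proof. by move=> fm gm; exact/cmeasD/cmeasN. Qed.

Lemma cmeasJ f : cmeas f -> cmeas (fun x => conjc (f x)).
Proof.
move=> [f1 f2]; split; under eq_fun do rewrite reim; first exact: f1.
exact: measurableT_comp.
Qed.

Lemma cmeasM f g : cmeas f -> cmeas g -> cmeas (fun x => f x * g x).
Proof.
move=> [f1 f2] [g1 g2]; split; under eq_fun do rewrite reim.
  by apply: measurable_funB; exact: measurable_funM.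
by apply: measurable_funD; exact: measurable_funM.
Qed.

Lemma cmeas_real (h : T -> R) : measurable_fun setT h -> cmeas (fun x => (h x)%:C%C).
Proof. by move=> mh; split => //=; exact: measurable_cst. Qed.

Lemma cmeas_sum (I : Type) (s : seq I) (P : pred I) (F : I -> T -> R[i]) :
  (forall i, P i -> cmeas (F i)) -> cmeas (fun x => \sum_(i <- s | P i) F i x).
Proof.
move=> Fi; elim: s => [|i s ih].
  by apply: eq_cmeas (cmeas_cst 0) => x; rewrite big_nil.
have [Pi|nPi] := boolP (P i).
  by apply: eq_cmeas (cmeasD (Fi i Pi) ih) => x; rewrite big_cons Pi.
by apply: eq_cmeas ih => x; rewrite big_cons (negbTE nPi).
Qed.

Lemma measurable_cabs2 f : cmeas f -> measurable_fun setT (fun x => cabs2 (f x)).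
Proof. by move=> [f1 f2]; apply: measurable_funD; exact: measurable_funX. Qed.

Lemma cintg_le f (g : T -> R) : cmeas f -> (forall x, nabs (f x) <= g x) ->
  intg m g -> cintg f.
Proof.
move=> [f1 f2] fg gi; split; apply: intg_le gi => // x; apply: le_trans (fg x).
- exact: Re_le_nabs.
- exact: Im_le_nabs.
Qed.

Lemma intg_nabs f : cintg f -> intg m (fun x => nabs (f x)).
Proof. by move=> [f1 f2]; apply: intgD; exact: intg_norm. Qed.

Lemma cintgD f g : cintg f -> cintg g -> cintg (fun x => f x + g x).
Proof. by move=> [f1 f2] [g1 g2]; split; under eq_fun do rewrite reim; exact: intgD. Qed.

Lemma cintgN f : cintg f -> cintg (fun x => - f x).
Proof. by move=> [f1 f2]; split; under eq_fun do rewrite reim; exact: intgN. Qed.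

Lemma cintgB f g : cintg f -> cintg g -> cintg (fun x => f x - g x).
Proof. by move=> fi gi; exact/cintgD/cintgN. Qed.

Lemma cintgJ f : cintg f -> cintg (fun x => conjc (f x)).
Proof.
move=> [f1 f2]; split; under eq_fun do rewrite reim; first exact: f1.
exact: intgN.
Qed.

Lemma cintg_bM k f (M : R) : cmeas k -> (forall x, nabs (k x) <= M) ->
  cintg f -> cintg (fun x => k x * f x).
Proof.
move=> mk kM fi; apply: (@cintg_le _ (fun x => M * nabs (f x))).
- by apply: cmeasM => //; exact: cintg_cmeas.
- move=> x; rewrite (le_trans (nabsM _ _))// ler_wpM2r ?nabs_ge0//.
- exact/intgZ/intg_nabs.
Qed.

Lemma cintgZ (c : R[i]) f : cintg f -> cintg (fun x => c * f x).
Proof. by apply: (@cintg_bM _ _ (nabs c)) => //; exact: cmeas_cst. Qed.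

Lemma cintg_sum (I : Type) (s : seq I) (P : pred I) (F : I -> T -> R[i]) :
  (forall i, P i -> cintg (F i)) -> cintg (fun x => \sum_(i <- s | P i) F i x).
Proof.
move=> Fi; elim: s => [|i s ih].
  have c0 : cintg (fun=> 0) by split; exact: intg0.
  by apply: eq_cintg c0 => x; rewrite big_nil.
have [Pi|nPi] := boolP (P i).
  by apply: eq_cintg (cintgD (Fi i Pi) ih) => x; rewrite big_cons Pi.
by apply: eq_cintg ih => x; rewrite big_cons (negbTE nPi).
Qed.

Lemma cintg_real (h : T -> R) : intg m h -> cintg (fun x => (h x)%:C%C).
Proof. by move=> hi; split => //=; exact: intg0. Qed.

Lemma CID f g : cintg f -> cintg g -> CI (fun x => f x + g x) = CI f + CI g.
Proof.
move=> [f1 f2] [g1 g2]; apply: complexP; rewrite !reim /= -RID//.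
  by under eq_Rintegral do rewrite reim.
by under eq_Rintegral do rewrite reim.
Qed.

Lemma CIZ (c : R[i]) f : cintg f -> CI (fun x => c * f x) = c * CI f.
Proof.
move=> [f1 f2]; apply: complexP; rewrite !reim /= -!RIZ//.
  rewrite -RIB; try exact: intgZ.
  by under eq_Rintegral do rewrite reim.
rewrite -RID; try exact: intgZ.
by under eq_Rintegral do rewrite reim.
Qed.

Lemma CIN f : cintg f -> CI (fun x => - f x) = - CI f.
Proof.
by move=> fi; rewrite -mulN1r -CIZ//; apply: eq_CI => x; rewrite mulN1r.
Qed.

Lemma CIB f g : cintg f -> cintg g -> CI (fun x => f x - g x) = CI f - CI g.
Proof. by move=> fi gi; rewrite CID ?CIN//; exact: cintgN. Qed.

Lemma CIJ f : cintg f -> CI (fun x => conjc (f x)) = conjc (CI f).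
Proof.
move=> [f1 f2]; apply: complexP; rewrite !reim /=.
  by under eq_Rintegral do rewrite reim.
by rewrite -RIN//; under eq_Rintegral do rewrite reim.
Qed.

Lemma CI_sum (I : Type) (s : seq I) (P : pred I) (F : I -> T -> R[i]) :
  (forall i, P i -> cintg (F i)) ->
  CI (fun x => \sum_(i <- s | P i) F i x) = \sum_(i <- s | P i) CI (F i).
Proof.
move=> Fi; elim: s => [|i s ih].
  have c0 : cintg (fun=> 0) by split; exact: intg0.
  rewrite big_nil -[RHS](mul0r (CI (fun=> 0))) -CIZ//.
  by apply: eq_CI => x; rewrite big_nil mul0r.
have [Pi|nPi] := boolP (P i).
  rewrite big_cons Pi -ih -CID; [|exact: Fi|exact: cintg_sum].
  by apply: eq_CI => x; rewrite big_cons Pi.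
rewrite big_cons (negbTE nPi) -ih.
by apply: eq_CI => x; rewrite big_cons (negbTE nPi).
Qed.

Lemma CI_real (h : T -> R) : CI (fun x => (h x)%:C%C) = (\int[m]_x h x)%:C%C.
Proof.
apply: complexP => //=; have E := @RIZ _ _ _ m 0 (fun=> 0) (intg0 m).
transitivity (\int[m]_x (0 * (0 : R))); last by rewrite E mul0r.
by apply: RI_ext => x; rewrite mul0r.
Qed.

Lemma nabs_CI f : cintg f -> nabs (CI f) <= \int[m]_x nabs (f x).
Proof.
move=> [f1 f2]; rewrite /nabs /= RID; try exact: intg_norm.
by apply: lerD; exact: le_normr_Rintegral.
Qed.

End ComplexIntegral.

(** * Fubini for complex integrals with a bounded kernel *)

Section ComplexFubini.
Context {d1 d2} {T1 : measurableType d1} {T2 : measurableType d2} {R : realType}.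
Variables (m1 : {sigma_finite_measure set T1 -> \bar R})
          (m2 : {sigma_finite_measure set T2 -> \bar R}).
Implicit Types (u : T1 -> R[i]) (v : T2 -> R[i]) (k : T1 * T2 -> R[i]).

(** Tonelli gives measurability of the inner integral for nonnegative integrands; a signed one is
    the difference of the nonnegative |f| and |f| - f. *)
Lemma measurable_RI (f : T1 * T2 -> R) : measurable_fun setT f ->
  (forall x, intg m2 (fun y => f (x, y))) ->
  measurable_fun setT (fun x => \int[m2]_y f (x, y)).
Proof.
move=> mf fi.
have H (h : T1 * T2 -> R) : measurable_fun setT h -> (forall z, 0 <= h z) ->
    (forall x, intg m2 (fun y => h (x, y))) ->
    measurable_fun setT (fun x => \int[m2]_y h (x, y)).
  move=> mh h0 hi; apply/measurable_EFinP.
  have -> : EFin \o (fun x => \int[m2]_y h (x, y)) = fubini_F m2 (EFin \o h).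
    by apply/funext => x; rewrite /fubini_F /= RI_fin.
  apply: measurable_fun_fubini_tonelli_F; first exact/measurable_EFinP.
  by move=> z; rewrite lee_fin.
have mn : measurable_fun setT (fun z => `|f z|) by exact: (measurableT_comp (@measurable_norm_id R) mf).
have ni x : intg m2 (fun y => `|f (x, y)|) by exact: intg_norm.
have -> : (fun x => \int[m2]_y f (x, y)) = (fun x => \int[m2]_y `|f (x, y)| -
    \int[m2]_y (`|f (x, y)| - f (x, y))).
  apply/funext => x; rewrite -RIB//; last exact: intgB.
  by apply: RI_ext => y; ring.
apply: measurable_funB; first exact: (H (fun z => `|f z|) mn (fun z => normr_ge0 _) ni).
apply: (H (fun z => `|f z| - f z)); first exact: measurable_funB.
- by move=> z; rewrite subr_ge0 ler_norm.
- by move=> x; exact: intgB.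
Qed.

Lemma cmeas_pair2 k x : cmeas k -> cmeas (fun y => k (x, y)).
Proof.
move=> [k1 k2]; split.
- exact: (measurable_fun_pair2 x k1).
- exact: (measurable_fun_pair2 x k2).
Qed.

Lemma cmeas_pair1 k y : cmeas k -> cmeas (fun x => k (x, y)).
Proof.
move=> [k1 k2]; split.
- exact: (measurable_fun_pair1 y k1).
- exact: (measurable_fun_pair1 y k2).
Qed.

Lemma cmeas_CI v k (M : R) : cmeas k -> (forall z, nabs (k z) <= M) -> cintg m2 v ->
  cmeas (fun x => CI m2 (fun y => v y * k (x, y))).
Proof.
move=> mk kM vi.
have [v1 v2] := cintg_cmeas vi.
have mw : cmeas (fun z : T1 * T2 => v z.2 * k z).
  apply: cmeasM => //; split.
    exact: (measurableT_comp v1).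
  exact: (measurableT_comp v2).
have si x : cintg m2 (fun y => v y * k (x, y)).
  apply: (@eq_cintg _ _ _ _ (fun y => k (x, y) * v y)).
    by move=> y; rewrite mulrC.
  by apply: cintg_bM => //; exact: cmeas_pair2.
split => /=.
- by apply: (@measurable_RI (fun z => complex.Re (v z.2 * k z)) mw.1) => x;
    have [] := si x.
- by apply: (@measurable_RI (fun z => complex.Im (v z.2 * k z)) mw.2) => x;
    have [] := si x.
Qed.

(** The product of two integrable densities is integrable on the product space, and a bounded kernel
    keeps it so. In the applications the kernel is an exponential. *)
Lemma CI_swap u v k (M : R) : cmeas k -> (forall z, nabs (k z) <= M) ->
  cintg m1 u -> cintg m2 v ->
  CI m1 (fun x => u x * CI m2 (fun y => v y * k (x, y))) =
  CI m2 (fun y => v y * CI m1 (fun x => u x * k (x, y))).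
Proof.
move=> mk kM ui vi.
pose w (z : T1 * T2) := u z.1 * v z.2 * k z.
have [u1 u2] := cintg_cmeas ui; have [v1 v2] := cintg_cmeas vi.
have mw : cmeas w.
  apply: cmeasM => //; apply: cmeasM; split.
  - exact: (measurableT_comp u1).
  - exact: (measurableT_comp u2).
  - exact: (measurableT_comp v1).
  - exact: (measurableT_comp v2).
have wi : cintg (m1 \x m2)%E w.
  apply: (@cintg_le _ _ _ _ _ (fun z => M * (nabs (u z.1) * nabs (v z.2)))) => //.
    move=> z; rewrite (le_trans (nabsM _ _))// mulrC ler_pM ?nabs_ge0//.
    exact: nabsM.
  by apply: intgZ; exact: (intg_prod (intg_nabs ui) (intg_nabs vi)).
have si x : cintg m2 (fun y => v y * k (x, y)).
  apply: (@eq_cintg _ _ _ _ (fun y => k (x, y) * v y)).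
    by move=> y; rewrite mulrC.
  by apply: cintg_bM => //; exact: cmeas_pair2.
have ti y : cintg m1 (fun x => u x * k (x, y)).
  apply: (@eq_cintg _ _ _ _ (fun x => k (x, y) * u x)).
    by move=> x; rewrite mulrC.
  by apply: (@cintg_bM _ _ _ _ (fun x => k (x, y))) => //; exact: cmeas_pair1.
have sw x : cintg m2 (fun y => w (x, y)).
  apply: (@eq_cintg _ _ _ _ (fun y => u x * (v y * k (x, y)))).
    by move=> y; rewrite /w /= mulrA.
  exact: cintgZ.
have tw y : cintg m1 (fun x => w (x, y)).
  apply: (@eq_cintg _ _ _ _ (fun x => v y * (u x * k (x, y)))).
    by move=> x; rewrite /w /= mulrA [v y * _]mulrC.
  exact: cintgZ.
have E1 x : u x * CI m2 (fun y => v y * k (x, y)) = CI m2 (fun y => w (x, y)).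
  by rewrite -CIZ//; apply: eq_CI => y; rewrite /w /= mulrA.
have E2 y : v y * CI m1 (fun x => u x * k (x, y)) = CI m1 (fun x => w (x, y)).
  by rewrite -CIZ//; apply: eq_CI => x; rewrite /w /= mulrA [v y * _]mulrC.
rewrite (eq_CI _ E1) (eq_CI _ E2); apply: complexP => /=.
- have [_ _ ->//] := @Rfubini _ _ _ _ _ m1 m2 (fun z => complex.Re (w z)) wi.1
    (fun x => (sw x).1) (fun y => (tw y).1).
- have [_ _ ->//] := @Rfubini _ _ _ _ _ m1 m2 (fun z => complex.Im (w z)) wi.2
    (fun x => (sw x).2) (fun y => (tw y).2).
Qed.

End ComplexFubini.

(** * Gaussians on the plane and their Fourier transform *)

Section PlaneGaussian.
Context {R : realType}.
Local Notation mu := (@lebesgue_measure R).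
Local Notation mu2 := (@leb2 R).
Implicit Types (s c : R) (x y : R * R).

Definition gs2 s x := gs s x.1 * gs s x.2.

Lemma gs2E s x : gs2 s x = expR (- (s * nrm2sq x)).
Proof. by rewrite /gs2 /gs -expRD /nrm2sq; congr expR; ring. Qed.

Lemma gs2_ge0 s x : 0 <= gs2 s x.
Proof. by rewrite mulr_ge0// gs_ge0. Qed.

Lemma gs2_le1 s x : 0 <= s -> gs2 s x <= 1.
Proof. by move=> s0; rewrite mulr_ile1 ?gs_ge0 ?gs_le1. Qed.

Lemma measurable_gs2 s : measurable_fun setT (gs2 s).
Proof.
apply: measurable_funM; first exact: (measurableT_comp (measurable_gs s)).
exact: (measurableT_comp (measurable_gs s)).
Qed.

Lemma measurable_cos_fun : measurable_fun setT (@cos R).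
Proof. apply: continuous_measurable_fun; exact: continuous_cos. Qed.

Lemma measurable_sin_fun : measurable_fun setT (@sin R).
Proof. apply: continuous_measurable_fun; exact: continuous_sin. Qed.

Lemma measurable_dot2 y : measurable_fun setT (fun x : R * R => dot2 x y).
Proof. by apply: measurable_funD; apply: measurable_funM. Qed.

Lemma measurable_dot2_pair :
  measurable_fun setT (fun z : (R * R) * (R * R) => dot2 z.1 z.2).
Proof.
have f11 : measurable_fun setT (fun z : (R * R) * (R * R) => z.1.1).
  exact: (measurableT_comp measurable_fst).
have f12 : measurable_fun setT (fun z : (R * R) * (R * R) => z.1.2).
  exact: (measurableT_comp measurable_snd).
have f21 : measurable_fun setT (fun z : (R * R) * (R * R) => z.2.1).
  exact: (measurableT_comp measurable_fst).
have f22 : measurable_fun setT (fun z : (R * R) * (R * R) => z.2.2).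
  exact: (measurableT_comp measurable_snd).
by apply: measurable_funD; apply: measurable_funM.
Qed.

Lemma cmeas_expi_comp {d} {T : measurableType d} (h : T -> R) :
  measurable_fun setT h -> cmeas (fun z => expi (h z)).
Proof.
move=> mh; split => /=.
- exact: (measurableT_comp measurable_cos_fun).
- exact: (measurableT_comp measurable_sin_fun).
Qed.

Lemma gs2_int s : 0 < s -> intg mu2 (gs2 s).
Proof. by move=> s0; apply: intg_prod; exact: (gs_int s0).1. Qed.

Lemma gs2_cos_RI s y c : 0 < s ->
  \int[mu2]_x (gs2 s x * cos (dot2 x y + c)) = pi / s * gs2 (4 * s)^-1 y * cos c.
Proof.
move=> s0.
have mf : measurable_fun setT (fun x => gs2 s x * cos (dot2 x y + c)).
  apply: measurable_funM; first exact: measurable_gs2.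
  apply: (measurableT_comp measurable_cos_fun).
  by apply: measurable_funD => //; exact: measurable_dot2.
have fi : intg mu2 (fun x => gs2 s x * cos (dot2 x y + c)).
  apply: (@intg_le _ _ _ mu2 _ (gs2 s)) (gs2_int s0) => [|x]; first exact: mf.
  by rewrite normrM (ger0_norm (gs2_ge0 _ _)) ler_piMr ?gs2_ge0 ?cos_norm_le1.
have H1 (t : R) : (fun r => gs2 s (t, r) * cos (dot2 (t, r) y + c)) =
   (fun r => gs s t * (gs s r * cos (r * y.2 + (t * y.1 + c)))).
  by apply/funext => r; rewrite /gs2 /dot2 /= -!mulrA; congr (_ * (_ * cos _)); ring.
have H2 (r : R) : (fun t => gs2 s (t, r) * cos (dot2 (t, r) y + c)) =
   (fun t => gs s r * (gs s t * cos (t * y.1 + (r * y.2 + c)))).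
  apply/funext => t; rewrite /gs2 /dot2 /= [gs s t * _]mulrC -!mulrA.
  by congr (_ * (_ * cos _)); ring.
have [||_ -> _] := @Rfubini _ _ _ _ _ mu mu _ fi.
- by move=> t; rewrite H1; apply: intgZ; exact: gs_cos_int.
- by move=> r; rewrite H2; apply: intgZ; exact: gs_cos_int.
transitivity (\int[mu]_t (Num.sqrt (pi / s) * gs (4 * s)^-1 y.2 *
    (gs s t * cos (t * y.1 + c)))).
  apply: RI_ext => t; rewrite H1 RIZ; last exact: gs_cos_int.
  rewrite -/(gsPhi _ _ _) gsPhiE//; ring.
rewrite RIZ; last exact: gs_cos_int.
rewrite -/(gsPhi _ _ _) gsPhiE// /gs2.
have E : Num.sqrt (pi / s) * Num.sqrt (pi / s) = pi / s.
  by rewrite -expr2 sqr_sqrtr// divr_ge0// ?pi_ge0// ltW.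
rewrite -[X in _ = X * _ * _]E; ring.
Qed.

Lemma gs2_RI s : 0 < s -> \int[mu2]_x gs2 s x = pi / s.
Proof.
move=> s0; have := gs2_cos_RI (0, 0) 0 s0.
rewrite cos0 /gs2 /= {3 4}/gs expr0n /= mulr0 oppr0 expR0 !mulr1 => <-.
by apply: RI_ext => x; rewrite /dot2 /= !mulr0 !addr0 cos0 mulr1.
Qed.

Lemma gs2_CI s y : 0 < s ->
  CI mu2 (fun x => (gs2 s x)%:C%C * expi (dot2 x y)) =
  (pi / s * gs2 (4 * s)^-1 y)%:C%C.
Proof.
move=> s0; apply: complexP => /=.
  transitivity (\int[mu2]_x (gs2 s x * cos (dot2 x y + 0))).
    by apply: RI_ext => x; rewrite mul0r subr0 addr0.
  by rewrite gs2_cos_RI// cos0 mulr1.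
transitivity (\int[mu2]_x (gs2 s x * cos (dot2 x y + - (pi / 2)))).
  apply: RI_ext => x; rewrite mul0r addr0 cosD cosN sinN cos_pihalf sin_pihalf.
  by ring.
by rewrite gs2_cos_RI// cosN cos_pihalf mulr0.
Qed.

Lemma gs2_expi_cintg s y : 0 < s ->
  cintg mu2 (fun x => (gs2 s x)%:C%C * expi (dot2 x y)).
Proof.
move=> s0.
apply: (@eq_cintg _ _ _ mu2 (fun x => expi (dot2 x y) * (gs2 s x)%:C%C)).
  by move=> x; rewrite mulrC.
apply: (@cintg_bM _ _ _ mu2 (fun x => expi (dot2 x y)) _ 2).
- by apply: cmeas_expi_comp; exact: measurable_dot2.
- by move=> x; exact: nabs_expi.
- by apply: cintg_real; exact: gs2_int.
Qed.

End PlaneGaussian.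

(** Both sides stay in the extended reals, so integrability of the limit is a consequence and not a
    premise. *)
Lemma fatou_bound {d} {T : measurableType d} {R : realType}
    (m : {measure set T -> \bar R}) (F : nat -> T -> R) (f : T -> R) (C : \bar R) :
  (forall n, measurable_fun setT (F n)) -> (forall n x, 0 <= F n x) ->
  (forall x, F n x @[n --> \oo] --> f x) ->
  (forall n, (\int[m]_x (F n x)%:E <= C)%E) -> (\int[m]_x (f x)%:E <= C)%E.
Proof.
move=> mF F0 Ff FC.
have := @fatou _ _ _ m setT measurableT (fun n x => (F n x)%:E)
  (fun n => (measurable_EFinP setT (F n)).2 (mF n))
  (fun n x _ => (F0 n x : (0 <= (F n x)%:E)%E)).
have -> : (\int[m]_x limn_einf (fun n => (F n x)%:E) = \int[m]_x (f x)%:E)%E.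
  apply: eq_integral => x _; have cv : (fun n => (F n x)%:E) @ \oo --> (f x)%:E.
    by apply: cvg_EFin; [exact: nearW|exact: Ff].
  by have [-> _] := cvg_limn_einf_sup cv.
move=> /le_trans; apply; rewrite limn_einf_lim.
apply: lime_le; first exact: is_cvg_einfs.
apply: nearW => n; apply: le_trans (FC n).
by apply: ereal_inf_lbound; exists n => //=.
Qed.

(** Exchanging the coordinates reduces this to the marginal in the first variable. *)
Lemma intg_RI2 {d1 d2} {T1 : measurableType d1} {T2 : measurableType d2}
    {R : realType} (m1 : {sigma_finite_measure set T1 -> \bar R})
    (m2 : {sigma_finite_measure set T2 -> \bar R}) (f : T1 * T2 -> R) :
  intg (m1 \x m2)%E f -> (forall y, intg m1 (fun x => f (x, y))) ->
  intg m2 (fun y => \int[m1]_x f (x, y)).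
Proof.
move=> fi fi2; have mf := intg_meas fi.
have fi' : intg (m2 \x m1)%E (fun z => f (z.2, z.1)).
  apply/integrable12ltyP.
    apply/measurable_EFinP; apply: (measurableT_comp mf).
    by apply: measurable_fun_pair; [exact: measurable_snd|exact: measurable_fst].
  have /(integrable21ltyP m1 m2) : measurable_fun setT (EFin \o f).
    exact/measurable_EFinP.
  by move=> [+ _] => /(_ fi).
have F1 := @integrable_fubini_F _ _ _ _ _ m2 m1 _ fi'.
suff E : fubini_F m1 (EFin \o (fun z => f (z.2, z.1))) =
    EFin \o (fun y => \int[m1]_x f (x, y)) by rewrite E in F1.
by apply/funext => x; rewrite /fubini_F /= RI_fin.
Qed.

(** * Convolution of nonnegative functions on the plane *)

Section Convolution.
Context {R : realType}.
Local Notation mu2 := (@leb2 R).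
Implicit Types (g K : R * R -> R).

Lemma leb2_sigma_finite : sigma_finite setT (@leb2 R).
Proof.
have /sigma_finiteP[F [TF ndF Foo]] := sigma_finiteT (@lebesgue_measure R).
exists (fun n => F n `*` F n).
  rewrite -setXTT TF predeqE => -[x y]; split.
    move=> [/= [n _ Fnx] [k _ Fky]]; exists (maxn n k) => //; split.
    - by move: x Fnx; exact/subsetPset/ndF/leq_maxl.
    - by move: y Fky; exact/subsetPset/ndF/leq_maxr.
  by move=> [n _ []/= ? ?]; split; exists n.
move=> k; have [mFk Fk] := Foo k.
split; first exact: measurableX.
by rewrite /leb2 product_measure1E// lte_mul_pinfty// ge0_fin_numE.
Qed.

(* The library's sigma-finite instance on products is shadowed by one for
   subprobabilities, so unification does not find it. *)
Definition sleb2 : {sigma_finite_measure set (measurableTypeR R * measurableTypeR R)%type -> \bar R} :=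
  HB.pack (@lebesgue_measure R \x @lebesgue_measure R)%E
    (Measure_isSigmaFinite.Build _ _ _ (@lebesgue_measure R \x @lebesgue_measure R)%E
       leb2_sigma_finite).

Lemma measurable_sub2 : measurable_fun setT (fun z : (R * R) * (R * R) => sub2 z.1 z.2).
Proof.
apply: measurable_fun_pair; apply: measurable_funB.
- exact: (measurableT_comp measurable_fst).
- exact: (measurableT_comp measurable_fst).
- exact: (measurableT_comp measurable_snd).
- exact: (measurableT_comp measurable_snd).
Qed.

Lemma measurable_sub2_swap :
  measurable_fun setT (fun z : (R * R) * (R * R) => sub2 z.2 z.1).
Proof.
apply: measurable_fun_pair; apply: measurable_funB.
- exact: (measurableT_comp measurable_fst).
- exact: (measurableT_comp measurable_fst).
- exact: (measurableT_comp measurable_snd).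
- exact: (measurableT_comp measurable_snd).
Qed.

Lemma intg_sub2 K y : (forall x, 0 <= K x) -> intg mu2 K ->
  intg mu2 (fun x => K (sub2 x y)).
Proof.
move=> K0 Ki.
pose phi (x : R * R) := (x.1 + - y.1, x.2 + - y.2).
have mphi : measurable_fun setT phi.
  by apply: measurable_fun_pair; apply: measurable_funD.
exact: (@intg_invariant _ _ _ mu2 phi mphi (leb2_shift (- y.1, - y.2)) K K0 Ki).
Qed.

Lemma RI_sub2 K y : (forall x, 0 <= K x) -> intg mu2 K ->
  \int[mu2]_x K (sub2 x y) = \int[mu2]_x K x.
Proof.
move=> K0 Ki.
pose phi (x : R * R) := (x.1 + - y.1, x.2 + - y.2).
have mphi : measurable_fun setT phi.
  by apply: measurable_fun_pair; apply: measurable_funD.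
exact: (@RI_invariant _ _ _ mu2 phi mphi (leb2_shift (- y.1, - y.2)) K (intg_meas Ki) K0).
Qed.

Lemma convolution_int g K : (forall x, 0 <= g x) -> (forall x, 0 <= K x) ->
  intg mu2 g -> intg mu2 K ->
  intg (sleb2 \x sleb2)%E (fun z => g z.1 * K (sub2 z.2 z.1)).
Proof.
move=> g0 K0 gi Ki.
apply: (@tonelli_intg _ _ _ _ _ sleb2 sleb2).
- apply: measurable_funM.
    exact: (measurableT_comp (intg_meas gi) measurable_fst).
  apply: (measurableT_comp (intg_meas Ki)).
  exact: measurable_sub2_swap.
- by move=> z; rewrite mulr_ge0.
- by move=> x /=; apply: intgZ; exact: intg_sub2.
- apply: (@eq_intg _ _ _ mu2 (fun x => (\int[mu2]_z K z) * g x)); last exact: intgZ.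
  by move=> x /=; rewrite RIZ ?RI_sub2 1?mulrC//; exact: intg_sub2.
Qed.

(** By translation invariance the integral in y of a translate of K does not depend on x, so masses
    multiply. The bound [M] makes the inner integrand integrable for every y, as the exchange of
    integrals demands. *)
Lemma convolution_RI g K (M : R) : (forall x, 0 <= g x) -> (forall x, 0 <= K x <= M) ->
  intg mu2 g -> intg mu2 K ->
  intg mu2 (fun y => \int[mu2]_x (g x * K (sub2 y x))) /\
  \int[mu2]_y \int[mu2]_x (g x * K (sub2 y x)) =
  \int[mu2]_x g x * \int[mu2]_x K x.
Proof.
move=> g0 KM gi Ki.
have K0 x : 0 <= K x by have /andP[] := KM x.
have ci := convolution_int g0 K0 gi Ki.
have s1 x : intg mu2 (fun y => g x * K (sub2 y x)).
  by apply: intgZ; exact: intg_sub2.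
have s2 y : intg mu2 (fun x => g x * K (sub2 y x)).
  apply: (@eq_intg _ _ _ mu2 (fun x => K (sub2 y x) * g x)).
    by move=> x; rewrite mulrC.
  apply: (@intg_bM _ _ _ mu2 _ (fun x => K (sub2 y x)) M) => //.
    apply: (measurableT_comp (intg_meas Ki)).
    exact: (@measurable_fun_pair2 _ _ _ _ _ _ _ y measurable_sub2).
  by move=> x; have /andP[? ?] := KM (sub2 y x); rewrite ger0_norm.
split.
  exact: (@intg_RI2 _ _ _ _ _ sleb2 sleb2 _ ci s2).
have [_ _ <-] := @Rfubini _ _ _ _ _ sleb2 sleb2 _ ci s1 s2.
transitivity (\int[mu2]_x ((\int[mu2]_z K z) * g x)); last by rewrite RIZ// mulrC.
by apply: RI_ext => x /=; rewrite RIZ ?RI_sub2 1?mulrC//; exact: intg_sub2.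
Qed.

End Convolution.

(** * A Plancherel inequality *)

Section Plancherel.
Context {R : realType}.
Local Notation mu2 := (@leb2 R).
Implicit Types (E : R * R -> R[i]).

(** The inverse Fourier integral without its factor 1/(2 pi), which is later carried by the
    symbol. *)
Definition ifourier E (y : R * R) : R[i] := CI mu2 (fun xi => E xi * expi (dot2 xi y)).

Lemma dot2C (x y : R * R) : dot2 x y = dot2 y x.
Proof. by rewrite /dot2 [x.1 * _]mulrC [x.2 * _]mulrC. Qed.

Lemma cmeas_expi_dot2 : cmeas (fun z : (R * R) * (R * R) => expi (dot2 z.2 z.1)).
Proof.
apply: (@eq_cmeas _ _ _ (fun z : (R * R) * (R * R) => expi (dot2 z.1 z.2))).
  by move=> z; rewrite dot2C.
by apply: cmeas_expi_comp; exact: measurable_dot2_pair.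
Qed.

Lemma cmeas_expi_dot2r (y : R * R) : cmeas (fun xi : R * R => expi (dot2 xi y)).
Proof. by apply: cmeas_expi_comp; exact: measurable_dot2. Qed.

Lemma cintg_expi E (y : R * R) : cintg mu2 E ->
  cintg mu2 (fun xi => E xi * expi (dot2 xi y)).
Proof.
move=> Ei; apply: (@eq_cintg _ _ _ mu2 (fun xi => expi (dot2 xi y) * E xi)).
  by move=> xi; rewrite mulrC.
by apply: (@cintg_bM _ _ _ mu2 _ _ 2) => // [|x]; [exact: cmeas_expi_dot2r|exact: nabs_expi].
Qed.

Lemma cmeas_ifourier E : cintg mu2 E -> cmeas (ifourier E).
Proof.
move=> Ei; apply: (@cmeas_CI _ _ _ _ _ sleb2 E
  (fun z : (R * R) * (R * R) => expi (dot2 z.2 z.1)) 2) => //.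
- exact: cmeas_expi_dot2.
- by move=> z; exact: nabs_expi.
Qed.

Lemma nabs_ifourier E y : cintg mu2 E -> nabs (ifourier E y) <= \int[mu2]_x (2 * nabs (E x)).
Proof.
move=> Ei; have Eyi := cintg_expi y Ei.
apply: (le_trans (nabs_CI Eyi)); apply: (@le_RI _ _ _ mu2).
- exact: intg_nabs.
- by apply: intgZ; exact: intg_nabs.
- move=> x; rewrite (le_trans (nabsM _ _))// mulrC ler_wpM2r ?nabs_ge0//.
  exact: nabs_expi.
Qed.

Lemma nabs2_le_cabs2 (z w : R[i]) : nabs z * nabs w <= cabs2 z + cabs2 w.
Proof.
have := nabs_sqr_le z; have := nabs_sqr_le w.
have := sqr_ge0 (nabs z - nabs w); nra.
Qed.

Lemma gs2_weight_cintg s (g : R * R -> R[i]) (M : R) : 0 < s -> cmeas g ->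
  (forall y, nabs (g y) <= M) -> cintg mu2 (fun y => (gs2 s y)%:C%C * g y).
Proof.
move=> s0 mg gM; apply: (@eq_cintg _ _ _ mu2 (fun y => g y * (gs2 s y)%:C%C)).
  by move=> y; rewrite mulrC.
apply: (@cintg_bM _ _ _ mu2 _ _ M) => //.
by apply: cintg_real; exact: gs2_int.
Qed.

(** The Fourier integral of the weight [gs2 s]: a Gaussian kernel of mass 4 pi^2 for every s,
    concentrating at 0 as s tends to 0. *)
Definition heat s (z : R * R) : R := pi / s * gs2 (4 * s)^-1 z.

Lemma heat_ge0 s z : 0 < s -> 0 <= heat s z <= pi / s.
Proof.
move=> s0; have p0 : 0 <= pi / s by rewrite divr_ge0 ?pi_ge0// ltW.
rewrite mulr_ge0 ?gs2_ge0//= -[leRHS]mulr1 ler_wpM2l// gs2_le1//.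
by rewrite invr_ge0 mulr_ge0// ltW.
Qed.

Lemma heat_int s : 0 < s -> intg mu2 (heat s) /\ \int[mu2]_x heat s x = 4 * pi ^+ 2.
Proof.
move=> s0; have s4 : 0 < (4 * s)^-1 by rewrite invr_gt0 mulr_gt0.
have gi := gs2_int s4; split; first exact: intgZ.
by rewrite RIZ// gs2_RI//; field; rewrite gt_eqF.
Qed.

Lemma heat_even s x y : heat s (sub2 x y) = heat s (sub2 y x).
Proof. by rewrite /heat !gs2E /nrm2sq /sub2 /=; congr (_ * expR _); ring. Qed.

(** [ifourier E] is so far known to be bounded only, and the Gaussian weight makes the y-integral
    converge. Both transforms are expanded and the y-integral is performed before the others, which
    turns the weight into the kernel [heat]. *)
Lemma gs2_ifourier_pairing s E : 0 < s -> cintg mu2 E ->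
  CI mu2 (fun y => (gs2 s y)%:C%C * conjc (ifourier E y) * ifourier E y) =
  CI mu2 (fun xi => E xi * CI mu2 (fun eta => conjc (E eta) * (heat s (sub2 xi eta))%:C%C)).
Proof.
move=> s0 Ei.
have mI := cmeas_ifourier Ei.
pose u y := (gs2 s y)%:C%C * conjc (ifourier E y).
have ui : cintg mu2 u.
  apply: (@gs2_weight_cintg _ _ (\int[mu2]_x (2 * nabs (E x)))) => //.
    exact: cmeasJ.
  by move=> y; rewrite nabsJ; exact: nabs_ifourier.
have mk := cmeas_expi_dot2.
have mk2 : cmeas (fun z : (R * R) * (R * R) => conjc (expi (dot2 z.2 z.1))).
  exact: cmeasJ.
have kM (z : (R * R) * (R * R)) : nabs (expi (dot2 z.2 z.1)) <= 2 by exact: nabs_expi.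
have kM2 (z : (R * R) * (R * R)) : nabs (conjc (expi (dot2 z.2 z.1))) <= 2.
  by rewrite nabsJ; exact: nabs_expi.
have -> := @CI_swap _ _ _ _ _ sleb2 sleb2 u E _ 2 mk kM ui Ei.
apply: eq_CI => xi; congr (_ * _).
pose u' y := (gs2 s y)%:C%C * expi (dot2 xi y).
have u'i : cintg mu2 u'.
  apply: (@gs2_weight_cintg _ _ 2) => //.
    apply: (@eq_cmeas _ _ _ (fun y => expi (dot2 y xi))); last exact: cmeas_expi_dot2r.
    by move=> y; rewrite dot2C.
  by move=> y; exact: nabs_expi.
transitivity (CI mu2 (fun y => u' y * CI mu2 (fun eta => conjc (E eta) * conjc (expi (dot2 eta y))))).
  apply: eq_CI => y; rewrite /u /u' /= -!mulrA; congr (_ * _); rewrite mulrC; congr (_ * _).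
  rewrite -[LHS]/(conjc (CI mu2 (fun eta => E eta * expi (dot2 eta y)))) -CIJ; last exact: cintg_expi.
  by apply: eq_CI => eta; rewrite rmorphM.
have -> := @CI_swap _ _ _ _ _ sleb2 sleb2 u' (fun eta => conjc (E eta)) _ 2 mk2 kM2 u'i (cintgJ Ei).
apply: eq_CI => eta; congr (_ * _).
rewrite /heat -gs2_CI//; apply: eq_CI => y.
rewrite -[LHS]/((gs2 s y)%:C%C * expi (dot2 xi y) * conjc (expi (dot2 eta y))) -mulrA.
congr (_ * _).
rewrite -expiN -expiD; congr expi; rewrite /dot2 /sub2 /=; ring.
Qed.

(** The product nabs (E xi) nabs (E eta) is bounded by |E xi|^2 + |E eta|^2. Each of the two terms
    integrates against [heat], of mass 4 pi^2, to 4 pi^2 times the square norm, uniformly in s. *)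
Lemma gs2_ifourier_le s E : 0 < s -> cintg mu2 E -> intg mu2 (fun x => cabs2 (E x)) ->
  intg mu2 (fun y => gs2 s y * cabs2 (ifourier E y)) /\
  \int[mu2]_y (gs2 s y * cabs2 (ifourier E y)) <= 8 * pi ^+ 2 * \int[mu2]_x cabs2 (E x).
Proof.
move=> s0 Ei E2.
have mI := cmeas_ifourier Ei.
set M := \int[mu2]_x (2 * nabs (E x)).
have IM y : nabs (ifourier E y) <= M by exact: nabs_ifourier.
have M0 : 0 <= M by apply: le_trans (IM (0, 0)); exact: nabs_ge0.
have wi : intg mu2 (fun y => gs2 s y * cabs2 (ifourier E y)).
  apply: (@eq_intg _ _ _ mu2 (fun y => cabs2 (ifourier E y) * gs2 s y)).
    by move=> y; rewrite mulrC.
  apply: (@intg_bM _ _ _ mu2 _ _ (M ^+ 2)); last exact: gs2_int.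
    exact: measurable_cabs2.
  move=> y; rewrite ger0_norm ?cabs2_ge0// (le_trans (cabs2_le_nabs _))//.
  by rewrite lerXn2r// nnegrE ?nabs_ge0.
split=> //.
have -> : \int[mu2]_y (gs2 s y * cabs2 (ifourier E y)) =
  complex.Re (CI mu2 (fun y => (gs2 s y)%:C%C * conjc (ifourier E y) * ifourier E y)).
  by apply: RI_ext => y; rewrite /cabs2 !reim /=; ring.
rewrite gs2_ifourier_pairing//.
have [hi hE] := heat_int s0.
have h0 z : 0 <= heat s z <= pi / s by exact: heat_ge0.
have h00 z : 0 <= heat s z by have /andP[] := h0 z.
have [ci cE] := convolution_RI (fun x => cabs2_ge0 (E x)) h0 E2 hi.
pose H xi := CI mu2 (fun eta => conjc (E eta) * (heat s (sub2 xi eta))%:C%C).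
have mh : measurable_fun setT (fun z : (R * R) * (R * R) => heat s (sub2 z.1 z.2)).
  exact: (measurableT_comp (intg_meas hi) measurable_sub2).
have nh (z : R * R) : nabs (heat s z)%:C%C <= pi / s.
  by rewrite /nabs /= normr0 addr0 ger0_norm//; have /andP[] := h0 z.
have mH : cmeas H.
  apply: (@cmeas_CI _ _ _ _ _ sleb2 (fun eta => conjc (E eta))
    (fun z : (R * R) * (R * R) => (heat s (sub2 z.1 z.2))%:C%C) (pi / s)).
  - exact: cmeas_real.
  - by move=> z.
  - exact: cintgJ.
have hi1 xi : cintg mu2 (fun eta => conjc (E eta) * (heat s (sub2 xi eta))%:C%C).
  apply: (@eq_cintg _ _ _ mu2 (fun eta => (heat s (sub2 xi eta))%:C%C * conjc (E eta))).
    by move=> eta; rewrite mulrC.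
  apply: (@cintg_bM _ _ _ mu2 _ _ (pi / s)) => //; last exact: cintgJ.
  apply: cmeas_real; exact: (@measurable_fun_pair2 _ _ _ _ _ _ _ xi mh).
have hs xi : intg mu2 (fun eta => heat s (sub2 xi eta)).
  apply: (@eq_intg _ _ _ mu2 (fun eta => heat s (sub2 eta xi))).
    by move=> eta; rewrite heat_even.
  exact: intg_sub2.
have hsE xi : \int[mu2]_eta heat s (sub2 xi eta) = 4 * pi ^+ 2.
  transitivity (\int[mu2]_eta heat s (sub2 eta xi)).
    by apply: RI_ext => eta; exact: heat_even.
  by rewrite -hE; exact: (RI_sub2 xi h00 hi).
have ch xi : intg mu2 (fun eta => cabs2 (E eta) * heat s (sub2 xi eta)).
  apply: (@eq_intg _ _ _ mu2 (fun eta => heat s (sub2 xi eta) * cabs2 (E eta))).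
    by move=> eta; rewrite mulrC.
  apply: (@intg_bM _ _ _ mu2 _ _ (pi / s)) => //; first exact: intg_meas (hs xi).
  by move=> eta; rewrite ger0_norm//; have /andP[] := h0 (sub2 xi eta).
pose B xi := 4 * pi ^+ 2 * cabs2 (E xi) + \int[mu2]_eta (cabs2 (E eta) * heat s (sub2 xi eta)).
have Bi : intg mu2 B by apply: intgD => //; exact: intgZ.
have EB xi : nabs (E xi * H xi) <= B xi.
  rewrite (le_trans (nabsM _ _))//.
  apply: (@le_trans _ _ (nabs (E xi) * \int[mu2]_eta (nabs (E eta) * heat s (sub2 xi eta)))).
    rewrite ler_wpM2l ?nabs_ge0// (le_trans (nabs_CI (hi1 xi)))//.
    apply: (@le_RI _ _ _ mu2); first exact: intg_nabs (hi1 xi).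
      apply: (@eq_intg _ _ _ mu2 (fun eta => heat s (sub2 xi eta) * nabs (E eta))).
        by move=> eta; rewrite mulrC.
      apply: (@intg_bM _ _ _ mu2 _ _ (pi / s)); last exact: intg_nabs.
        exact: intg_meas (hs xi).
      by move=> eta; rewrite ger0_norm//; have /andP[] := h0 (sub2 xi eta).
    move=> eta; rewrite (le_trans (nabsM _ _))// nabsJ ler_wpM2l ?nabs_ge0//.
    by rewrite /nabs /= normr0 addr0 ger0_norm.
  have ni : intg mu2 (fun eta => nabs (E eta) * heat s (sub2 xi eta)).
    apply: (@eq_intg _ _ _ mu2 (fun eta => heat s (sub2 xi eta) * nabs (E eta))).
      by move=> eta; rewrite mulrC.
    apply: (@intg_bM _ _ _ mu2 _ _ (pi / s)); last exact: intg_nabs.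
      exact: intg_meas (hs xi).
    by move=> eta; rewrite ger0_norm//; have /andP[] := h0 (sub2 xi eta).
  rewrite -RIZ// /B -(hsE xi) mulrC -[X in _ <= X + _]RIZ// -RID//; last exact: intgZ.
  apply: (@le_RI _ _ _ mu2); first exact: intgZ.
    by apply: intgD => //; exact: intgZ.
  by move=> eta; rewrite mulrA -mulrDl ler_wpM2r// nabs2_le_cabs2.
have EHi : cintg mu2 (fun xi => E xi * H xi).
  by apply: (@cintg_le _ _ _ mu2 _ B) => //; apply: cmeasM => //; exact: cintg_cmeas Ei.
apply: (le_trans (ler_norm _)); apply: (le_trans (Re_le_nabs _)).
apply: (le_trans (nabs_CI EHi)).
apply: (@le_trans _ _ (\int[mu2]_x B x)).
  by apply: (@le_RI _ _ _ mu2) => //; exact: intg_nabs.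
rewrite RID//; last exact: intgZ.
by rewrite RIZ// cE hE; lra.
Qed.

Lemma cvg_gs2_1 (y : R * R) : gs2 n.+1%:R^-1 y @[n --> \oo] --> (1 : R).
Proof.
have c : (fun n => - (n.+1%:R^-1 * nrm2sq y)) @ \oo --> (0 : R).
  have -> : 0 = - (0 * nrm2sq y) by rewrite mul0r oppr0.
  by apply: cvgN; apply: cvgM; [exact: cvg_harmonic|exact: cvg_cst].
have -> : (fun n => gs2 n.+1%:R^-1 y) = expR \o (fun n => - (n.+1%:R^-1 * nrm2sq y)).
  by apply/funext => n; rewrite gs2E.
by rewrite -[X in _ --> X]expR0; apply: cvg_comp c _; exact: continuous_expR.
Qed.

(** The weight with s = 1/(n+1) tends to 1, and the uniform bound passes to the limit by Fatou. *)
Lemma plancherel_le E : cintg mu2 E -> intg mu2 (fun x => cabs2 (E x)) ->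
  (\int[mu2]_y (cabs2 (ifourier E y))%:E <= (8 * pi ^+ 2 * \int[mu2]_x cabs2 (E x))%:E)%E.
Proof.
move=> Ei E2; have mI := cmeas_ifourier Ei.
apply: (@fatou_bound _ _ _ mu2 (fun n y => gs2 n.+1%:R^-1 y * cabs2 (ifourier E y))).
- move=> n; apply: measurable_funM; first exact: measurable_gs2.
  exact: measurable_cabs2.
- by move=> n y; rewrite mulr_ge0 ?gs2_ge0 ?cabs2_ge0.
- move=> y; rewrite -[X in _ --> X]mul1r; apply: cvgM; last exact: cvg_cst.
  exact: cvg_gs2_1.
- move=> n; have n0 : 0 < n.+1%:R^-1 :> R by rewrite invr_gt0.
  have [wi wle] := gs2_ifourier_le n0 Ei E2.
  by rewrite RI_fin// lee_fin.
Qed.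

End Plancherel.

(** * Limits of complex sequences and extended-real limits at infinity *)

Section ComplexLimit.
Context {R : realType}.
Implicit Types (u v : nat -> R[i]) (l : R[i]).

Definition ccvg u l := forall e : R, 0 < e ->
  exists N, forall n, (N <= n)%N -> nabs (u n - l) <= e.

Lemma ccvg_unique u l l' : ccvg u l -> ccvg u l' -> l = l'.
Proof.
move=> ul ul'; have H : nabs (l - l') <= 0.
  apply/ler_addgt0Pl => e e0; rewrite addr0.
  have e2 : 0 < e / 2 by rewrite divr_gt0.
  have [N HN] := ul _ e2; have [N' HN'] := ul' _ e2.
  have h1 := HN (maxn N N') (leq_maxl _ _); have h2 := HN' (maxn N N') (leq_maxr _ _).
  have -> : l - l' = - (u (maxn N N') - l) + (u (maxn N N') - l') by ring.
  rewrite (le_trans (nabsD _ _))// nabsN; lra.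
have r0 := le_trans (Re_le_nabs _) H; have i0 := le_trans (Im_le_nabs _) H.
move: r0 i0; rewrite !normr_le0 !reim !subr_eq0 => /eqP r0 /eqP i0.
exact: complexP.
Qed.

Lemma ccvgP u l : (fun n => complex.Re (u n)) @ \oo --> complex.Re l ->
  (fun n => complex.Im (u n)) @ \oo --> complex.Im l -> ccvg u l.
Proof.
move=> /cvgrPdist_le r /cvgrPdist_le i e e0.
have e2 : 0 < e / 2 by rewrite divr_gt0.
have [N _ HN] := r _ e2; have [N' _ HN'] := i _ e2.
exists (maxn N N') => n; rewrite geq_max => /andP[nN nN'].
have := HN n nN; have := HN' n nN' => /= h1 h2.
by rewrite /nabs !reim (distrC (complex.Re _)) (distrC (complex.Im _)); lra.
Qed.

Lemma ccvgZ (c : R[i]) u l : ccvg u l -> ccvg (fun n => c * u n) (c * l).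
Proof.
move=> ul e e0; have c1 : 0 < nabs c + 1 by rewrite ltr_wpDl ?nabs_ge0.
have [N HN] := ul (e / (nabs c + 1)) (divr_gt0 e0 c1); exists N => n /HN h.
rewrite -mulrBr (le_trans (nabsM _ _))//.
have := nabs_ge0 c; have := nabs_ge0 (u n - l).
move: h; rewrite ler_pdivlMr//; nra.
Qed.

Lemma CI_limn {d} {T : measurableType d} (m : {measure set T -> \bar R})
    (F : nat -> T -> R[i]) f (g : T -> R) :
  (forall n, cmeas (F n)) -> cmeas f -> (forall x, ccvg (F ^~ x) (f x)) ->
  intg m g -> (forall n x, nabs (F n x) <= g x) ->
  ccvg (fun n => CI m (F n)) (CI m f).
Proof.
move=> mF mf Ff gi Fg; apply: ccvgP.
- apply: (intg_limn (g := g)) => //.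
  + by move=> n; have [] := mF n.
  + by have [] := mf.
  + move=> x; apply/cvgrPdist_le => e e0; have [N HN] := Ff x _ e0.
    exists N => // n /HN /=; apply: le_trans.
    by rewrite distrC -ReN -ReD; exact: Re_le_nabs.
  + by move=> n x; apply: le_trans (Fg n x); exact: Re_le_nabs.
- apply: (intg_limn (g := g)) => //.
  + by move=> n; have [] := mF n.
  + by have [] := mf.
  + move=> x; apply/cvgrPdist_le => e e0; have [N HN] := Ff x _ e0.
    exists N => // n /HN /=; apply: le_trans.
    by rewrite distrC -ImN -ImD; exact: Im_le_nabs.
  + by move=> n x; apply: le_trans (Fg n x); exact: Im_le_nabs.
Qed.

Lemma cvge0_near (g : R -> \bar R) : g @ +oo --> 0%E -> forall e : R, 0 < e ->
  \forall r \near +oo, (g r < e%:E)%E.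
Proof.
move=> /fine_cvgP[fin /cvgrPdist_lt cv] e e0; have := cv e e0 => cv'.
near=> r; have fr : g r \is a fin_num by near: r.
rewrite -(fineK fr) lte_fin.
have : `|0 - fine (g r)| < e by near: r.
by rewrite sub0r normrN; apply: le_lt_trans; exact: ler_norm.
Unshelve. all: by end_near. Qed.

Lemma cvge0_intro (g : R -> \bar R) : (forall r, 0 <= g r)%E ->
  (forall e : R, 0 < e -> \forall r \near +oo, (g r <= e%:E)%E) -> g @ +oo --> 0%E.
Proof.
move=> g0 H; apply/fine_cvgP; split.
  near=> r; rewrite ge0_fin_numE//.
  by apply: (@le_lt_trans _ _ 1%:E); [near: r; exact: H|exact: ltry].
apply/cvgrPdist_le => e e0; near=> r.
rewrite sub0r normrN ger0_norm ?fine_ge0//.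
have : (g r <= e%:E)%E by near: r; exact: H.
move=> h; rewrite -lee_fin fineK// ge0_fin_numE//.
by apply: le_lt_trans h _; exact: ltry.
Unshelve. all: by end_near. Qed.

End ComplexLimit.

(** * Truncation to balls *)

Section BallIndicator.
Context {R : realType}.
Local Notation mu2 := (@leb2 R).

Lemma measurable_nrm2sq : measurable_fun setT (@nrm2sq R).
Proof. by apply: measurable_funD; apply: measurable_funX. Qed.

Lemma nrm2sq_ge0 (x : R * R) : 0 <= nrm2sq x.
Proof. by rewrite addr_ge0// sqr_ge0. Qed.

Lemma measurable_ball2 (r : R) : measurable (ball2 r).
Proof.
have -> : ball2 r = setT `&` (@nrm2sq R) @^-1` `]-oo, r ^+ 2].
  by apply/seteqP; split => x /=; rewrite in_itv /=; [split|case].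
by apply: measurable_nrm2sq => //; exact: measurable_itv.
Qed.

(** Domination by a multiple of a Gaussian gives integrability of the indicator without computing an
    area. *)
Lemma indic_ball2_le (r : R) x : \1_(ball2 r) x <= expR (r ^+ 2) * gs2 1 x.
Proof.
rewrite indicE; case: (boolP (x \in ball2 r)) => [|_]; last first.
  by rewrite /= mulr_ge0 ?expR_ge0 ?gs2_ge0.
rewrite inE /ball2 /= => h; rewrite gs2E -expRD -[leLHS]expR0 ler_expR.
by rewrite mul1r subr_ge0.
Qed.

Lemma indic_ball2_int (r : R) : intg mu2 (\1_(ball2 r)).
Proof.
apply: (@intg_le _ _ _ mu2 _ (fun x => expR (r ^+ 2) * gs2 1 x)).
- by apply: measurable_indic; exact: measurable_ball2.
- by move=> x; rewrite ger0_norm ?indic_ball2_le.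
- by apply: intgZ; exact: gs2_int.
Qed.

Lemma cut_cmeas (D : set (R * R)) (F : R * R -> R[i]) : measurable D -> cmeas F ->
  cmeas (fun x => (\1_D x)%:C%C * F x).
Proof.
move=> mD mF; apply: cmeasM => //; apply: cmeas_real; exact: measurable_indic.
Qed.

Lemma cabs2_cut (D : set (R * R)) (F : R * R -> R[i]) x :
  cabs2 ((\1_D x)%:C%C * F x) = \1_D x * cabs2 (F x).
Proof.
rewrite /cabs2 !reim /= indicE.
by case: (x \in D) => /=; ring.
Qed.

(** On a set of finite measure the bound nabs z <= 1 + |z|^2 passes from L2 to L1. *)
Lemma cut_L1 (r : R) (F : R * R -> R[i]) : cmeas F ->
  intg mu2 (fun x => cabs2 (F x)) -> cintg mu2 (fun x => (\1_(ball2 r) x)%:C%C * F x).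
Proof.
move=> mF F2.
apply: (@cintg_le _ _ _ mu2 _ (fun x => 2 * \1_(ball2 r) x + 2 * cabs2 (F x))).
- by apply: cut_cmeas => //; exact: measurable_ball2.
- move=> x; rewrite indicE; have := nabs_le_cabs2 (F x); have := cabs2_ge0 (F x).
  case: (x \in _) => /=; rewrite ?mul1r ?mul0r; first by lra.
  by rewrite /nabs /= !normr0; lra.
- by apply: intgD; apply: intgZ => //; exact: indic_ball2_int.
Qed.

Lemma cut_L2 (D : set (R * R)) (F : R * R -> R[i]) : measurable D -> cmeas F ->
  intg mu2 (fun x => cabs2 (F x)) ->
  intg mu2 (fun x => cabs2 ((\1_D x)%:C%C * F x)).
Proof.
move=> mD mF F2; apply: (@intg_le _ _ _ mu2 _ (fun x => cabs2 (F x))) => //.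
- by apply: measurable_cabs2; exact: cut_cmeas.
- move=> x; rewrite ger0_norm ?cabs2_ge0// cabs2_cut indicE.
  by case: (x \in D) => /=; rewrite ?mul1r ?mul0r ?cabs2_ge0.
Qed.

End BallIndicator.

(** * Gaussian averages of f in terms of its Fourier transform *)

Section Inversion.
Context {R : realType}.
Local Notation mu2 := (@leb2 R).
Variables (f F : R * R -> R[i]) (beta : R).
Hypothesis fL2 : L2on setT f.
Hypothesis fF : is_fourier_L2 f F.
Hypothesis F0 : {ae mu2, forall xi, ~ B_ beta xi -> F xi = 0}.

(** [F] vanishes outside the ball only almost everywhere; this representative vanishes there at
    every point and is therefore integrable with no exceptional set. *)
Definition Fcut xi : R[i] := (\1_(ball2 beta) xi)%:C%C * F xi.

Let mf : cmeas f. Proof. by have [? []] := fL2. Qed.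
Let f2 : intg mu2 (fun x => cabs2 (f x)). Proof. by have [_ []] := fL2. Qed.
Let mF : cmeas F. Proof. by have [[? []]] := fF. Qed.
Let F2 : intg mu2 (fun x => cabs2 (F x)). Proof. by have [[_ []]] := fF. Qed.

Lemma Fcut_L1 : cintg mu2 Fcut. Proof. exact: cut_L1. Qed.
Lemma Fcut_L2 : intg mu2 (fun x => cabs2 (Fcut x)).
Proof. by apply: cut_L2 => //; exact: measurable_ball2. Qed.
Lemma Fcut_meas : cmeas Fcut. Proof. exact: cintg_cmeas Fcut_L1. Qed.

Definition fcut (r : R) x : R[i] := (\1_(ball2 r) x)%:C%C * f x.

Lemma fcut_L1 r : cintg mu2 (fcut r). Proof. exact: cut_L1. Qed.

Lemma Rintegral_indic (D : set (R * R)) (g : R * R -> R) :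
  Rintegral mu2 D g = \int[mu2]_x (\1_D x * g x).
Proof.
rewrite Rintegral_mkcond; apply: RI_ext => x; rewrite patchE indicE.
by case: (x \in D); rewrite ?mul1r ?mul0r.
Qed.

Lemma fourier_truncE r xi : fourier_trunc f r xi =
  ((2 * pi)^-1)%:C%C * CI mu2 (fun x => fcut r x * conjc (expi (dot2 xi x))).
Proof.
rewrite /fourier_trunc; congr (_ * _); rewrite /cint; apply: complexP => /=.
- rewrite Rintegral_indic; apply: RI_ext => x.
  by rewrite /fcut !reim /= cosN sinN; ring.
- rewrite Rintegral_indic; apply: RI_ext => x.
  by rewrite /fcut !reim /= cosN sinN; ring.
Qed.

Lemma fourier_trunc_meas r : cmeas (fourier_trunc f r).
Proof.
apply: (@eq_cmeas _ _ _ (fun xi => ((2 * pi)^-1)%:C%C *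
   CI mu2 (fun x => fcut r x * conjc (expi (dot2 xi x))))).
  by move=> xi; rewrite fourier_truncE.
apply: cmeasM; first exact: cmeas_cst.
apply: (@cmeas_CI _ _ _ _ _ sleb2 (fcut r)
  (fun z : (R * R) * (R * R) => conjc (expi (dot2 z.1 z.2))) 2).
- by apply: cmeasJ; apply: cmeas_expi_comp; exact: measurable_dot2_pair.
- by move=> z; rewrite nabsJ; exact: nabs_expi.
- exact: fcut_L1.
Qed.

Lemma Fcut_ae : {ae mu2, forall xi, F xi = Fcut xi}.
Proof.
have [N [mN N0 sub]] := F0; exists N; split=> // xi h; apply: sub => h'; apply: h.
rewrite /= /Fcut indicE.
case: (boolP (xi \in ball2 beta)) => [_|]; first by rewrite mul1r.
by rewrite notin_setE => /h' ->; rewrite mulr0.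
Qed.

Lemma fourier_trunc_cvg (e : R) : 0 < e -> exists N, forall n, (N <= n)%N ->
  intg mu2 (fun xi => cabs2 (Fcut xi - fourier_trunc f n%:R xi)) /\
  \int[mu2]_xi cabs2 (Fcut xi - fourier_trunc f n%:R xi) <= e.
Proof.
move=> e0; have [_ cv] := fF.
have [A [_ HA]] := cvge0_near cv e0.
exists (Num.truncn `|A|).+1 => n An.
have lt : A < n%:R.
  rewrite (le_lt_trans (ler_norm A))// (lt_le_trans (Num.Theory.truncnS_gt _))//.
  by rewrite ler_nat.
have := HA _ lt; rewrite /L2sq.
have mT := fourier_trunc_meas n%:R.
have -> : (\int[mu2]_xi (cabs2 (F xi - fourier_trunc f n%:R xi))%:E =
   \int[mu2]_xi (cabs2 (Fcut xi - fourier_trunc f n%:R xi))%:E)%E.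
  apply: ge0_ae_eq_integral => //.
  - by apply/measurable_EFinP; apply: measurable_cabs2; exact: cmeasB.
  - apply/measurable_EFinP; apply: measurable_cabs2; apply: cmeasB => //.
    exact: Fcut_meas.
  - by move=> x _; rewrite lee_fin cabs2_ge0.
  - by move=> x _; rewrite lee_fin cabs2_ge0.
  - have [N [mN N0 sub]] := Fcut_ae; exists N; split=> // xi k; apply: sub => h.
    by apply: k => _; rewrite /= h.
move=> h.
have fi : intg mu2 (fun xi => cabs2 (Fcut xi - fourier_trunc f n%:R xi)).
  apply: intg_ge0P.
  - by apply: measurable_cabs2; apply: cmeasB => //; exact: Fcut_meas.
  - by move=> x; exact: cabs2_ge0.
  - by apply: lt_trans h _; exact: ltry.
by split=> //; rewrite -lee_fin -RI_fin// ltW.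
Qed.

Lemma gs2_representation s z : 0 < s -> (gs2 s z)%:C%C =
  ((4 * s)^-1 / pi)%:C%C *
  CI mu2 (fun xi => (gs2 (4 * s)^-1 xi)%:C%C * expi (dot2 xi z)).
Proof.
move=> s0; rewrite gs2_CI; last by rewrite invr_gt0 mulr_gt0.
rewrite -rmorphM /=; congr (_ %:C)%C.
have -> : (4 * (4 * s)^-1)^-1 = s by field; rewrite gt_eqF.
by have := @pi_gt0 R; move: (@pi R) => p p0; field; rewrite !gt_eqF.
Qed.

(** Completing the square. Integrated against a Gaussian, the free weight [l] balances an L2 error
    against the mass of the Gaussian, as Cauchy-Schwarz would. *)
Lemma nabs_le_scaled (l : R) (z : R[i]) : 0 < l -> nabs z <= l * cabs2 z + (2 * l)^-1.
Proof.
move=> l0; rewrite -subr_ge0 /nabs /cabs2.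
rewrite -(real_normK (num_real (complex.Re z))) -(real_normK (num_real (complex.Im z))).
set a := `|complex.Re z|; set b := `|complex.Im z|.
have -> : l * (a ^+ 2 + b ^+ 2) + (2 * l)^-1 - (a + b) =
  l * ((a - (2 * l)^-1) ^+ 2 + (b - (2 * l)^-1) ^+ 2).
  by field; rewrite gt_eqF.
by rewrite mulr_ge0 ?(ltW l0)// addr_ge0 ?sqr_ge0.
Qed.

Lemma gauss_weight_cintg (g : R * R -> R[i]) s y : 0 < s -> cmeas g ->
  intg mu2 (fun x => cabs2 (g x)) ->
  cintg mu2 (fun x => g x * (gs2 s (sub2 y x))%:C%C) /\
  intg mu2 (fun x => (1 + cabs2 (g x)) * gs2 s (sub2 y x)).
Proof.
move=> s0 mg g2.
have sE x : gs2 s (sub2 x y) = gs2 s (sub2 y x).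
  by rewrite !gs2E /nrm2sq /sub2 /=; congr (expR (- (_ * _))); ring.
have si : intg mu2 (fun x => gs2 s (sub2 y x)).
  apply: (@eq_intg _ _ _ mu2 (fun x => gs2 s (sub2 x y))) => //.
  by apply: intg_sub2; [exact: gs2_ge0|exact: gs2_int].
have bi : intg mu2 (fun x => (1 + cabs2 (g x)) * gs2 s (sub2 y x)).
  apply: (@eq_intg _ _ _ mu2 (fun x => gs2 s (sub2 y x) +
    gs2 s (sub2 y x) * cabs2 (g x))); first by move=> x; ring.
  apply: intgD => //; apply: (@intg_bM _ _ _ mu2 _ _ 1) => //.
    exact: intg_meas si.
  by move=> x; rewrite ger0_norm ?gs2_ge0 ?gs2_le1// ltW.
split=> //; apply: (cintg_le _ _ bi).
  by apply: cmeasM => //; apply: cmeas_real; exact: intg_meas si.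
move=> x; rewrite (le_trans (nabsM _ _))// ler_pM ?nabs_ge0 ?nabs_le_cabs2//.
by rewrite /nabs /= normr0 addr0 ger0_norm ?gs2_ge0.
Qed.

(** For truncations of f this is Fubini. As the radius grows, the left side converges by dominated
    convergence and the right side because the truncated transforms tend to F in L2. This turns the
    L2 definition of the Fourier transform into an identity at every point y. *)
Lemma gauss_average s y : 0 < s ->
  CI mu2 (fun x => f x * (gs2 s (sub2 y x))%:C%C) =
  ((2 * s)^-1)%:C%C * CI mu2 (fun xi => (gs2 (4 * s)^-1 xi)%:C%C *
     (Fcut xi * expi (dot2 xi y))).
Proof.
move=> s0; set t := (4 * s)^-1.
have t0 : 0 < t by rewrite invr_gt0 mulr_gt0.
have [fwi fwb] := gauss_weight_cintg y s0 mf f2.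
pose c := t / pi.
have c0 : 0 < c by rewrite divr_gt0// pi_gt0.
pose v xi := (gs2 t xi)%:C%C * expi (dot2 xi y).
have vi : cintg mu2 v by exact: gs2_expi_cintg.
have p0 := @pi_gt0 R.
have pK : (2 * pi)%:C%C * ((2 * pi)^-1)%:C%C = 1 :> R[i].
  by rewrite -rmorphM /= divff// mulf_neq0 ?gt_eqF.
have cK : (c^-1)%:C%C * c%:C%C = 1 :> R[i] by rewrite -rmorphM /= mulVf ?gt_eqF.
pose u (n : nat) : R[i] := CI mu2 (fun x => fcut n%:R x * (gs2 s (sub2 y x))%:C%C).
have uE n : u n = c%:C%C * (2 * pi)%:C%C *
    CI mu2 (fun xi => v xi * fourier_trunc f n%:R xi).
  have fTi : cintg mu2 (fun xi => v xi * CI mu2 (fun x => fcut n%:R x * conjc (expi (dot2 xi x)))).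
    apply: (@eq_cintg _ _ _ mu2 (fun xi => CI mu2 (fun x => fcut n%:R x * conjc (expi (dot2 xi x))) * v xi)).
      by move=> xi; rewrite mulrC.
    apply: (@cintg_bM _ _ _ mu2 _ _ (\int[mu2]_x (2 * nabs (fcut n%:R x)))) => //.
      apply: (@cmeas_CI _ _ _ _ _ sleb2 (fcut n%:R)
        (fun z : (R * R) * (R * R) => conjc (expi (dot2 z.1 z.2))) 2).
      - by apply: cmeasJ; apply: cmeas_expi_comp; exact: measurable_dot2_pair.
      - by move=> z; rewrite nabsJ; exact: nabs_expi.
      - exact: fcut_L1.
    move=> xi; have i1 : cintg mu2 (fun x => fcut n%:R x * conjc (expi (dot2 xi x))).
      apply: (@eq_cintg _ _ _ mu2 (fun x => conjc (expi (dot2 x xi)) * fcut n%:R x)).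
        by move=> x; rewrite mulrC dot2C.
      apply: (@cintg_bM _ _ _ mu2 _ _ 2); last exact: fcut_L1.
        by apply: cmeasJ; exact: cmeas_expi_dot2r.
      by move=> x; rewrite nabsJ; exact: nabs_expi.
    apply: (le_trans (nabs_CI i1)); apply: (@le_RI _ _ _ mu2).
    - exact: intg_nabs.
    - by apply: intgZ; apply: intg_nabs; exact: fcut_L1.
    - move=> x; rewrite (le_trans (nabsM _ _))// mulrC ler_wpM2r ?nabs_ge0//.
      by rewrite nabsJ; exact: nabs_expi.
  transitivity (c%:C%C * CI mu2 (fun x => fcut n%:R x *
      CI mu2 (fun xi => v xi * conjc (expi (dot2 xi x))))).
    rewrite -CIZ.
      apply: eq_CI => x; rewrite gs2_representation// mulrCA; congr (_ * (_ * _)).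
      apply: eq_CI => xi; rewrite /v -mulrA -expiN -expiD; congr (_ * expi _).
      by rewrite /dot2 /sub2 /=; ring.
    apply: (@eq_cintg _ _ _ mu2 (fun x => c^-1%:C%C * (fcut n%:R x * (gs2 s (sub2 y x))%:C%C))).
      move=> x; rewrite mulrCA; congr (_ * _); rewrite gs2_representation//.
      rewrite -/t -/c mulrA cK mul1r.
      apply: eq_CI => xi; rewrite /v -mulrA -expiN -expiD; congr (_ * expi _).
      by rewrite /dot2 /sub2 /=; ring.
    apply: cintgZ; apply: (gauss_weight_cintg y s0 _ _).1.
      exact: cintg_cmeas (fcut_L1 _).
    by apply: cut_L2 => //; exact: measurable_ball2.
  have -> := @CI_swap _ _ _ _ _ sleb2 sleb2 (fcut n%:R) v
    (fun z : (R * R) * (R * R) => conjc (expi (dot2 z.2 z.1))) 2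
    (cmeasJ cmeas_expi_dot2) (fun z => _) (fcut_L1 _) vi.
    rewrite -mulrA; congr (_ * _); rewrite -CIZ.
      apply: eq_CI => xi; rewrite fourier_truncE [in RHS]mulrCA; congr (_ * _).
      by rewrite mulrA pK mul1r.
    apply: (@eq_cintg _ _ _ mu2 (fun xi => ((2 * pi)^-1)%:C%C * (v xi *
      CI mu2 (fun x => fcut n%:R x * conjc (expi (dot2 xi x)))))).
      by move=> xi; rewrite fourier_truncE mulrCA.
    exact: cintgZ.
  by move=> z; rewrite nabsJ; exact: nabs_expi.
have u1 : ccvg u (CI mu2 (fun x => f x * (gs2 s (sub2 y x))%:C%C)).
  apply: (CI_limn _ _ _ fwb).
  - move=> n; apply: cmeasM; first exact: cintg_cmeas (fcut_L1 _).
    apply: cmeas_real; apply: (measurableT_comp (measurable_gs2 s)).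
    exact: (@measurable_fun_pair2 _ _ _ _ _ _ _ y measurable_sub2).
  - exact: cintg_cmeas fwi.
  (* For n > |x|^2 also n^2 >= |x|^2, so x lies in the ball and the truncated function already
     equals f at x. *)
  - move=> x e e0; exists (Num.truncn (nrm2sq x)).+1 => n xn.
    rewrite /fcut indicE mem_set ?mul1r ?subrr; first by rewrite /nabs /= !normr0 addr0 ltW.
    rewrite /ball2 /= (le_trans (ltW (Num.Theory.truncnS_gt _)))//.
    by rewrite -natrX ler_nat (leq_trans xn)// expnS expn1 leq_pmulr// (leq_trans _ xn).
  - move=> n x; rewrite (le_trans (nabsM _ _))// ler_pM ?nabs_ge0//.
      rewrite /fcut indicE; have := nabs_le_cabs2 (f x); case: (x \in _) => /=.
        by rewrite mul1r.
      by rewrite mul0r /nabs /= normr0 addr0 addr_ge0 ?cabs2_ge0.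
    by rewrite /nabs /= normr0 addr0 ger0_norm ?gs2_ge0.
have vM xi : nabs (v xi) <= 2 * gs2 t xi.
  rewrite (le_trans (nabsM _ _))// mulrC ler_pM ?nabs_ge0 ?nabs_expi//.
  by rewrite /nabs /= normr0 addr0 ger0_norm ?gs2_ge0.
have gti := gs2_int t0.
have vFi : cintg mu2 (fun xi => v xi * Fcut xi).
  apply: (@cintg_bM _ _ _ mu2 _ _ 2); [exact: cintg_cmeas vi| |exact: Fcut_L1].
  move=> xi; apply: le_trans (vM xi) _; rewrite -[leRHS]mulr1 ler_wpM2l//.
  by rewrite gs2_le1// ltW.
have u2 : ccvg (fun n => CI mu2 (fun xi => v xi * fourier_trunc f n%:R xi))
   (CI mu2 (fun xi => v xi * Fcut xi)).
  move=> e e0.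
  pose P := \int[mu2]_xi gs2 t xi.
  have P0 : 0 < P by rewrite /P gs2_RI// divr_gt0.
  (* This [l] makes the Gaussian term equal to e/2; an L2 error of at most e/(4l) then accounts for
     the other e/2. *)
  pose l := 2 * P / e; have l0 : 0 < l by rewrite divr_gt0// mulr_gt0.
  have [N HN] := @fourier_trunc_cvg (e / (4 * l)) (divr_gt0 e0 (mulr_gt0 (ltr0n _ 4) l0)).
  exists N => n /HN [Di Dle].
  set D := fun xi => Fcut xi - fourier_trunc f n%:R xi.
  have mD : cmeas D by apply: cmeasB; [exact: Fcut_meas|exact: fourier_trunc_meas].
  pose B xi := 2 * (l * cabs2 (D xi)) + 2 * ((2 * l)^-1 * gs2 t xi).
  have Bi : intg mu2 B by apply: intgD; do 2 apply: intgZ.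
  have vDB xi : nabs (v xi * D xi) <= B xi.
    rewrite (le_trans (nabsM _ _))//.
    apply: (@le_trans _ _ (2 * gs2 t xi * (l * cabs2 (D xi) + (2 * l)^-1))).
      by rewrite ler_pM ?nabs_ge0// nabs_le_scaled.
    rewrite /B mulrDr; apply: lerD; last by rewrite -mulrA [gs2 _ _ * _]mulrC.
    rewrite -mulrA ler_wpM2l// ler_piMl//; last by rewrite gs2_le1// ltW.
    by rewrite mulr_ge0 ?cabs2_ge0// ltW.
  have vDi : cintg mu2 (fun xi => v xi * D xi).
    apply: (@cintg_le _ _ _ mu2 _ B) => //; apply: cmeasM => //; exact: cintg_cmeas vi.
  have -> : CI mu2 (fun xi => v xi * fourier_trunc f n%:R xi) =
     CI mu2 (fun xi => v xi * Fcut xi) - CI mu2 (fun xi => v xi * D xi).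
    by rewrite -CIB//; apply: eq_CI => xi; rewrite /D; ring.
  rewrite addrAC subrr sub0r nabsN (le_trans (nabs_CI vDi))//.
  apply: (@le_trans _ _ (\int[mu2]_x B x)).
    by apply: (@le_RI _ _ _ mu2) => //; exact: intg_nabs.
  rewrite RID; [|by do 2 apply: intgZ|by do 2 apply: intgZ].
  rewrite !RIZ//; try by apply: intgZ.
  rewrite -/P.
  have -> : 2 * ((2 * l)^-1 * P) = e / 2 by rewrite /l; field; rewrite !gt_eqF.
  have : 2 * (l * \int[mu2]_x cabs2 (D x)) <= 2 * (l * (e / (4 * l))).
    by rewrite ler_wpM2l// ler_wpM2l// ltW.
  have -> : 2 * (l * (e / (4 * l))) = e / 2 by field; rewrite gt_eqF.
  by lra.
have u3 : ccvg u (c%:C%C * (2 * pi)%:C%C * CI mu2 (fun xi => v xi * Fcut xi)).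
  have := ccvgZ (c%:C%C * (2 * pi)%:C%C) u2.
  by rewrite (_ : (fun n => _) = u)//; apply/funext => n; rewrite uE.
rewrite (ccvg_unique u1 u3) -rmorphM /=; congr (_ %:C%C * _).
  by rewrite /c /t; move: (@pi R) p0 => p p0; field; rewrite !gt_eqF.
by apply: eq_CI => xi; rewrite /v -mulrA [Fcut _ * _]mulrC.
Qed.

End Inversion.

(** * Pointwise Fourier inversion for continuous f *)

Section PointwiseInversion.
Context {R : realType}.
Local Notation mu2 := (@leb2 R).

(** The square of 1 + u/2 <= e^(u/2). Quadratic decay is what beats the factor s / pi that
    normalises the Gaussian average. *)
Lemma expRN_le (u : R) : 0 < u -> expR (- u) <= 4 / u ^+ 2.
Proof.
move=> u0; rewrite expRN -[leRHS]invrK lef_pV2 ?posrE ?expR_gt0//; last first.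
  by rewrite invr_gt0 divr_gt0// exprn_gt0.
rewrite invf_div; have -> : u = u / 2 + u / 2 by field.
rewrite expRD; have := expR_ge1Dx (u / 2); set E := expR (u / 2) => h.
have : (u / 2) * (u / 2) <= E * E by apply: ler_pM; lra.
by lra.
Qed.

Lemma nabs_realM (c : R) (z : R[i]) : 0 <= c -> nabs (c%:C%C * z) = c * nabs z.
Proof.
by move=> c0; rewrite /nabs !reim /= !mul0r subr0 addr0 !normrM (ger0_norm c0); ring.
Qed.

Lemma continuous_nabs (f : R * R -> R[i]) y (e : R) :
  continuous (fun y : R * R => complex.Re (f y)) ->
  continuous (fun y : R * R => complex.Im (f y)) -> 0 < e ->
  exists2 rho : R, 0 < rho & forall x, `|y.1 - x.1| < rho -> `|y.2 - x.2| < rho ->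
    nabs (f x - f y) <= e.
Proof.
move=> c1 c2 e0; have e2 : 0 < e / 2 by rewrite divr_gt0.
have /cvgrPdist_le/(_ _ e2)/nbhs_ballP[r1 /= r10 h1] := c1 y.
have /cvgrPdist_le/(_ _ e2)/nbhs_ballP[r2 /= r20 h2] := c2 y.
exists (Num.min r1 r2); first by rewrite lt_min r10.
move=> x; rewrite !lt_min => /andP[a1 a2] /andP[b1 b2].
have k1 : `|complex.Re (f y) - complex.Re (f x)| <= e / 2 by apply: h1; split.
have k2 : `|complex.Im (f y) - complex.Im (f x)| <= e / 2 by apply: h2; split.
rewrite distrC in k1; rewrite distrC in k2.
by rewrite /nabs !reim; lra.
Qed.

(** One unit of the exponent is kept as an integrable weight independent of s; the remaining s - 1
    supplies the smallness. *)
Lemma gs2_concentration (s rho : R) (z : R * R) : 1 <= s -> 0 < rho ->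
  ~ (`|z.1| < rho /\ `|z.2| < rho) ->
  gs2 s z <= gs2 1 z * expR (- ((s - 1) * rho ^+ 2)).
Proof.
move=> s1 r0 nz; rewrite !gs2E -expRD ler_expR.
suff h : rho ^+ 2 <= nrm2sq z.
  have : (s - 1) * rho ^+ 2 <= (s - 1) * nrm2sq z by rewrite ler_wpM2l// subr_ge0.
  by lra.
rewrite /nrm2sq -(real_normK (num_real z.1)) -(real_normK (num_real z.2)).
have z1 := normr_ge0 z.1; have z2 := normr_ge0 z.2.
have [a|a] := ltP `|z.1| rho; have [b|b] := ltP `|z.2| rho; first by case: nz.
- by nra.
- by nra.
- by nra.
Qed.

(** Near y continuity is used. Far from y only square integrability of f is available: there |f| is
    bounded by 1 + |f|^2, which is integrable against the fixed Gaussian [gs2 1]. *)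
Lemma gauss_approx_identity (f : R * R -> R[i]) y (e : R) :
  L2on setT f ->
  continuous (fun y : R * R => complex.Re (f y)) ->
  continuous (fun y : R * R => complex.Im (f y)) -> 0 < e ->
  exists s1 : R, forall s, s1 <= s -> 1 <= s ->
   nabs ((s / pi)%:C%C * CI mu2 (fun x => f x * (gs2 s (sub2 y x))%:C%C) - f y) <= e.
Proof.
move=> [m1 [m2 f2]] c1 c2 e0; have mf : cmeas f by split.
have e2 : 0 < e / 2 by rewrite divr_gt0.
have p0 := @pi_gt0 R.
have [rho r0 Hrho] := continuous_nabs y c1 c2 e2.
have gsi s : 0 < s -> intg mu2 (fun x => gs2 s (sub2 y x)) /\
    \int[mu2]_x gs2 s (sub2 y x) = pi / s.
  move=> s0; have sE x : gs2 s (sub2 x y) = gs2 s (sub2 y x).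
    by rewrite !gs2E /nrm2sq /sub2 /=; congr (expR (- (_ * _))); ring.
  split.
    apply: (@eq_intg _ _ _ mu2 (fun x => gs2 s (sub2 x y))) => //.
    by apply: intg_sub2; [exact: gs2_ge0|exact: gs2_int].
  rewrite -gs2_RI// -(RI_sub2 y (gs2_ge0 s) (gs2_int s0)).
  by apply: RI_ext => x; rewrite sE.
pose h x := (1 + cabs2 (f x)) * gs2 1 (sub2 y x) + nabs (f y) * gs2 1 (sub2 y x).
have h1i : intg mu2 (fun x => nabs (f y) * gs2 1 (sub2 y x)).
  by apply: intgZ; exact: (gsi 1 ltr01).1.
have h2i := (@gauss_weight_cintg _ f 1 y ltr01 mf f2).2.
have hi : intg mu2 h by exact: intgD.
have h0 x : 0 <= h x.
  by rewrite addr_ge0// mulr_ge0 ?gs2_ge0 ?nabs_ge0// addr_ge0 ?cabs2_ge0.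
pose H := \int[mu2]_x h x; have H0 : 0 <= H by exact: RI_ge0.
(* For s >= 2, s - 1 >= s/2 and hence q <= 16 / (s^2 rho^4). The far part is then at most 16 H / (pi
   s rho^4), which is at most e/2 from the second threshold on. *)
exists (Num.max 2 (32 * H / (pi * rho ^+ 4 * e))) => s; rewrite ge_max => /andP[s2 sH] s1.
have s0 : 0 < s by lra.
have [gi gE] := gsi s s0.
have [fgi _] := @gauss_weight_cintg _ f s y s0 mf f2.
have yi : cintg mu2 (fun x => f y * (gs2 s (sub2 y x))%:C%C).
  by apply: cintgZ; exact: cintg_real.
have -> : (s / pi)%:C%C * CI mu2 (fun x => f x * (gs2 s (sub2 y x))%:C%C) - f y =
    (s / pi)%:C%C * CI mu2 (fun x => (f x - f y) * (gs2 s (sub2 y x))%:C%C).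
  have -> : CI mu2 (fun x => (f x - f y) * (gs2 s (sub2 y x))%:C%C) =
     CI mu2 (fun x => f x * (gs2 s (sub2 y x))%:C%C) - f y * (pi / s)%:C%C.
    rewrite -gE -CI_real -CIZ; last exact: cintg_real.
    by rewrite -CIB//; apply: eq_CI => x; rewrite mulrBl.
  rewrite mulrBr mulrCA -rmorphM /=.
  have -> : s / pi * (pi / s) = 1 :> R.
    by move: (@pi R) p0 => p p0; field; rewrite !gt_eqF.
  by rewrite mulr1.
have sp : 0 <= s / pi by rewrite divr_ge0// ltW.
rewrite nabs_realM//.
have di : cintg mu2 (fun x => (f x - f y) * (gs2 s (sub2 y x))%:C%C).
  apply: (@eq_cintg _ _ _ mu2 (fun x => f x * (gs2 s (sub2 y x))%:C%C -
     f y * (gs2 s (sub2 y x))%:C%C)); first by move=> x; rewrite mulrBl.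
  exact: cintgB.
pose q := expR (- ((s - 1) * rho ^+ 2)).
pose B x := e / 2 * gs2 s (sub2 y x) + q * h x.
have Bi : intg mu2 B by apply: intgD; exact: intgZ.
have dB x : nabs ((f x - f y) * (gs2 s (sub2 y x))%:C%C) <= B x.
  rewrite mulrC nabs_realM ?gs2_ge0// mulrC.
  have q0 : 0 <= q by exact: expR_ge0.
  have [near|far] := pselect (`|(sub2 y x).1| < rho /\ `|(sub2 y x).2| < rho).
    rewrite /B -[leLHS]addr0; apply: lerD; last by rewrite mulr_ge0.
    by rewrite ler_wpM2r ?gs2_ge0//; apply: Hrho; case: near.
  rewrite /B -[leLHS]add0r; apply: lerD.
    by rewrite mulr_ge0 ?gs2_ge0// ltW.
  apply: (@le_trans _ _ ((1 + cabs2 (f x) + nabs (f y)) * (gs2 1 (sub2 y x) * q))).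
    apply: ler_pM; rewrite ?nabs_ge0 ?gs2_ge0//; last exact: gs2_concentration.
    by rewrite (le_trans (nabsD _ _))// nabsN lerD2r nabs_le_cabs2.
  by rewrite /h -mulrDl mulrA mulrC.
have le1 : nabs (CI mu2 (fun x => (f x - f y) * (gs2 s (sub2 y x))%:C%C)) <=
   e / 2 * (pi / s) + q * H.
  apply: (le_trans (nabs_CI di)); apply: (@le_trans _ _ (\int[mu2]_x B x)).
    by apply: (@le_RI _ _ _ mu2) => //; exact: intg_nabs.
  by rewrite RID ?RIZ ?gE//; exact: intgZ.
apply: (le_trans (ler_wpM2l sp le1)).
have -> : s / pi * (e / 2 * (pi / s) + q * H) = e / 2 + s / pi * (q * H).
  by move: (@pi R) p0 => p p0; field; rewrite !gt_eqF.
have q4 : q <= 4 / (s / 2 * rho ^+ 2) ^+ 2.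
  have u0 : 0 < (s - 1) * rho ^+ 2 by rewrite mulr_gt0 ?exprn_gt0//; lra.
  apply: (le_trans (expRN_le u0)); rewrite ler_wpM2l// lef_pV2 ?posrE ?exprn_gt0//.
    have r2 : 0 < rho ^+ 2 by rewrite exprn_gt0.
    have a0 : 0 <= s / 2 * rho ^+ 2 by apply: mulr_ge0; lra.
    have ab : s / 2 * rho ^+ 2 <= (s - 1) * rho ^+ 2.
      by apply: ler_wpM2r; lra.
    by rewrite lerXn2r ?nnegrE//; exact: le_trans ab.
  by rewrite mulr_gt0 ?exprn_gt0 ?divr_gt0.
suff : s / pi * (q * H) <= e / 2 by lra.
apply: (@le_trans _ _ (s / pi * (4 / (s / 2 * rho ^+ 2) ^+ 2 * H))).
  by rewrite ler_wpM2l// ler_wpM2r.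
have -> : s / pi * (4 / (s / 2 * rho ^+ 2) ^+ 2 * H) =
   (32 * H / (pi * rho ^+ 4 * e)) * (e / 2) / s.
  by move: (@pi R) p0 => p p0; field; rewrite !gt_eqF.
rewrite ler_pdivrMr// mulrC ler_wpM2l//; exact: ltW.
Qed.

(** With s = (n+1)/4 the multiplier on the Fourier side is [gs2] of parameter 1/(n+1), which tends
    to 1, while the averages of f tend to f y. The identity holds at every y, as sampling at the
    nodes requires. *)
Lemma fourier_inversion (f F : R * R -> R[i]) (beta : R) y : L2on setT f ->
  is_fourier_L2 f F -> {ae mu2, forall xi, ~ B_ beta xi -> F xi = 0} ->
  continuous (fun y : R * R => complex.Re (f y)) ->
  continuous (fun y : R * R => complex.Im (f y)) ->
  f y = ((2 * pi)^-1)%:C%C * ifourier (Fcut F beta) y.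
Proof.
move=> fL2 fF F0 c1 c2.
pose s (n : nat) : R := n.+1%:R / 4.
have s0 n : 0 < s n by rewrite divr_gt0.
have p0 := @pi_gt0 R.
pose u n := (s n / pi)%:C%C * CI mu2 (fun x => f x * (gs2 (s n) (sub2 y x))%:C%C).
apply: (@ccvg_unique _ u).
  move=> e e0; have [s1 Hs] := gauss_approx_identity y fL2 c1 c2 e0.
  exists (Num.truncn (4 * `|s1| + 4)).+1 => n nN.
  have sn : 4 * `|s1| + 4 <= n.+1%:R.
    rewrite (le_trans (ltW (Num.Theory.truncnS_gt _)))// ler_nat.
    exact: leq_trans nN _.
  have := ler_norm s1; have := normr_ge0 s1 => n0 n1.
  by apply: Hs; rewrite /s ler_pdivlMr//; lra.
have uE n : u n = ((2 * pi)^-1)%:C%C * CI mu2 (fun xi => (gs2 n.+1%:R^-1 xi)%:C%C *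
     (Fcut F beta xi * expi (dot2 xi y))).
  rewrite /u (gauss_average fL2 fF F0)// mulrA -rmorphM /=.
  have -> : s n / pi / (2 * s n) = (2 * pi)^-1.
    by have := s0 n; move: (@pi R) p0 => p p0 sn0; field; rewrite !gt_eqF.
  have -> // : (4 * s n)^-1 = n.+1%:R^-1.
  by rewrite /s; congr (_^-1); field.
have mFc := Fcut_meas beta fF.
have FL1 := Fcut_L1 beta fF.
have -> : u = fun n => ((2 * pi)^-1)%:C%C * CI mu2 (fun xi => (gs2 n.+1%:R^-1 xi)%:C%C *
     (Fcut F beta xi * expi (dot2 xi y))) by apply/funext.
apply: ccvgZ; have FLe := cintg_expi y FL1.
apply: (@CI_limn _ _ _ mu2 _ _ (fun xi => nabs (Fcut F beta xi * expi (dot2 xi y)))).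
- move=> n; apply: cmeasM; last exact: cintg_cmeas FLe.
  by apply: cmeas_real; exact: measurable_gs2.
- exact: cintg_cmeas FLe.
- move=> xi; set z := Fcut F beta xi * _.
  have := cvg_gs2_1 xi => cv.
  have cvm (r : R) : (fun n : nat => gs2 n.+1%:R^-1 xi * r) @ \oo --> r.
    by rewrite -[X in _ --> X]mul1r; apply: cvgM => //; exact: cvg_cst.
  apply: ccvgP.
  + rewrite (_ : (fun n => _) = (fun n : nat => gs2 n.+1%:R^-1 xi * complex.Re z)).
      exact: cvm.
    by apply/funext => n; rewrite reim /= mul0r subr0.
  + rewrite (_ : (fun n => _) = (fun n : nat => gs2 n.+1%:R^-1 xi * complex.Im z)).
      exact: cvm.
    by apply/funext => n; rewrite reim /= mul0r addr0.
- exact: intg_nabs.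
- move=> n xi; rewrite nabs_realM ?gs2_ge0// ler_piMl ?nabs_ge0//.
  by rewrite gs2_le1.
Qed.

End PointwiseInversion.

(** * The Fourier symbol of the Poisson kernel *)

Section PoissonSymbol.
Context {R : realType}.
Local Notation mu := (@lebesgue_measure R).
Local Notation mu2 := (@leb2 R).
Implicit Types (al t : R) (xi y : R * R).

(* Subordination: the Fourier symbol of the Poisson kernel as a superposition
   of Gaussians; the factor [t != 0] discards the junk value of [t^-1] at 0. *)
Definition subord al (z : R * (R * R)) : R :=
  (z.1 != 0)%:R * gs (al ^+ 2) z.1 * gs2 (4 * z.1 ^+ 2)^-1 z.2.

(** Normalised so that the Fourier integral of [poisson_symbol] is exactly [poisson]: the
    xi-integral contributes 4 pi t^2, and the second moment of e^(-S t^2) is (sqrt pi / 2)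
    S^(-3/2). *)
Definition subord_cst : R := (4 * pi ^+ 2 * Num.sqrt pi)^-1.

(** This equals (2 pi)^(-2) e^(-al |xi|). The integral form is kept throughout: the transform and
    cruder exponential bounds can be read off from it directly. *)
Definition poisson_symbol al xi : R :=
  subord_cst * al * \int[mu]_t subord al (t, xi).

Lemma subord_cst_gt0 : 0 < subord_cst.
Proof. by rewrite invr_gt0 !mulr_gt0 ?sqrtr_gt0 ?pi_gt0// exprn_gt0 ?pi_gt0. Qed.

Lemma subord_ge0 al z : 0 <= subord al z.
Proof. by rewrite !mulr_ge0 ?gs_ge0 ?gs2_ge0. Qed.

Lemma subord_le al z : subord al z <= gs (al ^+ 2) z.1.
Proof.
rewrite /subord -[leRHS]mulr1 ler_pM ?mulr_ge0 ?gs_ge0 ?gs2_ge0//.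
  by case: eqP => _; rewrite /= ?mul0r ?mul1r ?gs_ge0.
by rewrite gs2_le1// invr_ge0 mulr_ge0// sqr_ge0.
Qed.

Lemma measurable_subord al : measurable_fun setT (subord al).
Proof.
have m1 : measurable_fun setT (fun z : R * (R * R) => z.1) by exact: measurable_fst.
apply: measurable_funM; first apply: measurable_funM.
- have -> : (fun z : R * (R * R) => (z.1 != 0)%:R) = (\1_(~` [set (0 : R)]) : R -> R) \o fst.
    apply/funext => z; rewrite /= indicE; congr (nat_of_bool _)%:R.
    by apply/idP/idP; rewrite inE /= => /eqP.
  apply: measurableT_comp => //; apply: measurable_indic; apply: measurableC.
  exact: measurable_set1.
- exact: (measurableT_comp (measurable_gs _)).
- have -> : (fun z : R * (R * R) => gs2 (4 * z.1 ^+ 2)^-1 z.2) =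
     (fun z => expR (- ((4 * z.1 ^+ 2)^-1 * nrm2sq z.2))).
    by apply/funext => z; rewrite gs2E.
  apply: (measurableT_comp (@measurable_expR R)); apply: measurableT_comp => //.
  apply: measurable_funM; last exact: (measurableT_comp measurable_nrm2sq).
  (* The inverse is written as a real power, whose measurability is known. *)
  have -> : (fun z : R * (R * R) => (4 * z.1 ^+ 2)^-1) = (fun z => (4 * z.1 ^+ 2) `^ (-1)).
    by apply/funext => z; rewrite powR_inv1// mulr_ge0// sqr_ge0.
  apply: (measurableT_comp (measurable_powR (-1 : R))).
  by apply: measurable_funM => //; exact: measurable_funX.
Qed.

Lemma subord_int_t al xi : 0 < al -> intg mu (fun t => subord al (t, xi)).
Proof.
move=> a0; apply: (@intg_le _ _ _ mu _ (gs (al ^+ 2))).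
- exact: (@measurable_fun_pair1 _ _ _ _ _ _ _ xi (measurable_subord al)).
- by move=> t; rewrite ger0_norm ?subord_ge0// (le_trans (subord_le _ _)).
- by apply: (gs_int _).1; rewrite exprn_gt0.
Qed.

Lemma subord_cos_RI al t y c : 0 < al ->
  intg mu2 (fun xi => subord al (t, xi) * cos (dot2 xi y + c)) /\
  \int[mu2]_xi (subord al (t, xi) * cos (dot2 xi y + c)) =
  4 * pi * cos c * (t ^+ 2 * gs (al ^+ 2 + nrm2sq y) t).
Proof.
move=> a0; have [->|t0] := eqVneq t 0.
  rewrite /subord /= eqxx /=; split.
    by apply: (@eq_intg _ _ _ mu2 (fun=> 0)); [move=> x; rewrite !mul0r|exact: intg0].
  rewrite [RHS](_ : _ = 0); last by rewrite expr0n /= mul0r mulr0.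
  have E := @RIZ _ _ _ mu2 0 (fun=> 0) (intg0 mu2).
  transitivity (\int[mu2]_x (0 * (0 : R))); last by rewrite E mul0r.
  by apply: RI_ext => x; rewrite !mul0r.
have s0 : 0 < (4 * t ^+ 2)^-1 by rewrite invr_gt0 mulr_gt0// exprn_even_gt0//=.
have E xi : subord al (t, xi) * cos (dot2 xi y + c) =
   gs (al ^+ 2) t * (gs2 (4 * t ^+ 2)^-1 xi * cos (dot2 xi y + c)).
  by rewrite /subord /= t0 mul1r mulrA.
have gi : intg mu2 (fun xi => gs2 (4 * t ^+ 2)^-1 xi * cos (dot2 xi y + c)).
  apply: (@intg_le _ _ _ mu2 _ (gs2 (4 * t ^+ 2)^-1)).
  - apply: measurable_funM; first exact: measurable_gs2.
    apply: (measurableT_comp measurable_cos_fun).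
    by apply: measurable_funD => //; exact: measurable_dot2.
  - move=> x; rewrite normrM (ger0_norm (gs2_ge0 _ _)) ler_piMr ?gs2_ge0//.
    exact: cos_norm_le1.
  - exact: gs2_int.
split.
  by apply: (@eq_intg _ _ _ mu2 (fun xi => gs (al ^+ 2) t * (gs2 (4 * t ^+ 2)^-1 xi * cos (dot2 xi y + c)))) => //; exact: intgZ.
transitivity (\int[mu2]_xi (gs (al ^+ 2) t * (gs2 (4 * t ^+ 2)^-1 xi * cos (dot2 xi y + c)))).
  by apply: RI_ext => xi; rewrite E.
rewrite RIZ// gs2_cos_RI//.
have -> : (4 * (4 * t ^+ 2)^-1)^-1 = t ^+ 2 by field.
have -> : gs (al ^+ 2 + nrm2sq y) t = gs (al ^+ 2) t * gs2 (t ^+ 2) y.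
  by rewrite gs2E /gs -expRD; congr expR; ring.
by rewrite invrK; ring.
Qed.

Lemma powR_S32 (S : R) : 0 < S -> Num.sqrt (pi / S) / (2 * S) =
  Num.sqrt pi / 2 * powR S (- (3 / 2)).
Proof.
move=> S0; have -> : (3 / 2 : R) = 1 + 2^-1 by field.
rewrite powRN powRD; last by rewrite gt_eqF ?implybT.
rewrite powRr1 ?ltW// powR12_sqrt ?ltW// sqrtrM ?pi_ge0// sqrtrV ?ltW//.
have : Num.sqrt S != 0 by rewrite gt_eqF// sqrtr_gt0.
move: (Num.sqrt pi) (Num.sqrt S) => p q q0; field.
by rewrite q0 gt_eqF.
Qed.

(** For fixed t the xi-integral is that of a Gaussian. What is left is the second moment of a
    Gaussian in t with parameter al^2 + |y|^2, the source of the power -3/2 in the Poisson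
    kernel. *)
Lemma poisson_symbol_RI al y c : 0 < al ->
  intg mu2 (fun xi => poisson_symbol al xi * cos (dot2 xi y + c)) /\
  \int[mu2]_xi (poisson_symbol al xi * cos (dot2 xi y + c)) = poisson al y * cos c.
Proof.
move=> a0; have a2 : 0 < al ^+ 2 by rewrite exprn_gt0.
have S0 : 0 < al ^+ 2 + nrm2sq y by rewrite ltr_wpDr ?nrm2sq_ge0.
have mc : measurable_fun setT (fun z : R * (R * R) => cos (dot2 z.2 y + c)).
  apply: (measurableT_comp measurable_cos_fun); apply: measurable_funD => //.
  exact: (measurableT_comp (measurable_dot2 y)).
have mf : measurable_fun setT (fun z => subord al z * cos (dot2 z.2 y + c)).
  by apply: measurable_funM => //; exact: measurable_subord.
have sx t : intg mu2 (fun xi => subord al (t, xi)).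
  have [h _] := subord_cos_RI t (0, 0) 0 a0.
  by apply: eq_intg h => xi; rewrite /dot2 /= !mulr0 !addr0 cos0 mulr1.
have sE t : \int[mu2]_xi subord al (t, xi) = 4 * pi * (t ^+ 2 * gs (al ^+ 2) t).
  have [_ h] := subord_cos_RI t (0, 0) 0 a0.
  rewrite cos0 mulr1 /nrm2sq /= expr0n /= !addr0 in h; rewrite -h.
  by apply: RI_ext => xi; rewrite /dot2 /= !mulr0 !addr0 cos0 mulr1.
have si : intg (mu \x sleb2)%E (subord al).
  apply: (@tonelli_intg _ _ _ _ _ mu sleb2) => //.
  - exact: measurable_subord.
  - by move=> z; exact: subord_ge0.
  - apply: (@eq_intg _ _ _ mu (fun t => 4 * pi * (t ^+ 2 * gs (al ^+ 2) t))).
      by move=> t; rewrite -sE.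
    by apply: intgZ; exact: sqr_gs_int.
have fi : intg (mu \x sleb2)%E (fun z => subord al z * cos (dot2 z.2 y + c)).
  apply: (@intg_le _ _ _ (mu \x sleb2)%E _ (subord al)) => // z; rewrite normrM ger0_norm ?subord_ge0//.
  by rewrite ler_piMr ?subord_ge0 ?cos_norm_le1.
have f1 t : intg mu2 (fun xi => subord al (t, xi) * cos (dot2 xi y + c)).
  exact: (subord_cos_RI t y c a0).1.
have f2 xi : intg mu (fun t => subord al (t, xi) * cos (dot2 xi y + c)).
  apply: (@eq_intg _ _ _ mu (fun t => cos (dot2 xi y + c) * subord al (t, xi))).
    by move=> t; rewrite mulrC.
  by apply: intgZ; exact: subord_int_t.
have pE xi : poisson_symbol al xi * cos (dot2 xi y + c) =
   subord_cst * al * \int[mu]_t (subord al (t, xi) * cos (dot2 xi y + c)).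
  rewrite /poisson_symbol -mulrA; congr (_ * _); rewrite mulrC -RIZ; last exact: subord_int_t.
  by apply: RI_ext => t; rewrite mulrC.
have gi := @intg_RI2 _ _ _ _ _ mu sleb2 _ fi f2.
split.
  apply: (@eq_intg _ _ _ mu2 (fun xi => subord_cst * al *
     \int[mu]_t (subord al (t, xi) * cos (dot2 xi y + c)))) => //.
  exact: intgZ.
transitivity (subord_cst * al * \int[mu2]_xi \int[mu]_t (subord al (t, xi) * cos (dot2 xi y + c))).
  by rewrite -RIZ//; apply: RI_ext => xi.
have [_ _ E] := @Rfubini _ _ _ _ _ mu sleb2 _ fi f1 f2.
rewrite -[X in _ * X = _]E.
transitivity (subord_cst * al * \int[mu]_t (4 * pi * cos c * (t ^+ 2 * gs (al ^+ 2 + nrm2sq y) t))).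
  congr (_ * _); apply: RI_ext => t; exact: (subord_cos_RI t y c a0).2.
rewrite RIZ; last exact: sqr_gs_int.
rewrite sqr_gs_RI// powR_S32// /poisson /subord_cst.
have : 0 < Num.sqrt pi :> R by rewrite sqrtr_gt0 pi_gt0.
have := @pi_gt0 R.
move: (@pi R) (Num.sqrt pi) (powR _ _) => p q w p0 q0.
by field; rewrite !gt_eqF.
Qed.

Lemma poisson_symbol_int al : 0 < al -> intg mu2 (poisson_symbol al).
Proof.
move=> a0; have [h _] := poisson_symbol_RI (0, 0) 0 a0.
by apply: eq_intg h => xi; rewrite /dot2 /= !mulr0 !addr0 cos0 mulr1.
Qed.

Lemma poisson_symbolP al y : 0 < al ->
  ifourier (fun xi => (poisson_symbol al xi)%:C%C) y = (poisson al y)%:C%C.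
Proof.
move=> a0; apply: complexP => /=.
  have [_ h] := poisson_symbol_RI y 0 a0.
  rewrite cos0 mulr1 in h; rewrite -h; apply: RI_ext => x.
  by rewrite mul0r subr0 addr0.
have [_ h] := poisson_symbol_RI y (- (pi / 2)) a0.
rewrite cosN cos_pihalf mulr0 in h; rewrite -[RHS]h; apply: RI_ext => x.
by rewrite mul0r addr0 cosD cosN sinN cos_pihalf sin_pihalf; ring.
Qed.

Lemma poisson_symbol_ge0 al xi : 0 < al -> 0 <= poisson_symbol al xi.
Proof.
move=> a0; rewrite !mulr_ge0 ?(ltW subord_cst_gt0) ?(ltW a0)//.
by apply: RI_ge0 => t; exact: subord_ge0.
Qed.

(** By AM-GM, al^2 t^2 + r^2/(4 t^2) >= al r. Half of this inequality gives e^(-al r / 2), and half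
    of the Gaussian in t is kept for integrability. The integral of that Gaussian is of order 1/al,
    which cancels the prefactor [al]. *)
Lemma poisson_symbol_ub : exists2 C : R, 0 < C & forall al xi r, 0 < al -> 0 <= r ->
  r ^+ 2 <= nrm2sq xi -> poisson_symbol al xi <= C * expR (- (al * r / 2)).
Proof.
exists (subord_cst * Num.sqrt (2 * pi)).
  by rewrite mulr_gt0 ?subord_cst_gt0// sqrtr_gt0 mulr_gt0 ?pi_gt0.
move=> al xi r a0 r0 rx.
have a2 : 0 < al ^+ 2 / 2 by rewrite divr_gt0 ?exprn_gt0.
have [gi gE] := gs_int a2.
have le1 t : subord al (t, xi) <= expR (- (al * r / 2)) * gs (al ^+ 2 / 2) t.
  rewrite /subord /=; have [->|t0] := eqVneq t 0.
    by rewrite /= !mul0r mulr_ge0 ?expR_ge0 ?gs_ge0.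
  rewrite mul1r gs2E /gs -!expRD ler_expR.
  have n0 : 0 < `|t| by rewrite normr_gt0.
  have n2 : t ^+ 2 = `|t| ^+ 2 by rewrite real_normK ?num_real.
  rewrite n2.
  have : 0 <= (al * `|t| - r / (2 * `|t|)) ^+ 2 by exact: sqr_ge0.
  have -> : (al * `|t| - r / (2 * `|t|)) ^+ 2 =
    al ^+ 2 * `|t| ^+ 2 + (4 * `|t| ^+ 2)^-1 * r ^+ 2 - al * r.
    by field; rewrite gt_eqF.
  have : (4 * `|t| ^+ 2)^-1 * r ^+ 2 <= (4 * `|t| ^+ 2)^-1 * nrm2sq xi.
    by rewrite ler_wpM2l// invr_ge0 mulr_ge0// exprn_ge0.
  have : 0 <= (4 * `|t| ^+ 2)^-1 * nrm2sq xi.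
    by rewrite mulr_ge0 ?nrm2sq_ge0// invr_ge0 mulr_ge0// exprn_ge0.
  have : 0 <= al ^+ 2 * `|t| ^+ 2 by rewrite mulr_ge0 ?exprn_ge0// ltW.
  lra.
have : \int[mu]_t subord al (t, xi) <= expR (- (al * r / 2)) * Num.sqrt (pi / (al ^+ 2 / 2)).
  rewrite -gE -RIZ//; apply: (@le_RI _ _ _ mu) => //; first exact: subord_int_t.
  exact: intgZ.
have -> : Num.sqrt (pi / (al ^+ 2 / 2)) = Num.sqrt (2 * pi) / al.
  have -> : pi / (al ^+ 2 / 2) = 2 * pi * (al^-1) ^+ 2.
    by move: (@pi R) => p; field; rewrite gt_eqF.
  by rewrite sqrtrM ?mulr_ge0 ?pi_ge0// sqrtr_sqr ger0_norm// invr_ge0 ltW.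
move=> h; rewrite /poisson_symbol.
apply: (@le_trans _ _ (subord_cst * al * (expR (- (al * r / 2)) * (Num.sqrt (2 * pi) / al)))).
  by rewrite ler_wpM2l// mulr_ge0 ?(ltW subord_cst_gt0)// ltW.
rewrite le_eqVlt; apply/orP; left; apply/eqP; field; by rewrite gt_eqF.
Qed.

(** Only t in [t0, 2 t0] is kept, an interval around the minimiser sqrt (beta / (2 al)) of the
    exponent for |xi| = beta. On it both al^2 t^2 and |xi|^2/(4 t^2) are at most al beta, whence the
    exponent 2 al beta; its length t0 satisfies al t0 >= sqrt beta / 2 once al >= 1. *)
Lemma poisson_symbol_lb (beta : R) : 0 < beta -> exists2 c : R, 0 < c &
  forall al xi, 1 <= al -> nrm2sq xi <= beta ^+ 2 ->
  c * expR (- (2 * al * beta)) <= poisson_symbol al xi.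
Proof.
move=> b0; exists (subord_cst * (Num.sqrt beta / 2)).
  by rewrite mulr_gt0 ?subord_cst_gt0// divr_gt0 ?sqrtr_gt0.
move=> al xi a1 xb; have a0 : 0 < al by lra.
pose t0 := Num.sqrt (beta / (4 * al)).
have b4 : 0 < beta / (4 * al) by rewrite divr_gt0// mulr_gt0.
have t00 : 0 < t0 by rewrite sqrtr_gt0.
have t02 : t0 ^+ 2 = beta / (4 * al) by rewrite sqr_sqrtr// ltW.
pose I : set R := [set` `[t0, 2 * t0]%R].
have mI : measurable I by exact: measurable_itv.
have lt2 : t0 < 2 * t0 by lra.
have muE : mu I = t0%:E.
  rewrite /I lebesgue_measure_itv /= lte_fin lt2 -EFinB; congr EFin; lra.
have muI : fine (mu I) = t0 by rewrite muE.
have Ii : intg mu (\1_I).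
  apply: intg_ge0P; first exact: measurable_indic.
    by move=> t; rewrite indicE.
  rewrite integral_indic// setIT.
  by apply: (@le_lt_trans _ _ t0%:E); [rewrite -muE|exact: ltry].
have IE : \int[mu]_t \1_I t = t0.
  by rewrite /Rintegral integral_indic// setIT muI.
have le1 t : expR (- (2 * al * beta)) * \1_I t <= subord al (t, xi).
  rewrite indicE; have [|_] := boolP (t \in I); last by rewrite mulr0 subord_ge0.
  rewrite inE /I /= in_itv /= => /andP[l u].
  have tp : 0 < t by exact: lt_le_trans l.
  rewrite /subord /= gt_eqF//= mulr1 mul1r gs2E /gs -expRD ler_expR.
  have u2 : t ^+ 2 <= 4 * t0 ^+ 2.
    by have -> : 4 * t0 ^+ 2 = (2 * t0) ^+ 2 by [ring]; rewrite lerXn2r ?nnegrE ?(ltW tp)//; lra.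
  have l2 : t0 ^+ 2 <= t ^+ 2 by rewrite lerXn2r ?nnegrE ?(ltW tp) ?(ltW t00).
  have h1 : al ^+ 2 * t ^+ 2 <= al * beta.
    apply: (@le_trans _ _ (al ^+ 2 * (4 * t0 ^+ 2))).
      by rewrite ler_wpM2l// sqr_ge0.
    rewrite t02 le_eqVlt; apply/orP; left; apply/eqP; field; by rewrite gt_eqF.
  have h2 : (4 * t ^+ 2)^-1 * nrm2sq xi <= al * beta.
    apply: (@le_trans _ _ ((4 * t0 ^+ 2)^-1 * beta ^+ 2)).
      apply: ler_pM => //; rewrite ?nrm2sq_ge0//.
        by rewrite invr_ge0 mulr_ge0 ?sqr_ge0.
      by rewrite lef_pV2 ?posrE ?mulr_gt0 ?exprn_gt0// ler_wpM2l.
    rewrite t02 le_eqVlt; apply/orP; left; apply/eqP; field; by rewrite !gt_eqF.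
  lra.
have h : expR (- (2 * al * beta)) * t0 <= \int[mu]_t subord al (t, xi).
  rewrite -IE -RIZ//; apply: (@le_RI _ _ _ mu) => //; first exact: intgZ.
  exact: subord_int_t.
have t0a : Num.sqrt beta / 2 <= al * t0.
  have -> : Num.sqrt beta / 2 = Num.sqrt (beta / 4).
    rewrite sqrtrM ?(ltW b0)// sqrtrV//; congr (_ / _).
    by have -> : 4 = 2 ^+ 2 :> R by [ring]; rewrite sqrtr_sqr ger0_norm.
  have -> : al * t0 = Num.sqrt (al ^+ 2 * (beta / (4 * al))).
    by rewrite sqrtrM ?sqr_ge0// sqrtr_sqr ger0_norm// ltW.
  rewrite ler_wsqrtr//.
  have -> : al ^+ 2 * (beta / (4 * al)) = al * (beta / 4) by field; rewrite gt_eqF.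
  by rewrite ler_peMl// divr_ge0// ltW.
rewrite /poisson_symbol -!mulrA ler_wpM2l ?(ltW subord_cst_gt0)//.
have e0 := expR_ge0 (- (2 * al * beta)).
apply: (@le_trans _ _ (al * (expR (- (2 * al * beta)) * t0))).
  have h1 := ler_wpM2r e0 t0a.
  have -> : al * (expR (- (2 * al * beta)) * t0) = al * t0 * expR (- (2 * al * beta)) by ring.
  by rewrite !mulrA.
by rewrite ler_wpM2l// ltW.
Qed.

End PoissonSymbol.

(** * The square as a set of finite positive measure *)

Section SquareIndicator.
Context {R : realType}.
Local Notation mu := (@lebesgue_measure R).
Local Notation mu2 := (@leb2 R).

Lemma S_setX (delta : R) : S_ delta = `[- delta, delta]%classic `*` `[- delta, delta]%classic.
Proof. by apply/seteqP; split => -[a b] /=; rewrite !in_itv /= -!ler_norml. Qed.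

Lemma measurable_S (delta : R) : measurable (S_ delta).
Proof. by rewrite S_setX; apply: measurableX; exact: measurable_itv. Qed.

Lemma indic_S_int (delta : R) : intg mu2 (\1_(S_ delta)).
Proof.
apply: (@intg_le _ _ _ mu2 _ (fun x => expR (2 * delta ^+ 2) * gs2 1 x)).
- by apply: measurable_indic; exact: measurable_S.
- move=> x; rewrite ger0_norm// indicE; have [|_] := boolP (x \in S_ delta).
    rewrite inE => -[h1 h2]; rewrite gs2E -expRD -[leLHS]expR0 ler_expR mul1r.
    rewrite subr_ge0 /nrm2sq -(real_normK (num_real x.1)) -(real_normK (num_real x.2)).
    have := normr_ge0 x.1; have := normr_ge0 x.2; nra.
  by rewrite /= mulr_ge0 ?expR_ge0 ?gs2_ge0.
- by apply: intgZ; exact: gs2_int.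
Qed.

Lemma indic_S_RI_gt0 (delta : R) : 0 < delta -> 0 < \int[mu2]_x \1_(S_ delta) x.
Proof.
move=> d0; pose I : set R := `[- delta, delta]%classic.
have E1 : mu I = (2 * delta)%:E.
  rewrite /I lebesgue_measure_itv /= lte_fin; case: ifPn => [_|].
    by rewrite -EFinB; congr EFin; ring.
  by rewrite -leNgt => h; exfalso; move: h d0; lra.
have E2 : mu2 (S_ delta) = (mu I * mu I)%E.
  by rewrite S_setX /leb2 product_measure1E//; exact: measurable_itv.
have E : mu2 (S_ delta) = ((2 * delta) * (2 * delta))%:E by rewrite E2 E1.
have R1 : \int[mu2]_x \1_(S_ delta) x = fine (mu2 (S_ delta)).
  by rewrite /Rintegral integral_indic ?setIT//; exact: measurable_S.
by rewrite R1 E /= mulr_gt0// mulr_gt0.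
Qed.

Lemma L2sqE (D : set (R * R)) (g : R * R -> R[i]) : measurable D ->
  intg mu2 (fun x => \1_D x * cabs2 (g x)) ->
  L2sq D g = (\int[mu2]_x (\1_D x * cabs2 (g x)))%:E.
Proof.
move=> mD gi; rewrite -(RI_fin gi) /L2sq; etransitivity; first exact: (@integral_mkcond _ _ _ mu2 D).
apply: (@eq_integral _ _ _ mu2) => x _.
by rewrite patchE indicE; case: (x \in D); rewrite ?mul1r ?mul0r.
Qed.

End SquareIndicator.

(** * Exponential sums and the Bessel inequality on the plane *)

Section ExponentialSums.
Context {R : realType}.
Local Notation mu2 := (@leb2 R).
Implicit Types (x : nat -> R * R) (c : nat -> R[i]).

Lemma csum_cmeas N c x : cmeas (csum N c x).
Proof.
apply: cmeas_sum => j _; apply: cmeasM; first exact: cmeas_cst.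
exact: cmeas_expi_dot2r.
Qed.

Lemma nabs_sum (I : Type) (s : seq I) (F : I -> R[i]) :
  nabs (\sum_(i <- s) F i) <= \sum_(i <- s) nabs (F i).
Proof.
elim: s => [|i s ih]; first by rewrite !big_nil /nabs /= normr0 addr0.
by rewrite !big_cons (le_trans (nabsD _ _))// lerD2l.
Qed.

Definition csum_bound N c : R := \sum_(j < N) nabs (c j) * 2.

Lemma csum_nabs_le N c x xi : nabs (csum N c x xi) <= csum_bound N c.
Proof.
apply: (le_trans (nabs_sum _ _)); apply: ler_sum => j _.
by rewrite (le_trans (nabsM _ _))// ler_wpM2l ?nabs_ge0 ?nabs_expi.
Qed.

Lemma csum_cabs2_le N c x xi : cabs2 (csum N c x xi) <= csum_bound N c ^+ 2.
Proof.
rewrite (le_trans (cabs2_le_nabs _))//.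
have h := csum_nabs_le N c x xi.
by rewrite lerXn2r ?nnegrE ?nabs_ge0// (le_trans _ h) ?nabs_ge0.
Qed.

Lemma intg_csum N c x (w : R * R -> R) : intg mu2 w ->
  intg mu2 (fun xi => w xi * cabs2 (csum N c x xi)).
Proof.
move=> wi; apply: (@eq_intg _ _ _ mu2 (fun xi => cabs2 (csum N c x xi) * w xi)).
  by move=> xi; rewrite mulrC.
apply: (@intg_bM _ _ _ mu2 _ _ (csum_bound N c ^+ 2)) => //.
- by apply: measurable_cabs2; exact: csum_cmeas.
- by move=> xi; rewrite ger0_norm ?cabs2_ge0 ?csum_cabs2_le.
Qed.

Lemma csum_shift N c x (xi t : R * R) : csum N c x (xi.1 + t.1, xi.2 + t.2) =
  csum N (fun j => c j * expi (dot2 t (x j))) x xi.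
Proof.
apply: eq_bigr => j _; rewrite -mulrA -expiD; congr (_ * expi _).
by rewrite /dot2 /=; ring.
Qed.

(** An integrable weight on the plane that a translation by a point of the square diminishes by no
    more than a constant factor. *)
Definition pexp (xi : R * R) : R := expR (- `|xi.1|) * expR (- `|xi.2|).

Lemma pexp_gt0 xi : 0 < pexp xi.
Proof. by rewrite mulr_gt0 ?expR_gt0. Qed.

Lemma pexp_ge0 xi : 0 <= pexp xi. Proof. exact/ltW/pexp_gt0. Qed.

Lemma pexp_le1 xi : pexp xi <= 1.
Proof. by rewrite /pexp -expRD -[leRHS]expR0 ler_expR; have := normr_ge0 xi.1; have := normr_ge0 xi.2; lra. Qed.

(** By symmetry the integral is twice that over the half-line, which is compared with the
    exponential density of rate 1. *)
Lemma exp_abs_int : intg (@lebesgue_measure R) (fun t : R => expR (- `|t|)).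
Proof.
have cf : continuous (fun t : R => expR (- `|t|)).
  move=> t; apply: (@continuous_comp _ _ _ (fun t : R => - `|t|) expR).
    by apply: cvgN; exact: norm_continuous.
  exact: continuous_expR.
have mf : measurable_fun setT (fun t : R => expR (- `|t|)).
  by apply: continuous_measurable_fun; exact: cf.
have e := @integral_exponential_pdf R 1 ltr01.
apply: intg_ge0P => //.
have f0 (t : R) : 0 <= expR (- `|t|) by exact: expR_ge0.
have ev : (fun t : R => expR (- `|t|)) =1 (fun t : R => expR (- `|t|)) \o -%R.
  by move=> t /=; rewrite normrN.
rewrite [ltLHS](ge0_symfun_integralT f0 cf ev).
apply: lte_mul_pinfty => //; apply: (@le_lt_trans _ _ 1%E); last exact: ltry.
rewrite -e integral_mkcond; apply: ge0_le_integral => //.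
- by move=> t _; rewrite patchE; case: ifP => // _; rewrite lee_fin.
- apply/(measurable_restrictT _ _).1 => //.
    by rewrite -set_itvcy; exact: measurable_itv.
  by apply/measurable_EFinP; apply: measurable_funTS.
- by apply: measurableT_comp => //; exact: measurable_exponential_pdf.
- move=> t _; rewrite [leLHS]patchE; case: ifPn => [|_]; last by rewrite lee_fin exponential_pdf_ge0.
  rewrite inE /= => t0; rewrite exponential_pdfE// lee_fin ger0_norm//.
  by rewrite mul1r mulN1r.
Qed.

Lemma pexp_int : intg mu2 pexp.
Proof. exact: (intg_prod exp_abs_int exp_abs_int). Qed.

Lemma pexp_sub2 (delta : R) (t xi : R * R) : S_ delta xi ->
  expR (- (2 * delta)) * pexp t <= pexp (sub2 t xi).
Proof.
move=> [h1 h2]; rewrite /pexp /sub2 /= -!expRD ler_expR.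
by have := ler_normB t.1 xi.1; have := ler_normB t.2 xi.2; lra.
Qed.

(** Translating an exponential sum multiplies its coefficients by unimodular numbers, so [B] serves
    for all translates of the square. These bounds are averaged with the weight [pexp] of the
    translation: integrating over the square before t gives at most P B E, while integrating over t
    before the square and recentring gives at least A e^(-2 delta) times the weighted integral
    sought. *)
Lemma bessel (delta B : R) x : 0 < delta -> 0 < B ->
  (forall N c, (L2sq (S_ delta) (csum N c x) <= (B * \sum_(j < N) cabs2 (c j))%R%:E)%E) ->
  exists2 C : R, 0 < C & forall N c,
    \int[mu2]_xi (pexp xi * cabs2 (csum N c x xi)) <= C * \sum_(j < N) cabs2 (c j).
Proof.
move=> d0 B0 HB.
have A0 := indic_S_RI_gt0 d0; set A := (\int[mu2]_x \1_(S_ delta) x) in A0.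
have P0 : 0 <= \int[mu2]_x pexp x by apply: RI_ge0; exact: pexp_ge0.
set P := \int[mu2]_x pexp x in P0.
have e0 := expR_gt0 (- (2 * delta)).
(* The added 1 makes positivity immediate, since [P] is only known to be nonnegative here. *)
exists (P * B / (A * expR (- (2 * delta))) + 1).
  by rewrite ltr_wpDl// divr_ge0 ?mulr_ge0// ltW// mulr_gt0.
move=> N c; set E := \sum_(j < N) cabs2 (c j).
have E0 : 0 <= E by apply: sumr_ge0 => j _; exact: cabs2_ge0.
set Psi := csum N c x.
pose sh (t xi : R * R) : R * R := (xi.1 + t.1, xi.2 + t.2).
have shE t : (fun xi => Psi (sh t xi)) = csum N (fun j => c j * expi (dot2 t (x j))) x.
  by apply/funext => xi; rewrite /Psi /sh csum_shift.
have shC t xi : sh t xi = sh xi t by rewrite /sh; congr pair; rewrite addrC.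
have Ii := indic_S_int delta.
have bnd t : \int[mu2]_xi (\1_(S_ delta) xi * cabs2 (Psi (sh t xi))) <= B * E.
  have := HB N (fun j => c j * expi (dot2 t (x j))).
  have si : intg mu2 (fun xi => \1_(S_ delta) xi * cabs2 (Psi (sh t xi))).
    by have := @intg_csum N (fun j => c j * expi (dot2 t (x j))) x _ Ii; rewrite -shE.
  rewrite -shE (@L2sqE _ _ (fun xi => Psi (sh t xi)) (measurable_S delta) si).
  rewrite lee_fin; have -> // : \sum_(j < N) cabs2 (c j * expi (dot2 t (x j))) = E.
  by apply: eq_bigr => j _; rewrite cabs2M cabs2_expi mulr1.
set M := csum_bound N c ^+ 2.
have PM z : cabs2 (Psi z) <= M by exact: csum_cabs2_le.
pose F (z : (R * R) * (R * R)) := pexp z.1 * (\1_(S_ delta) z.2 * cabs2 (Psi (sh z.1 z.2))).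
have msh : measurable_fun setT (fun z : (R * R) * (R * R) => sh z.1 z.2).
  apply: measurable_fun_pair; apply: measurable_funD.
  - exact: (measurableT_comp measurable_fst).
  - exact: (measurableT_comp measurable_fst).
  - exact: (measurableT_comp measurable_snd).
  - exact: (measurableT_comp measurable_snd).
have mPsi : measurable_fun setT (fun z => cabs2 (Psi z)).
  by apply: measurable_cabs2; exact: csum_cmeas.
have mF : measurable_fun setT F.
  apply: measurable_funM.
    exact: (measurableT_comp (intg_meas pexp_int) measurable_fst).
  apply: measurable_funM.
    exact: (measurableT_comp (intg_meas Ii) measurable_snd).
  exact: (measurableT_comp mPsi msh).
have Fi : intg (sleb2 \x sleb2)%E F.
  apply: (@intg_le _ _ _ (sleb2 \x sleb2)%E _ (fun z => M * (pexp z.1 * \1_(S_ delta) z.2))) => //.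
    move=> z; rewrite ger0_norm; last by rewrite !mulr_ge0 ?pexp_ge0 ?cabs2_ge0.
    rewrite /F [leLHS]mulrA [leLHS]mulrC ler_wpM2r// mulr_ge0 ?pexp_ge0//.
  by apply: intgZ; exact: (@intg_prod _ _ _ _ _ sleb2 sleb2 _ _ pexp_int Ii).
have F1 t : intg mu2 (fun xi => F (t, xi)).
  by rewrite /F /=; apply: intgZ; have := @intg_csum N (fun j => c j * expi (dot2 t (x j))) x _ Ii;
    rewrite -shE.
have F2 xi : intg mu2 (fun t => F (t, xi)).
  apply: (@eq_intg _ _ _ mu2 (fun t => \1_(S_ delta) xi * (pexp t * cabs2 (Psi (sh xi t))))).
    by move=> t; rewrite /F /= shC; ring.
  apply: intgZ; have := @intg_csum N (fun j => c j * expi (dot2 xi (x j))) x _ pexp_int.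
  by rewrite -shE.
have [G1 _ G2] := @Rfubini _ _ _ _ _ sleb2 sleb2 _ Fi F1 F2.
have G3 := @intg_RI2 _ _ _ _ _ sleb2 sleb2 _ Fi F2.
have up : \int[mu2]_t \int[mu2]_xi F (t, xi) <= P * (B * E).
  rewrite mulrC -(RIZ _ pexp_int).
  apply: (@le_RI _ _ _ mu2); [exact: G1|exact: intgZ pexp_int|].
  move=> t; rewrite /F /= RIZ; last first.
    by have := @intg_csum N (fun j => c j * expi (dot2 t (x j))) x _ Ii; rewrite -shE.
  by rewrite mulrC ler_wpM2r ?pexp_ge0.
set Q := \int[mu2]_xi (pexp xi * cabs2 (Psi xi)).
have Qi : intg mu2 (fun xi => pexp xi * cabs2 (Psi xi)) by exact: intg_csum pexp_int.
have lo : A * (expR (- (2 * delta)) * Q) <= \int[mu2]_xi \int[mu2]_t F (t, xi).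
  rewrite mulrC -(RIZ _ Ii).
  apply: (@le_RI _ _ _ mu2); [exact: intgZ Ii|exact: G3|].
  move=> xi; have -> : \int[mu2]_t F (t, xi) =
      \1_(S_ delta) xi * \int[mu2]_t (pexp t * cabs2 (Psi (sh xi t))).
    rewrite -RIZ; last first.
      by have := @intg_csum N (fun j => c j * expi (dot2 xi (x j))) x _ pexp_int; rewrite -shE.
    by apply: RI_ext => t; rewrite /F /= shC; ring.
  rewrite mulrC indicE; have [|_] := boolP (xi \in S_ delta); last by rewrite !mul0r.
  rewrite inE !mul1r => Sxi.
  have Ki : intg mu2 (fun t => pexp t * cabs2 (Psi (sh xi t))).
    by have := @intg_csum N (fun j => c j * expi (dot2 xi (x j))) x _ pexp_int; rewrite -shE.
  have K0 t : 0 <= pexp t * cabs2 (Psi (sh xi t)).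
    by rewrite mulr_ge0 ?pexp_ge0 ?cabs2_ge0.
  rewrite -(RI_sub2 xi K0 Ki) -(RIZ _ Qi); apply: (@le_RI _ _ _ mu2).
  - exact: intgZ Qi.
  - exact: (intg_sub2 xi K0 Ki).
  - move=> t; have -> : sh xi (sub2 t xi) = t.
      by rewrite /sh /sub2 /= !subrK; case: t.
    rewrite mulrA; apply: ler_wpM2r; first exact: cabs2_ge0.
    exact: pexp_sub2.
have fin : A * (expR (- (2 * delta)) * Q) <= P * (B * E).
  by apply: (le_trans lo); rewrite -[leLHS]G2.
have Q1 : Q <= P * B / (A * expR (- (2 * delta))) * E.
  rewrite mulrAC ler_pdivlMr; last exact: mulr_gt0 A0 e0.
  have -> : Q * (A * expR (- (2 * delta))) = A * (expR (- (2 * delta)) * Q) by ring.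
  by rewrite -mulrA.
by rewrite [leRHS]mulrDl mul1r; apply: (le_trans Q1); rewrite lerDl; exact: E0.
Qed.

End ExponentialSums.

(** * Pairing with exponentials and the Gram matrix *)

Section Sampling.
Context {R : realType}.
Local Notation mu2 := (@leb2 R).
Implicit Types (g h : R * R -> R[i]) (c d : nat -> R[i]) (x : nat -> R * R).

(** The inner product of g with e^(i<.,y>), hence the conjugate. *)
Definition cfourier g (y : R * R) : R[i] :=
  CI mu2 (fun xi => g xi * conjc (expi (dot2 xi y))).

Lemma cintg_conj_expi g y : cintg mu2 g ->
  cintg mu2 (fun xi => g xi * conjc (expi (dot2 xi y))).
Proof.
move=> gi; apply: (@eq_cintg _ _ _ mu2 (fun xi => conjc (expi (dot2 xi y)) * g xi)).
  by move=> xi; rewrite mulrC.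
apply: (@cintg_bM _ _ _ mu2 _ _ 2) => //.
  by apply: cmeasJ; exact: cmeas_expi_dot2r.
by move=> xi; rewrite nabsJ; exact: nabs_expi.
Qed.

Lemma cintg_csum g M c x : cintg mu2 g ->
  cintg mu2 (fun xi => g xi * conjc (csum M c x xi)).
Proof.
move=> gi; apply: (@eq_cintg _ _ _ mu2 (fun xi => conjc (csum M c x xi) * g xi)).
  by move=> xi; rewrite mulrC.
apply: (@cintg_bM _ _ _ mu2 _ _ (csum_bound M c)) => //.
  by apply: cmeasJ; exact: csum_cmeas.
by move=> xi; rewrite nabsJ; exact: csum_nabs_le.
Qed.

Lemma CI_csum g M c x : cintg mu2 g ->
  CI mu2 (fun xi => g xi * conjc (csum M c x xi)) =
  \sum_(k < M) conjc (c k) * cfourier g (x k).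
Proof.
move=> gi.
transitivity (CI mu2 (fun xi => \sum_(k < M) conjc (c k) * (g xi * conjc (expi (dot2 xi (x k)))))).
  apply: eq_CI => xi; rewrite /csum rmorph_sum mulr_sumr; apply: eq_bigr => k _.
  by rewrite rmorphM mulrCA.
rewrite CI_sum; last by move=> k _; apply: cintgZ; exact: cintg_conj_expi.
by apply: eq_bigr => k _; rewrite CIZ//; exact: cintg_conj_expi.
Qed.

Lemma Re_sum (I : Type) (s : seq I) (F : I -> R[i]) :
  complex.Re (\sum_(i <- s) F i) = \sum_(i <- s) complex.Re (F i).
Proof.
by elim: s => [|i s ih]; rewrite ?big_nil// !big_cons reim ih.
Qed.

Lemma Im_sum (I : Type) (s : seq I) (F : I -> R[i]) :
  complex.Im (\sum_(i <- s) F i) = \sum_(i <- s) complex.Im (F i).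
Proof.
by elim: s => [|i s ih]; rewrite ?big_nil// !big_cons reim ih.
Qed.

Lemma real_csum_cintg (G : R * R -> R) N c x : intg mu2 G ->
  cintg mu2 (fun xi => (G xi)%:C%C * csum N c x xi).
Proof.
move=> Gi; apply: (@eq_cintg _ _ _ mu2 (fun xi => csum N c x xi * (G xi)%:C%C)).
  by move=> xi; rewrite mulrC.
apply: (@cintg_bM _ _ _ mu2 _ _ (csum_bound N c)); first exact: csum_cmeas.
- exact: csum_nabs_le.
- exact: cintg_real.
Qed.

(* A vector of values of the Gram matrix is tested against itself. *)
Lemma gram_bound (G : R * R -> R) x x' (T T' : R) J M d :
  (forall xi, 0 <= G xi) -> intg mu2 G -> 0 < T' ->
  \int[mu2]_xi (G xi * cabs2 (csum J d x xi)) <= T * \sum_(j < J) cabs2 (d j) ->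
  (forall c, \int[mu2]_xi (G xi * cabs2 (csum M c x' xi)) <=
     T' * \sum_(k < M) cabs2 (c k)) ->
  \sum_(k < M) cabs2 (cfourier (fun xi => (G xi)%:C%C * csum J d x xi) (x' k)) <=
  T * T' * \sum_(j < J) cabs2 (d j).
Proof.
move=> G0 Gi T0 HT HT'.
set g := fun xi => (G xi)%:C%C * csum J d x xi.
have gi : cintg mu2 g by exact: real_csum_cintg.
pose eta k := cfourier g (x' k).
set D := \sum_(j < J) cabs2 (d j) in HT *.
set E := \sum_(k < M) cabs2 (eta k).
have E1 : E = complex.Re (CI mu2 (fun xi => g xi * conjc (csum M eta x' xi))).
  rewrite CI_csum// Re_sum; apply: eq_bigr => k _.
  by rewrite cabs2E mulrC.
have i1 := intg_csum J d x Gi.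
have i2 := intg_csum M eta x' Gi.
(* With weight [T'] in Young's inequality the second term is at most E itself, which the left side
   absorbs. *)
have : 2 * E <= T' * (T * D) + T'^-1 * (T' * E).
  apply: (@le_trans _ _ (T' * \int[mu2]_xi (G xi * cabs2 (csum J d x xi)) +
     T'^-1 * \int[mu2]_xi (G xi * cabs2 (csum M eta x' xi)))).
    have ci := cintg_csum M eta x' gi.
    rewrite E1 /CI /= -(RIZ _ ci.1) -(RIZ _ i1) -(RIZ _ i2) -RID; [|exact: intgZ i1|exact: intgZ i2].
    apply: (@le_RI _ _ _ mu2); [exact: intgZ ci.1|by apply: intgD; [exact: intgZ i1|exact: intgZ i2]|].
    move=> xi; have := young_complex (csum J d x xi) (csum M eta x' xi) T0.
    rewrite /g -mulrA ![complex.Re (_%:C%C * _)]reim /= mul0r subr0.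
    have := G0 xi; move: (complex.Re _) => r Gx h.
    have := ler_wpM2l Gx h; lra.
  apply: lerD; first by rewrite ler_wpM2l// ltW.
  by rewrite ler_wpM2l ?invr_ge0 ?(ltW T0)//; exact: HT'.
rewrite mulKf ?gt_eqF// -/E; set W := T' * (T * D) => h.
have -> : T * T' * D = W by rewrite /W; ring.
by move: h; clear; lra.
Qed.

End Sampling.

(** * The estimate for the truncated residual *)

Section MainEstimate.
Context {R : realType}.
Local Notation mu2 := (@leb2 R).
Variables (x : nat -> R * R) (delta : R) (G : R * R -> R) (H : R * R -> R[i]).
Variables (m K1 K A C : R).
Hypothesis G0 : forall xi, 0 <= G xi.
Hypothesis Gi : intg mu2 G.
Hypothesis GK1 : forall xi, G xi <= K1.
Hypothesis K0 : 0 < K.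
Hypothesis GK : forall xi, ~ S_ delta xi -> G xi <= K * pexp xi.
Hypothesis Hi : cintg mu2 H.
Hypothesis H2 : intg mu2 (fun xi => cabs2 (H xi)).
Hypothesis m0 : 0 < m.
Hypothesis Hm : forall xi, H xi <> 0 -> m <= G xi.
Hypothesis HS : forall xi, ~ S_ delta xi -> H xi = 0.
Hypothesis A0 : 0 < A.
Hypothesis riesz_lb : forall (N : nat) (c : nat -> R[i]), ((A * \sum_(j < N) cabs2 (c j))%R%:E <=
  L2sq (S_ delta) (csum N c x))%E.
Hypothesis complete : forall g, L2on (S_ delta) g -> forall eps : R, 0 < eps ->
  exists N c, (L2sq (S_ delta) (fun xi => (g xi - csum N c x xi)%R) < eps%:E)%E.
Hypothesis C0 : 0 < C.
Hypothesis HC : forall (N : nat) (c : nat -> R[i]),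
  \int[mu2]_xi (pexp xi * cabs2 (csum N c x xi)) <= C * \sum_(j < N) cabs2 (c j).

(** [b] provides finitely many coefficients with square sum at most [A2]. The residual is then only
    almost orthogonal to the exponentials: [w] bounds the square sum of its pairings, and [l] is a
    weight left free to balance [A2] against [w]. *)
Variables (N : nat) (b : nat -> R[i]) (w A2 l : R).

Let Phi := csum N b x.
Definition residual xi : R[i] := H xi - (G xi)%:C%C * csum N b x xi.
Local Notation h := residual.
Hypothesis hw : forall M, \sum_(k < M) cabs2 (cfourier h (x k)) <= w.
Hypothesis bA : \sum_(j < N) cabs2 (b j) <= A2.
Hypothesis l0 : 0 < l.

Let Q := \int[mu2]_xi (G xi * cabs2 (Phi xi)).
Let Qi : intg mu2 (fun xi => G xi * cabs2 (Phi xi)).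
Proof. exact: intg_csum Gi. Qed.
Lemma residual_cintg : cintg mu2 h.
Proof. by apply: cintgB => //; exact: real_csum_cintg. Qed.

Let hm : cmeas h. Proof. exact: cintg_cmeas residual_cintg. Qed.

Lemma residual_L2 : intg mu2 (fun xi => cabs2 (h xi)).
Proof.
apply: (@intg_le _ _ _ mu2 _ (fun xi => 2 * cabs2 (H xi) + (2 * K1) * (G xi * cabs2 (Phi xi)))).
- exact: measurable_cabs2.
- move=> xi; rewrite ger0_norm ?cabs2_ge0// (le_trans (cabs2D _ _))// cabs2N cabs2M.
  apply: lerD => //; rewrite -[leRHS]mulrA ler_wpM2l// mulrA ler_wpM2r ?cabs2_ge0//.
  by rewrite /cabs2 /= expr0n /= addr0 expr2 ler_wpM2r.
- by apply: intgD; apply: intgZ.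
Qed.

Lemma youngN (r : R) (z v : R[i]) : 0 < r ->
  - (2 * complex.Re (z * conjc v)) <= r * cabs2 z + r^-1 * cabs2 v.
Proof.
move=> r0; have := young_complex (- z) v r0.
by rewrite mulNr ReN cabs2N mulrN.
Qed.

(** The pairing with an exponential sum sees only the numbers [cfourier h (x k)], so Young's
    inequality applies term by term. Both signs are needed: one for the energy, the other for the
    inner part. *)
Let pair_le (r : R) M c : 0 < r ->
  2 * complex.Re (CI mu2 (fun xi => h xi * conjc (csum M c x xi))) <=
    r * \sum_(k < M) cabs2 (c k) + r^-1 * w /\
  - (2 * complex.Re (CI mu2 (fun xi => h xi * conjc (csum M c x xi)))) <=
    r * \sum_(k < M) cabs2 (c k) + r^-1 * w.
Proof.
move=> r0; rewrite CI_csum ?Re_sum; last exact: residual_cintg.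
have ri : 0 <= r^-1 by rewrite invr_ge0 ltW.
have hM := ler_wpM2l ri (hw M).
have rE (z v : R[i]) : complex.Re (conjc z * v) = complex.Re (z * conjc v).
  by rewrite !reim; ring.
split.
- apply: (@le_trans _ _ (r * \sum_(k < M) cabs2 (c k) +
     r^-1 * \sum_(k < M) cabs2 (cfourier h (x k)))); last by rewrite lerD2l.
  rewrite !mulr_sumr -big_split /=; apply: ler_sum => k _.
  by rewrite rE; exact: young_complex.
- apply: (@le_trans _ _ (r * \sum_(k < M) cabs2 (c k) +
     r^-1 * \sum_(k < M) cabs2 (cfourier h (x k)))); last by rewrite lerD2l.
  rewrite !mulr_sumr -sumrN -big_split /=; apply: ler_sum => k _.
  by rewrite rE; exact: youngN.
Qed.

(** Twice the pairing of h with Phi contains -2 G |Phi|^2. Where H is nonzero, m <= G, and Young's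
    inequality with weight 1/m costs only one of these two copies; elsewhere the cross term
    vanishes. The remaining copy integrates to Q. *)
Lemma energy_le : Q <= m^-1 * \int[mu2]_xi cabs2 (H xi) + l * A2 + l^-1 * w.
Proof.
have ci := cintg_csum N b x residual_cintg.
have := (pair_le N b l0).2.
have lb := ler_wpM2l (ltW l0) bA.
suff : 2 * complex.Re (CI mu2 (fun xi => h xi * conjc (Phi xi))) <=
   m^-1 * \int[mu2]_xi cabs2 (H xi) - Q by rewrite -/Phi; lra.
rewrite /CI /= -(RIZ _ ci.1) -(RIZ _ H2) -(RIB (intgZ _ H2) Qi).
apply: (@le_RI _ _ _ mu2); [exact: intgZ ci.1|by apply: intgB => //; exact: intgZ|].
move=> xi; have -> : complex.Re (h xi * conjc (Phi xi)) =
    complex.Re (H xi * conjc (Phi xi)) - G xi * cabs2 (Phi xi).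
  by rewrite /residual -/Phi /cabs2 !reim /=; ring.
suff : 2 * complex.Re (H xi * conjc (Phi xi)) <= m^-1 * cabs2 (H xi) + G xi * cabs2 (Phi xi).
  by lra.
have [Hz|/eqP/Hm mG] := eqVneq (H xi) 0.
  rewrite Hz mul0r /= mulr0 addr_ge0// mulr_ge0 ?cabs2_ge0//.
  by rewrite invr_ge0 ltW.
have mi : 0 < m^-1 by rewrite invr_gt0.
rewrite (le_trans (young_complex _ _ mi))// invrK lerD2l ler_wpM2r ?cabs2_ge0//.
Qed.

(** Off the square |h|^2 = G^2 |Phi|^2: one factor G is bounded by K and the other is kept for the
    energy. *)
Lemma outer_le : \int[mu2]_xi ((1 - \1_(S_ delta) xi) * cabs2 (h xi)) <= K * Q.
Proof.
have mS := measurable_S delta.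
rewrite -(RIZ _ Qi); apply: (@le_RI _ _ _ mu2); [|exact: intgZ Qi|].
  apply: (@intg_bM _ _ _ mu2 _ _ 1); last exact: residual_L2.
    by apply: measurable_funB => //; exact: measurable_indic.
  by move=> xi; rewrite indicE; case: (_ \in _); rewrite /= ?subrr ?subr0 ?normr0 ?normr1.
move=> xi; rewrite indicE; have [_|] := boolP (xi \in S_ delta).
  by rewrite subrr mul0r !mulr_ge0 ?cabs2_ge0// ltW.
rewrite notin_setE => nS; rewrite /= subr0 mul1r /residual HS// sub0r cabs2N cabs2M.
rewrite mulrA -/Phi ler_wpM2r ?cabs2_ge0//.
rewrite /cabs2 /= expr0n /= addr0 expr2 ler_wpM2r// (le_trans (GK nS))//.
by rewrite ler_piMr ?pexp_le1// ltW.
Qed.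

(** Let psi approximate h on the square. In |h|^2 = |h - psi|^2 - |psi|^2 + 2 Re (h conj psi) the
    Riesz bound makes the middle term at most -A E after integration. The pairing over the square is
    the nearly vanishing pairing over the plane minus the outer one, where h = -G Phi. The term -A E
    absorbs all the dependence on the coefficients of psi, which are not bounded otherwise. *)
Lemma inner_le : \int[mu2]_xi (\1_(S_ delta) xi * cabs2 (h xi)) <=
  2 / A * w + 2 * C / A * (K * Q).
Proof.
have mS := measurable_S delta.
have iM (f : R * R -> R) : intg mu2 f -> intg mu2 (fun xi => \1_(S_ delta) xi * f xi).
  apply: (@intg_bM _ _ _ mu2 _ _ 1); first exact: measurable_indic.
  by move=> xi; rewrite indicE; case: (_ \in _); rewrite /= ?normr0 ?normr1.
have h2 := residual_L2.
apply/ler_addgt0Pl => e e0.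
have hS : L2on (S_ delta) h.
  split; [|split].
  - by apply: measurable_funTS; have [] := hm.
  - by apply: measurable_funTS; have [] := hm.
  - by apply: (@integrableS _ _ _ mu2 setT) => //.
have [M [c]] := complete hS e0.
set psi := csum M c x; set E := \sum_(k < M) cabs2 (c k).
have pm : cmeas psi by exact: csum_cmeas.
have Ii := indic_S_int delta.
have psi2 : intg mu2 (fun xi => \1_(S_ delta) xi * cabs2 (psi xi)) by exact: intg_csum Ii.
have ppsi : intg mu2 (fun xi => pexp xi * cabs2 (psi xi)) by exact: (intg_csum _ _ _ pexp_int).
have d2 : intg mu2 (fun xi => \1_(S_ delta) xi * cabs2 (h xi - psi xi)).
  apply: (@intg_le _ _ _ mu2 _ (fun xi => 2 * (\1_(S_ delta) xi * cabs2 (h xi)) +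
     2 * (\1_(S_ delta) xi * cabs2 (psi xi)))).
  - apply: measurable_funM; first exact: measurable_indic.
    by apply: measurable_cabs2; exact: cmeasB.
  - move=> xi; rewrite ger0_norm; last by rewrite mulr_ge0 ?cabs2_ge0.
    have := cabs2D (h xi) (- psi xi); rewrite cabs2N.
    by rewrite indicE; case: (_ \in _); rewrite /= ?mul1r ?mul0r ?mulr0 ?addr0.
  - by apply: intgD; apply: intgZ => //; exact: iM.
rewrite (L2sqE mS d2) lte_fin => dle.
have := riesz_lb M c; rewrite (L2sqE mS psi2) lee_fin -/psi -/E => rl.
have pC := HC M c; rewrite -/psi -/E in pC.
have ci := cintg_csum M c x residual_cintg; rewrite -/psi in ci.
(* The negative term A E is spent in two halves: A/2 as the weight for the pairing over the plane,
   and A/2 = nu C for the Bessel bound on psi, which fixes [nu]. *)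
have hA : 0 < A / 2 by rewrite divr_gt0.
have pl := (pair_le M c hA).1; rewrite -/psi -/E in pl.
pose nu := A / (2 * C); have nu0 : 0 < nu by rewrite divr_gt0// mulr_gt0.
(* The inequality holds pointwise under the integrals. On the square it expands |h - psi|^2; off it
   the left side is 0 and Young's inequality has to dominate the pairing. *)
have key : \int[mu2]_xi (\1_(S_ delta) xi * cabs2 (h xi)) <=
   \int[mu2]_xi (\1_(S_ delta) xi * cabs2 (h xi - psi xi)) -
   \int[mu2]_xi (\1_(S_ delta) xi * cabs2 (psi xi)) +
   (2 * complex.Re (CI mu2 (fun xi => h xi * conjc (psi xi))) +
    (nu^-1 * K * Q + nu * \int[mu2]_xi (pexp xi * cabs2 (psi xi)))).
  have j1 := intgB d2 psi2.
  have j2 := intgZ (nu^-1 * K) Qi; have j3 := intgZ nu ppsi.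
  have j4 := intgZ 2 ci.1; have j5 := intgD j2 j3; have j6 := intgD j4 j5.
  rewrite -(RIB d2 psi2) /CI /= -(RIZ _ ci.1) -(RIZ _ Qi) -(RIZ _ ppsi).
  rewrite -(RID j2 j3) -(RID j4 j5) -(RID j1 j6).
  apply: (@le_RI _ _ _ mu2); [exact: iM|exact: intgD|].
  move=> xi; have p0 := pexp_ge0 xi; have c0 := cabs2_ge0 (psi xi).
  have f0 := cabs2_ge0 (Phi xi); have g0 := G0 xi.
  have t1 : 0 <= nu^-1 * K * (G xi * cabs2 (Phi xi)).
    by rewrite !mulr_ge0 ?invr_ge0 ?(ltW nu0) ?(ltW K0).
  have t2 : 0 <= nu * (pexp xi * cabs2 (psi xi)).
    by apply: mulr_ge0; [exact: ltW|exact: mulr_ge0].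
  rewrite indicE; have [_|] := boolP (xi \in S_ delta).
    rewrite !mul1r.
    have -> : cabs2 (h xi - psi xi) = cabs2 (h xi) + cabs2 (psi xi) -
       2 * complex.Re (h xi * conjc (psi xi)).
      by rewrite /cabs2 !reim; ring.
    by lra.
  rewrite notin_setE => nS; rewrite /= !mul0r subrr add0r.
  have hE : h xi = - ((G xi)%:C%C * Phi xi) by rewrite /residual HS// sub0r.
  have -> : complex.Re (h xi * conjc (psi xi)) = - (G xi * complex.Re (Phi xi * conjc (psi xi))).
    by rewrite hE !reim /=; ring.
  (* With this weight the factor K from the bound of G by K pexp cancels, leaving exactly nu pexp
     |psi|^2. *)
  have kn : 0 < K / nu by rewrite divr_gt0.
  have := young_complex (Phi xi) (psi xi) kn => y1.
  have y2 := ler_wpM2l g0 y1.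
  have y3 : (K / nu)^-1 * (G xi * cabs2 (psi xi)) <= nu * (pexp xi * cabs2 (psi xi)).
    have := ler_wpM2r c0 (GK nS) => y4.
    have nk : 0 <= (K / nu)^-1 by rewrite invr_ge0 ltW.
    apply: (le_trans (ler_wpM2l nk y4)).
    rewrite invf_div le_eqVlt; apply/orP; left; apply/eqP; field.
    by rewrite gt_eqF.
  have -> : nu^-1 * K * (G xi * cabs2 (Phi xi)) = G xi * (K / nu * cabs2 (Phi xi)) by ring.
  have E5 : G xi * ((K / nu)^-1 * cabs2 (psi xi)) = (K / nu)^-1 * (G xi * cabs2 (psi xi)) by ring.
  rewrite mulrDr E5 in y2.
  by lra.
have n1 : nu^-1 * K * Q = 2 * C / A * (K * Q).
  by rewrite /nu; field; rewrite !gt_eqF.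
have n2 : nu * \int[mu2]_xi (pexp xi * cabs2 (psi xi)) <= A / 2 * E.
  apply: (le_trans (ler_wpM2l (ltW nu0) pC)).
  rewrite /nu le_eqVlt; apply/orP; left; apply/eqP; field; by rewrite gt_eqF.
have n3 : (A / 2)^-1 * w = 2 / A * w by field; rewrite gt_eqF.
rewrite n1 in key; rewrite n3 in pl.
by lra.
Qed.

Lemma main_estimate : \int[mu2]_xi cabs2 (h xi) <= 2 / A * w +
  (2 * C / A + 1) * (K * (m^-1 * \int[mu2]_xi cabs2 (H xi) + l * A2 + l^-1 * w)).
Proof.
have mS := measurable_S delta.
have h2 := residual_L2.
have i1 : intg mu2 (fun xi => \1_(S_ delta) xi * cabs2 (h xi)).
  apply: (@intg_bM _ _ _ mu2 _ _ 1) h2; first exact: measurable_indic.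
  by move=> xi; rewrite indicE; case: (_ \in _); rewrite /= ?normr0 ?normr1.
have i2 : intg mu2 (fun xi => (1 - \1_(S_ delta) xi) * cabs2 (h xi)).
  by apply: (@eq_intg _ _ _ mu2 _ _ _ (intgB h2 i1)) => xi; rewrite mulrBl mul1r.
have -> : \int[mu2]_xi cabs2 (h xi) = \int[mu2]_xi (\1_(S_ delta) xi * cabs2 (h xi)) +
   \int[mu2]_xi ((1 - \1_(S_ delta) xi) * cabs2 (h xi)).
  by rewrite -RID//; apply: RI_ext => xi; ring.
have cA : 0 <= 2 * C / A by rewrite divr_ge0 ?(ltW A0)// mulr_ge0// ltW.
have o := outer_le; have i := inner_le.
have q := ler_wpM2l (ltW K0) energy_le.
set T := K * (_ + _ + _) in q *.
have q' := ler_wpM2l cA q.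
lra.
Qed.

End MainEstimate.

(** * Square-summable sequences and their tails *)

Lemma cvgn_of_tail {R : realType} (u : nat -> R) :
  (forall e, 0 < e -> exists N, forall J, (N <= J)%N -> `|u N - u J| <= e) -> cvgn u.
Proof.
move=> H; apply/cauchy_cvgP/cauchy_exP => e e0.
have [N HN] := H (e / 2) (divr_gt0 e0 (ltr0n R 2)).
exists (u N); exists N => // J /= NJ.
by rewrite /ball /= (le_lt_trans (HN J NJ))// ltr_pdivrMr// ltr_pMr// ltr1n.
Qed.

Lemma conjB {R : realType} (z v : R[i]) : conjc (z - v) = conjc z - conjc v.
Proof. by apply: complexP; rewrite !reim //; ring. Qed.

Lemma conjM {R : realType} (z v : R[i]) : conjc (z * v) = conjc z * conjc v.
Proof. by apply: complexP; rewrite !reim; ring. Qed.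

Section SquareSummable.
Context {R : realType}.
Variable a : nat -> R[i].
Hypothesis a2 : ell2 a.

Lemma partial_cabs2_le N : \sum_(j < N) cabs2 (a j) <= limn (series (fun j => cabs2 (a j))).
Proof.
rewrite -(big_mkord xpredT (fun j => cabs2 (a j))).
apply: (nondecreasing_cvgn_le _ a2 N); apply/nondecreasing_seqP => n.
by rewrite !seriesEord /= big_ord_recr /= lerDl cabs2_ge0.
Qed.

(** Zeroing the leading terms makes a difference of two partial sums a partial sum again, so the
    bounds for finite sums apply to it. *)
Definition tail_from N j : R[i] := if (j < N)%N then 0 else a j.

Lemma cabs20 : cabs2 (0 : R[i]) = 0.
Proof. by rewrite /cabs2 /= expr0n /= addr0. Qed.

Lemma tail_from_sum N J : (N <= J)%N ->
  \sum_(j < J) cabs2 (tail_from N j) = \sum_(j < J) cabs2 (a j) - \sum_(j < N) cabs2 (a j).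
Proof.
move=> NJ; rewrite -(big_mkord xpredT (fun j => cabs2 (tail_from N j))).
rewrite -(big_mkord xpredT (fun j => cabs2 (a j))).
rewrite -(big_mkord xpredT (fun j => cabs2 (a j))).
rewrite (big_cat_nat (n := N))//= [X in _ = X - _](big_cat_nat (n := N))//=.
rewrite [X in _ = X - _]addrC addrK big_nat_cond big1 ?add0r.
  by apply: eq_big_nat => j /andP[Nj _]; rewrite /tail_from ltnNge Nj.
by move=> j /andP[/andP[_ jN] _]; rewrite /tail_from jN cabs20.
Qed.

Lemma tail_small (e : R) : 0 < e -> exists N0, forall N J, (N0 <= N)%N -> (N <= J)%N ->
  \sum_(j < J) cabs2 (tail_from N j) <= e.
Proof.
move=> e0; have e2 : 0 < e / 2 by rewrite divr_gt0.
have /cvgrPdist_le/(_ _ e2)[N0 _ HN] := a2.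
exists N0 => N J N0N NJ; rewrite tail_from_sum//.
have := HN N N0N; have := HN J (leq_trans N0N NJ) => /=.
rewrite !seriesEord /= !ler_norml => /andP[h1 _] /andP[_ h2].
by move: h1 h2; lra.
Qed.

Lemma csum_tail N J (x : nat -> R * R) xi : (N <= J)%N ->
  csum J (tail_from N) x xi = csum J a x xi - csum N a x xi.
Proof.
move=> NJ; rewrite /csum -(big_mkord xpredT (fun j => tail_from N j * expi (dot2 xi (x j)))).
rewrite -(big_mkord xpredT (fun j => a j * expi (dot2 xi (x j)))).
rewrite -(big_mkord xpredT (fun j => a j * expi (dot2 xi (x j)))).
rewrite (big_cat_nat (n := N))//= [X in _ = X - _](big_cat_nat (n := N))//=.
rewrite [X in _ = X - _]addrC addrK big_nat_cond big1 ?add0r.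
  by apply: eq_big_nat => j /andP[Nj _]; rewrite /tail_from ltnNge Nj.
by move=> j /andP[/andP[_ jN] _]; rewrite /tail_from jN mul0r.
Qed.

End SquareSummable.

(** * The interpolation error at a fixed parameter *)

Section InterpolationError.
Context {R : realType}.
Local Notation mu2 := (@leb2 R).
Variables (x : nat -> R * R) (delta al : R) (f Fc : R * R -> R[i]) (a : nat -> R[i]).
Variables (m K1 K A C : R).
Local Notation G := (poisson_symbol al).
Hypothesis al0 : 0 < al.
Hypothesis K10 : 0 < K1.
Hypothesis GK1 : forall xi, G xi <= K1 * pexp xi.
Hypothesis K0 : 0 < K.
Hypothesis GK : forall xi, ~ S_ delta xi -> G xi <= K * pexp xi.
Hypothesis Fi : cintg mu2 Fc.
Hypothesis F2 : intg mu2 (fun xi => cabs2 (Fc xi)).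
Hypothesis fE : forall y, f y = ifourier Fc y.
Hypothesis m0 : 0 < m.
Hypothesis Fm : forall xi, Fc xi <> 0 -> m <= G xi.
Hypothesis FS : forall xi, ~ S_ delta xi -> Fc xi = 0.
Hypothesis A0 : 0 < A.
Hypothesis riesz_lb : forall (N : nat) (c : nat -> R[i]),
  ((A * \sum_(j < N) cabs2 (c j))%R%:E <= L2sq (S_ delta) (csum N c x))%E.
Hypothesis complete : forall g, L2on (S_ delta) g -> forall eps : R, 0 < eps ->
  exists N c, (L2sq (S_ delta) (fun xi => (g xi - csum N c x xi)%R) < eps%:E)%E.
Hypothesis C0 : 0 < C.
Hypothesis HC : forall (N : nat) (c : nat -> R[i]),
  \int[mu2]_xi (pexp xi * cabs2 (csum N c x xi)) <= C * \sum_(j < N) cabs2 (c j).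
Hypothesis a2 : ell2 a.
Hypothesis interp : forall k, poisson_sum al a x (x k) = f (x k).

Let G0 xi : 0 <= G xi. Proof. exact: poisson_symbol_ge0. Qed.
Let Gi : intg mu2 G. Proof. exact: poisson_symbol_int. Qed.
(** After conjugation a sample f (x k) becomes the inner product of H with e^(i<.,x_k>) itself and
    not with its conjugate, which matches the exponentials of the Riesz basis. *)
Let b j := conjc (a j).
Let H xi := conjc (Fc xi).

Let b2 : ell2 b.
Proof. by move: a2; rewrite /ell2 /b; under [in X in _ -> X]eq_fun do rewrite cabs2J. Qed.

Definition partial_interp N y : R[i] := \sum_(j < N) a j * (poisson al (sub2 y (x j)))%:C%C.
Local Notation I := partial_interp.

Lemma poisson_even (u v : R * R) : poisson al (sub2 u v) = poisson al (sub2 v u).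
Proof.
rewrite /poisson; congr (_ * powR _ _); congr (_ + _).
by rewrite /nrm2sq /sub2 /=; ring.
Qed.

Lemma cfourier_csum N y :
  cfourier (fun xi => (G xi)%:C%C * csum N b x xi) y = conjc (I N y).
Proof.
transitivity (CI mu2 (fun xi => \sum_(j < N) b j * ((G xi)%:C%C * expi (dot2 xi (sub2 (x j) y))))).
  apply: eq_CI => xi; rewrite /csum mulr_sumr mulr_suml; apply: eq_bigr => j _.
  have -> : expi (dot2 xi (sub2 (x j) y)) = expi (dot2 xi (x j)) * conjc (expi (dot2 xi y)).
    by rewrite -expiN -expiD; congr expi; rewrite /dot2 /sub2 /=; ring.
  by ring.
have gi (z : R * R) : cintg mu2 (fun xi => (G xi)%:C%C * expi (dot2 xi z)).
  by apply: cintg_expi; exact: cintg_real.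
rewrite CI_sum; last by move=> j _; exact: cintgZ.
rewrite rmorph_sum; apply: eq_bigr => j _; rewrite CIZ//.
have cE (p : R) : conjc (a j * p%:C%C) = b j * p%:C%C.
  by apply: complexP; rewrite /b !reim /=; ring.
rewrite [RHS]cE poisson_even; congr (_ * _); exact: poisson_symbolP.
Qed.

Let gram_const : R := K1 * C.
Let T0 : 0 < gram_const. Proof. exact: mulr_gt0. Qed.

Let gram_le N c : \int[mu2]_xi (G xi * cabs2 (csum N c x xi)) <=
  gram_const * \sum_(j < N) cabs2 (c j).
Proof.
have pc : intg mu2 (fun xi => pexp xi * cabs2 (csum N c x xi)).
  by apply: intg_csum; exact: pexp_int.
apply: (@le_trans _ _ (K1 * \int[mu2]_xi (pexp xi * cabs2 (csum N c x xi)))).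
  rewrite -(RIZ _ pc); apply: (@le_RI _ _ _ mu2); [exact: intg_csum Gi|exact: intgZ pc|].
  by move=> xi; rewrite mulrA ler_wpM2r ?cabs2_ge0.
by rewrite -mulrA ler_wpM2l ?(ltW K10).
Qed.

Lemma cfourier_tail N J y : (N <= J)%N ->
  cfourier (fun xi => (G xi)%:C%C * csum J (tail_from b N) x xi) y = conjc (I J y - I N y).
Proof.
move=> NJ; rewrite conjB -!cfourier_csum -CIB; try by apply: cintg_conj_expi; exact: real_csum_cintg.
by apply: eq_CI => xi; rewrite csum_tail//; ring.
Qed.

(** The Gram bound against the single node y, with coefficient constant the integral of G; the added
    1 keeps it positive. It shows that the partial interpolants are Cauchy at every point of the
    plane. *)
Lemma partial_interp_point N J y : (N <= J)%N -> cabs2 (I J y - I N y) <=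
  gram_const * (\int[mu2]_xi G xi + 1) * \sum_(j < J) cabs2 (tail_from b N j).
Proof.
move=> NJ; have TT : 0 < \int[mu2]_xi G xi + 1 by rewrite ltr_wpDl// RI_ge0.
have := @gram_bound R G x (fun=> y) gram_const (\int[mu2]_xi G xi + 1) J 1 (tail_from b N) G0 Gi TT
  (gram_le J (tail_from b N)).
rewrite big_ord1 cfourier_tail// cabs2J; apply => c.
rewrite big_ord1.
have -> : \int[mu2]_xi (G xi * cabs2 (csum 1 c (fun=> y) xi)) =
    cabs2 (c 0%N) * \int[mu2]_xi G xi.
  rewrite -(RIZ _ Gi); apply: RI_ext => xi.
  by rewrite /csum big_ord1 cabs2M cabs2_expi mulr1 mulrC.
by rewrite [leRHS]mulrDl mul1r mulrC lerDl cabs2_ge0.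
Qed.

(** The Gram bound against the nodes themselves. It is uniform in the number [M] of samples, so the
    sample sequence depends continuously in l2 on the coefficients. *)
Lemma partial_interp_samples N J M : (N <= J)%N ->
  \sum_(k < M) cabs2 (I J (x k) - I N (x k)) <=
  gram_const * gram_const * \sum_(j < J) cabs2 (tail_from b N j).
Proof.
move=> NJ; have := @gram_bound R G x x gram_const gram_const J M (tail_from b N) G0 Gi T0
  (gram_le J (tail_from b N)) (gram_le M).
by under eq_bigr do rewrite cfourier_tail// cabs2J.
Qed.

Lemma cabs2_lt_reim (z : R[i]) (e : R) : 0 < e -> cabs2 z <= e ^+ 2 ->
  `|complex.Re z| <= e /\ `|complex.Im z| <= e.
Proof.
move=> e0; rewrite /cabs2 => h.
have r := sqr_ge0 (complex.Re z); have i := sqr_ge0 (complex.Im z).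
split; rewrite -(ger0_norm (ltW e0)) -ler_sqr ?nnegrE// !real_normK ?num_real//; lra.
Qed.

(** [poisson_sum] is defined through [limn], which has a default value on divergent sequences; its
    meaning rests on this convergence, which follows from the tail bound at y. *)
Lemma partial_interp_cvg y :
  (fun N => complex.Re (I N y)) @ \oo --> complex.Re (poisson_sum al a x y) /\
  (fun N => complex.Im (I N y)) @ \oo --> complex.Im (poisson_sum al a x y).
Proof.
have reE : (fun N => complex.Re (I N y)) =
    series (fun j => complex.Re (a j) * poisson al (sub2 y (x j))).
  apply/funext => N; rewrite seriesEord Re_sum; apply: eq_bigr => j _.
  by rewrite reim /= mulr0 subr0.
have imE : (fun N => complex.Im (I N y)) =
    series (fun j => complex.Im (a j) * poisson al (sub2 y (x j))).
  apply/funext => N; rewrite seriesEord Im_sum; apply: eq_bigr => j _.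
  by rewrite reim /= mulr0 add0r.
have cau (e : R) : 0 < e -> exists N, forall J, (N <= J)%N ->
    `|complex.Re (I N y) - complex.Re (I J y)| <= e /\
    `|complex.Im (I N y) - complex.Im (I J y)| <= e.
  move=> e0; set TT := gram_const * (\int[mu2]_xi G xi + 1).
  have TT0 : 0 < TT by rewrite mulr_gt0// ltr_wpDl// RI_ge0.
  have [N0 HN] := tail_small b2 (divr_gt0 (exprn_gt0 2 e0) TT0).
  exists N0 => J NJ; have := partial_interp_point y NJ; rewrite -/TT => h.
  have h2 : cabs2 (I J y - I N0 y) <= e ^+ 2.
    apply: (le_trans h); rewrite mulrC -ler_pdivlMr//; exact: HN.
  have [] := cabs2_lt_reim e0 h2; rewrite !reim => h3 h4.
  by split; rewrite distrC.
have c1 : cvgn (fun N => complex.Re (I N y)).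
  by apply: cvgn_of_tail => e /cau[N HN]; exists N => J /HN[].
have c2 : cvgn (fun N => complex.Im (I N y)).
  by apply: cvgn_of_tail => e /cau[N HN]; exists N => J /HN[].
by rewrite /poisson_sum /= -reE -imE.
Qed.

Lemma cvg_cabs2 (u : nat -> R[i]) (v z : R[i]) :
  (fun n => complex.Re (u n)) @ \oo --> complex.Re v ->
  (fun n => complex.Im (u n)) @ \oo --> complex.Im v ->
  (fun n => cabs2 (u n - z)) @ \oo --> cabs2 (v - z).
Proof.
move=> c1 c2; rewrite /cabs2 !reim.
rewrite (_ : (fun n => _) = (fun n => (complex.Re (u n) - complex.Re z) ^+ 2 +
   (complex.Im (u n) - complex.Im z) ^+ 2)); last by apply/funext => n; rewrite !reim.
rewrite !expr2; under eq_fun do rewrite !expr2.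
by apply: cvgD; apply: cvgM; apply: cvgB => //; exact: cvg_cst.
Qed.

(** The interpolation conditions enter here: f (x k) is the limit of the partial interpolants at x
    k, and the bound between two partial interpolants is closed under this limit for each finite
    [M]. *)
Lemma sample_error N (e : R) M : (forall J, (N <= J)%N ->
    \sum_(j < J) cabs2 (tail_from b N j) <= e) ->
  \sum_(k < M) cabs2 (f (x k) - I N (x k)) <= gram_const * gram_const * e.
Proof.
move=> He.
have cv : (fun J => \sum_(k < M) cabs2 (I J (x k) - I N (x k))) @ \oo -->
    \sum_(k < M) cabs2 (f (x k) - I N (x k)).
  elim: M => [|M ih].
    rewrite big_ord0; under eq_fun do rewrite big_ord0; exact: cvg_cst.
  rewrite big_ord_recr /=; under eq_fun do rewrite big_ord_recr /=.
  apply: cvgD; first exact: ih.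
  have [c1 c2] := partial_interp_cvg (x M).
  by rewrite -interp; exact: cvg_cabs2.
apply: (@closed_cvg _ _ \oo _ _ [set r | r <= _] _ _ _ cv); first exact: closed_le.
exists N => // J /= NJ; apply: (le_trans (partial_interp_samples M NJ)).
by apply: ler_wpM2l; [apply: mulr_ge0; exact: ltW T0|exact: He].
Qed.

Lemma partial_error N :
  (fun y => f y - I N y) = ifourier (fun xi => conjc (residual x G H N b xi)).
Proof.
apply/funext => y.
have Hi : cintg mu2 H by exact: cintgJ.
have hi := residual_cintg x Gi Hi N b.
have -> : f y - I N y = conjc (cfourier (residual x G H N b) y).
  have -> : cfourier (residual x G H N b) y = cfourier H y -
     cfourier (fun xi => (G xi)%:C%C * csum N b x xi) y.
    rewrite /cfourier -CIB; [|exact: cintg_conj_expi|by apply: cintg_conj_expi; exact: real_csum_cintg].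
    by apply: eq_CI => xi; rewrite /residual; ring.
  rewrite cfourier_csum conjB conjcK; congr (_ - _).
  rewrite fE /ifourier /cfourier -CIJ; last exact: cintg_conj_expi.
  by apply: eq_CI => xi; rewrite conjM /H !conjcK.
rewrite /cfourier /ifourier -CIJ; last exact: cintg_conj_expi.
by apply: eq_CI => xi; rewrite conjM conjcK.
Qed.

Lemma interpolation_error (e : R) : 0 < e ->
  (L2sq setT (fun y => (f y - poisson_sum al a x y)%R) <=
   (8 * pi ^+ 2 * ((2 * C / A + 1) * (K * (m^-1 * \int[mu2]_xi cabs2 (Fc xi))) + e))%R%:E)%E.
Proof.
move=> e0.
have Hi : cintg mu2 H by exact: cintgJ.
have H2 : intg mu2 (fun xi => cabs2 (H xi)).
  by apply: (@eq_intg _ _ _ mu2 (fun xi => cabs2 (Fc xi))) => // xi; rewrite cabs2J.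
have HE : \int[mu2]_xi cabs2 (H xi) = \int[mu2]_xi cabs2 (Fc xi).
  by apply: RI_ext => xi; rewrite cabs2J.
have Hm xi : H xi <> 0 -> m <= G xi.
  by move=> h; apply: Fm => z; apply: h; rewrite /H z conjc0.
have HS xi : ~ S_ delta xi -> H xi = 0 by move=> h; rewrite /H FS ?conjc0.
have GK1' xi : G xi <= K1.
  by rewrite (le_trans (GK1 xi))// ler_piMr ?pexp_le1// ltW.
pose A2 := limn (series (fun j => cabs2 (b j))).
have A20 : 0 <= A2 by have := partial_cabs2_le b2 0; rewrite big_ord0.
pose Z := (2 * C / A + 1) * K.
have Z0 : 0 < Z by rewrite mulr_gt0// ltr_wpDl// divr_ge0 ?(ltW A0)// mulr_ge0// ltW.
(* Three error terms get e/3 each. [l] makes Z l A2 small, with A2 + 1 in place of A2 to avoid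
   dividing by 0; [w] is taken after [l] and makes 2 w / A and Z w / l small. [A2] bounds all
   partial sums, so both are fixed before the truncation [N]. *)
pose l := e / (3 * (Z * (A2 + 1))).
have A21 : 0 < A2 + 1 by rewrite ltr_wpDl.
have l0 : 0 < l by exact: divr_gt0 e0 (mulr_gt0 (ltr0n R 3) (mulr_gt0 Z0 A21)).
pose w := Num.min (e * A / 6) (e * l / (3 * Z)).
have w0 : 0 < w.
  rewrite lt_min (divr_gt0 (mulr_gt0 e0 A0) (ltr0n R 6)).
  exact: divr_gt0 (mulr_gt0 e0 l0) (mulr_gt0 (ltr0n R 3) Z0).
have TT : 0 < gram_const * gram_const by exact: mulr_gt0.
have [N0 HN0] := tail_small b2 (divr_gt0 w0 TT).
have hle N : (N0 <= N)%N -> \int[mu2]_xi cabs2 (residual x G H N b xi) <=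
    (2 * C / A + 1) * (K * (m^-1 * \int[mu2]_xi cabs2 (Fc xi))) + e.
  move=> N0N.
  have hw M : \sum_(k < M) cabs2 (cfourier (residual x G H N b) (x k)) <= w.
    have E k : cabs2 (cfourier (residual x G H N b) (x k)) = cabs2 (f (x k) - I N (x k)).
      rewrite -cabs2J -[f (x k) - _]/((fun y => f y - I N y) (x k)) (partial_error N).
      congr cabs2; rewrite /cfourier /ifourier -CIJ; last first.
        by apply: cintg_conj_expi; exact: residual_cintg.
      by apply: eq_CI => xi; rewrite conjM conjcK.
    under eq_bigr do rewrite E.
    apply: (le_trans (@sample_error N (w / (gram_const * gram_const)) M _)).
      by move=> J; exact: HN0.
    by rewrite mulrC divfK// gt_eqF.
  have bA := partial_cabs2_le b2 N.
  have := @main_estimate R x delta G H m K1 K A C G0 Gi GK1' K0 GK Hi H2 m0 Hm HS A0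
    riesz_lb complete C0 HC N b w A2 l hw bA l0.
  rewrite HE => h; apply: (le_trans h).
  set X := m^-1 * _.
  have w1 : 2 / A * w <= e / 3.
    apply: (@le_trans _ _ (2 / A * (e * A / 6))).
      by rewrite ler_wpM2l ?divr_ge0 ?(ltW A0)// ge_min lexx.
    rewrite le_eqVlt; apply/orP; left; apply/eqP; field; by rewrite gt_eqF.
  have w2 : Z * (l^-1 * w) <= e / 3.
    apply: (@le_trans _ _ (Z * (l^-1 * (e * l / (3 * Z))))).
      rewrite ler_wpM2l ?(ltW Z0)// ler_wpM2l ?invr_ge0 ?(ltW l0)// ge_min lexx orbT//.
    rewrite le_eqVlt; apply/orP; left; apply/eqP; field.
    by rewrite (gt_eqF Z0) (gt_eqF l0).
  have w3 : Z * (l * A2) <= e / 3.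
    apply: (@le_trans _ _ (Z * (l * (A2 + 1)))).
      by rewrite ler_wpM2l ?(ltW Z0)// ler_wpM2l ?(ltW l0)// lerDl.
    rewrite /l le_eqVlt; apply/orP; left; apply/eqP; field.
    by rewrite (gt_eqF Z0) (gt_eqF A21).
  have -> : (2 * C / A + 1) * (K * (X + l * A2 + l^-1 * w)) =
     (2 * C / A + 1) * (K * X) + Z * (l * A2) + Z * (l^-1 * w) by rewrite /Z; ring.
  lra.
have pe N : (N0 <= N)%N -> (\int[mu2]_y (cabs2 (f y - I N y)%R)%:E <=
   (8 * pi ^+ 2 * ((2 * C / A + 1) * (K * (m^-1 * \int[mu2]_xi cabs2 (Fc xi))) + e))%R%:E)%E.
  move=> N0N; have hi : cintg mu2 (residual x G H N b) by exact: residual_cintg.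
  have h2 : intg mu2 (fun xi => cabs2 (residual x G H N b xi)).
    exact: (residual_L2 x G0 Gi GK1' Hi H2 N b).
  have h2' : intg mu2 (fun xi => cabs2 (conjc (residual x G H N b xi))).
    by apply: (@eq_intg _ _ _ mu2 _ _ _ h2) => xi; rewrite cabs2J.
  have := plancherel_le (cintgJ hi) h2'.
  rewrite -(partial_error N) => /le_trans; apply; rewrite lee_fin.
  rewrite ler_wpM2l ?mulr_ge0 ?exprn_ge0 ?pi_ge0//.
  have -> : \int[mu2]_xi cabs2 (conjc (residual x G H N b xi)) =
     \int[mu2]_xi cabs2 (residual x G H N b xi) by apply: RI_ext => xi; rewrite cabs2J.
  exact: hle.
(* The bound is available only for truncations from [N0] on, hence the shifted sequence. *)
apply: (@fatou_bound _ _ _ mu2 (fun n y => cabs2 (f y - I (n + N0) y))).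
- move=> n; apply: measurable_cabs2; rewrite partial_error.
  by apply: cmeas_ifourier; apply: cintgJ; exact: residual_cintg.
- by move=> n y; exact: cabs2_ge0.
- move=> y; have [c1 c2] := partial_interp_cvg y.
  have cJ (u v : R[i]) : cabs2 (u - v) = cabs2 (v - u) by rewrite -cabs2N opprB.
  rewrite cJ (_ : (fun n => _) = (fun n => cabs2 (I (n + N0) y - f y))).
    have := @cvg_cabs2 (fun N => I N y) _ (f y) c1 c2.
    by rewrite -(cvg_shiftn N0).
  by apply/funext => n; rewrite cJ.
- by move=> n; apply: pe; rewrite leq_addl.
Qed.

End InterpolationError.

(** * Decay constants and the conclusion *)

Section Constants.
Context {R : realType}.
Implicit Types (xi : R * R) (al delta beta : R).

Lemma max_norm_sqr_le xi : Num.max `|xi.1| `|xi.2| ^+ 2 <= nrm2sq xi.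
Proof.
rewrite /nrm2sq -(real_normK (num_real xi.1)) -(real_normK (num_real xi.2)).
have h1 := sqr_ge0 `|xi.1|; have h2 := sqr_ge0 `|xi.2|.
by case: (leP `|xi.1| `|xi.2|) => _; [rewrite lerDr|rewrite lerDl].
Qed.

Lemma max_norm_gt delta xi : ~ S_ delta xi -> delta < Num.max `|xi.1| `|xi.2|.
Proof.
move=> nS; rewrite ltNge; apply/negP; rewrite ge_max => /andP[h1 h2].
by apply: nS.
Qed.

Lemma expR_max_norm_le xi : expR (- (2 * Num.max `|xi.1| `|xi.2|)) <= pexp xi.
Proof.
rewrite /pexp -expRD ler_expR.
have h1 : `|xi.1| <= Num.max `|xi.1| `|xi.2| by rewrite le_max lexx.
have h2 : `|xi.2| <= Num.max `|xi.1| `|xi.2| by rewrite le_max lexx orbT.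
lra.
Qed.

(** A factor e^(-2r) of the decay in r = max(|xi_1|, |xi_2|) is set aside to be dominated by [pexp],
    which leaves the exponent al/2 - 2. The maximum norm is used because it exceeds delta off the
    square. *)
Lemma symbol_decay (C1 : R) al xi : 0 < C1 ->
  (forall al xi r, 0 < al -> 0 <= r -> r ^+ 2 <= nrm2sq xi ->
    poisson_symbol al xi <= C1 * expR (- (al * r / 2))) -> 0 < al ->
  poisson_symbol al xi <=
    C1 * expR (- ((al / 2 - 2) * Num.max `|xi.1| `|xi.2|)) * pexp xi.
Proof.
move=> C10 ub a0; set r := Num.max _ _.
have r0 : 0 <= r by rewrite le_max normr_ge0.
apply: (le_trans (ub al xi r a0 r0 (max_norm_sqr_le xi))).
apply: (@le_trans _ _ (C1 * expR (- ((al / 2 - 2) * r)) * expR (- (2 * r)))).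
  rewrite -[leRHS]mulrA -expRD le_eqVlt; apply/orP; left; apply/eqP; congr (_ * expR _).
  by field.
apply: ler_wpM2l; last exact: expR_max_norm_le.
by rewrite mulr_ge0 ?expR_ge0// ltW.
Qed.

Lemma ball2_sub_S beta delta xi : 0 < beta -> beta <= delta -> ball2 beta xi -> S_ delta xi.
Proof.
rewrite /ball2 /= => b0 bd h.
have H (t : R) : t ^+ 2 <= nrm2sq xi -> `|t| <= delta.
  move=> ht; apply: le_trans bd.
  by rewrite -(ger0_norm (ltW b0)) -ler_sqr ?nnegrE// !real_normK ?num_real// (le_trans ht).
by split; apply: H; rewrite /nrm2sq ?lerDl ?lerDr ?sqr_ge0.
Qed.

Lemma three_minus_sqrt8_lt : 3 - Num.sqrt 8 < 4^-1 :> R.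
Proof.
(* The rational 14/5 has square 7.84 < 8, and 3 - 14/5 = 1/5. *)
have : 14 / 5 <= Num.sqrt 8 :> R; last by lra.
by rewrite -(@ger0_norm _ (14 / 5 : R))// -sqrtr_sqr ler_wsqrtr//; lra.
Qed.

Lemma expRN_le_inv (u : R) : 0 < u -> expR (- u) <= u^-1.
Proof.
move=> u0; rewrite expRN lef_pV2 ?posrE ?expR_gt0//.
by have := expR_ge1Dx u; lra.
Qed.

End Constants.

Theorem theorem2 (R : realType) (delta beta : R) (x : nat -> R * R)
    (f : R * R -> R[i]) (a : R -> nat -> R[i]) :
  0 < delta ->
  complete_interpolating (S_ delta) x ->
  0 < beta -> beta < (3 - Num.sqrt 8) * delta ->
  PW (B_ beta) f ->
  continuous (fun y : R * R => complex.Re (f y)) ->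
  continuous (fun y : R * R => complex.Im (f y)) ->
  (forall al : R, 0 < al ->
     ell2 (a al) /\ (forall k : nat, poisson_sum al (a al) x (x k) = f (x k))) ->
  (fun al : R => L2sq setT (fun y => f y - poisson_sum al (a al) x y)) @ +oo
    --> 0%E.
Proof.
move=> d0 [[A [B [A0 [B0 riesz]]]] complete] b0 bd [fL2 [F [fF F0]]] c1 c2 interp.
have b4 : beta < delta / 4.
  apply: (lt_trans bd); rewrite mulrC ltr_pM2l//; exact: three_minus_sqrt8_lt.
(* The inversion factor is put into the symbol, so that f is exactly [ifourier Fc]; the cut makes
   [Fc] vanish at every point outside the ball. *)
pose Fc xi : R[i] := ((2 * pi)^-1)%:C%C * Fcut F beta xi.
have Fi : cintg (@leb2 R) Fc by apply: cintgZ; exact: Fcut_L1 fF.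
have F2 : intg (@leb2 R) (fun xi => cabs2 (Fc xi)).
  apply: (@eq_intg _ _ _ (@leb2 R) (fun xi => cabs2 ((2 * pi)^-1)%:C%C * cabs2 (Fcut F beta xi))).
    by move=> xi; rewrite /Fc cabs2M.
  by apply: intgZ; exact: Fcut_L2 fF.
have fE y : f y = ifourier Fc y.
  rewrite (fourier_inversion y fL2 fF F0 c1 c2) /ifourier -CIZ.
    by apply: eq_CI => xi; rewrite /Fc mulrA.
  by apply: cintg_expi; exact: Fcut_L1 fF.
have nball xi : ~ ball2 beta xi -> Fc xi = 0.
  by move=> nb; rewrite /Fc /Fcut indicE memNset// mul0r mulr0.
have [C C0 HC] := bessel d0 B0 (fun N c => (riesz N c).2).
have [C1 C10 ub] := @poisson_symbol_ub R.
have [cl cl0 lb] := poisson_symbol_lb b0.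
set I2 := \int[@leb2 R]_xi cabs2 (Fc xi).
have I20 : 0 <= I2 by apply: RI_ge0 => xi; exact: cabs2_ge0.
(* What does not depend on [al] in the error bound: K / m = (C1 / cl) e^(2 delta) e^(-al gam). *)
pose W := (2 * C / A + 1) * (C1 / cl) * expR (2 * delta) * I2.
have W0 : 0 <= W.
  have cA : 0 <= 2 * C / A + 1 by rewrite addr_ge0// divr_ge0 ?mulr_ge0 ?(ltW C0) ?(ltW A0).
  have cc : 0 <= C1 / cl by rewrite divr_ge0 ?ltW.
  by apply: mulr_ge0 => //; apply: mulr_ge0; [exact: mulr_ge0|exact: expR_ge0].
(* The decay of the symbol off the square competes with its minimum on the ball; their balance is
   positive exactly when beta < delta / 4. *)
pose gam := delta / 2 - 2 * beta.
have gam0 : 0 < gam by rewrite /gam; lra.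
(* From 4 on, the exponent al/2 - 2 is nonnegative, so the symbol is bounded by C1 pexp on the whole
   plane as well; the lower bound of the symbol only asks for al >= 1. *)
have err al : 4 <= al -> forall e, 0 < e ->
    (L2sq setT (fun y => (f y - poisson_sum al (a al) x y)%R) <=
      (8 * pi ^+ 2 * (W * expR (- (al * gam)) + e))%R%:E)%E.
  move=> al4 e e0; have al0 : 0 < al by lra.
  have [a2 ai] := interp al al0.
  pose K := C1 * expR (- ((al / 2 - 2) * delta)).
  pose m := cl * expR (- (2 * al * beta)).
  have al2 : 0 <= al / 2 - 2 by lra.
  have GK1 xi : poisson_symbol al xi <= C1 * pexp xi.
    apply: (le_trans (symbol_decay xi C10 ub al0)).
    apply: ler_wpM2r; first exact: pexp_ge0.
    have r0 : 0 <= Num.max `|xi.1| `|xi.2| by rewrite le_max normr_ge0.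
    rewrite -[leRHS]mulr1; apply: ler_wpM2l; first exact: ltW.
    by rewrite -[leRHS]expR0 ler_expR oppr_le0; exact: mulr_ge0.
  have K0 : 0 < K by rewrite mulr_gt0 ?expR_gt0.
  have GK xi : ~ S_ delta xi -> poisson_symbol al xi <= K * pexp xi.
    move=> nS; apply: (le_trans (symbol_decay xi C10 ub al0)).
    apply: ler_wpM2r; first exact: pexp_ge0.
    rewrite ler_wpM2l ?(ltW C10)// ler_expR lerN2 ler_wpM2l//.
    exact/ltW/max_norm_gt.
  have m0 : 0 < m by rewrite mulr_gt0 ?expR_gt0.
  have Fm xi : Fc xi <> 0 -> m <= poisson_symbol al xi.
    move=> Fn; have [bx|nb] := pselect (ball2 beta xi); last by case: Fn; exact: nball.
    by apply: lb => //; lra.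
  have FS xi : ~ S_ delta xi -> Fc xi = 0.
    move=> nS; apply: nball => bx; apply: nS; apply: ball2_sub_S bx => //.
    by lra.
  have := @interpolation_error R x delta al f Fc (a al) m C1 K A C al0 C10 GK1 K0 GK
    Fi F2 fE m0 Fm FS A0 (fun N c => (riesz N c).1) complete C0 HC a2 ai e e0.
  rewrite -/I2; suff -> : (2 * C / A + 1) * (K * (m^-1 * I2)) = W * expR (- (al * gam)) by [].
  have -> : m^-1 = cl^-1 * expR (2 * al * beta).
    by rewrite /m invfM -expRN opprK.
  have E : expR (- ((al / 2 - 2) * delta)) * expR (2 * al * beta) =
     expR (2 * delta) * expR (- (al * gam)).
    by rewrite -!expRD /gam; congr expR; field.
  rewrite /K /W.
  transitivity ((2 * C / A + 1) * (C1 / cl) * I2 *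
    (expR (- ((al / 2 - 2) * delta)) * expR (2 * al * beta))).
    by move: (expR _) (expR _) (2 * C / A) (cl^-1) => *; ring.
  by rewrite E; move: (expR _) (expR _) (2 * C / A) (cl^-1) => *; ring.
apply: cvge0_intro => [al|e e0].
  by apply: integral_ge0 => y _; rewrite lee_fin cabs2_ge0.
have p0 := @pi_gt0 R.
have p2 : 0 < 8 * pi ^+ 2 :> R by rewrite mulr_gt0 ?exprn_gt0.
set P := 8 * pi ^+ 2 in p2 err.
near=> al.
have al4 : 4 <= al by near: al; apply: nbhs_pinfty_ge; exact: num_real.
(* Since e^(-u) <= 1/u, this threshold brings W e^(-al gam) below e / (2P), which is also the value
   given to the free error term. *)
have alW : 2 * P * W / (gam * e) <= al by near: al; apply: nbhs_pinfty_ge; exact: num_real.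
have al0 : 0 < al by lra.
have e2 : 0 < e / (2 * P) by rewrite divr_gt0// mulr_gt0.
apply: (le_trans (err al al4 _ e2)); rewrite lee_fin.
have ag : 0 < al * gam by rewrite mulr_gt0.
have h1 : W * expR (- (al * gam)) <= W * (al * gam)^-1.
  by rewrite ler_wpM2l// expRN_le_inv.
have h2 : W * (al * gam)^-1 <= e / (2 * P).
  rewrite ler_pdivrMr//; move: alW; rewrite ler_pdivrMr ?mulr_gt0// => alW.
  rewrite mulrAC ler_pdivlMr ?mulr_gt0//.
  have -> : W * (2 * P) = 2 * P * W by ring.
  have -> : e * (al * gam) = al * (gam * e) by ring.
  exact: alW.
rewrite [leRHS](_ : e = P * (e / (2 * P) + e / (2 * P))); last by field; rewrite gt_eqF.
by apply: ler_wpM2l; [exact: ltW|rewrite lerD2r; exact: le_trans h1 h2].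
Unshelve. all: by end_near. Qed.
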